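(* Let $H$ and $K$ be locally compact groups with $K$ abelian, let $\tau:H\to Aut(K)$ be a continuous homomorphism and let $G_\tau=H\ltimes_\tau K$. Then $L^1(G_\tau)$ with respect to the $\tau$-convolution $\stackrel{\tau}{\ast}$ and the $\tau$-involution $f\mapsto f^{*^\tau}$ is a Jordan Banach $*$-algebra.
   Context: $H,K$ have left Haar measures $dh$ (also written $dt$) and $dk$ (also $ds$); $\Delta_K$ is the modular function of $K$. A homomorphism $\tau:H\to Aut(K)$, $h\mapsto\tau_h$, is called continuous if $(h,k)\mapsto\tau_h(k)$ is continuous from $H\times K$ to $K$. The semidirect product $G_\tau=H\ltimes_\tau K$ is the set $H\times K$ with the product topology and the operation $(h,k)\ltimes_\tau(h',k')=(hh',k\tau_h(k'))$. The continuous homomorphism $\delta:H\to(0,\infty)$ is given by $dk=\delta(h)\,d(\tau_h(k))$, i.e. $|E|=\delta(h)|\tau_h(E)|$ for Haar measure $|\cdot|$ on $K$; a left Haar measure of $G_\tau$ is $\delta(h)\,dh\,dk$, and $L^1(G_\tau)$ is taken with respect to it. For $f\in L^1(G_\tau)$ and $t\in H$ put $f_t(k)=f(t,k)$. With $\ast$ the standard convolution on $L^1(K)$, for $f,g\in L^1(G_\tau)$ put $$f\stackrel{\tau_r}{\ast}g(h,k)=\int_H f_h\ast g_t(k)\,\delta(t)\,dt,\qquad f\stackrel{\tau_l}{\ast}g(h,k)=\int_H f_t\ast g_h(k)\,\delta(t)\,dt,$$ and define the $\tau$-convolution $f\stackrel{\tau}{\ast}g=2^{-1}(f\stackrel{\tau_r}{\ast}g+f\stackrel{\tau_l}{\ast}g)$.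 The $\tau$-involution is $f^{*^\tau}(h,k)=(f_h)^*(k)$, where $\psi^*(k)=\Delta_K(k^{-1})\overline{\psi(k^{-1})}$ is the standard involution of $L^1(K)$. A non-associative (i.e. not necessarily associative) Banach $*$-algebra is a Banach space with a bilinear product satisfying $\|xy\|\le\|x\|\|y\|$ and an isometric conjugate-linear involution with $x^{**}=x$ and $(xy)^*=y^*x^*$. It is a Jordan Banach $*$-algebra if moreover the product is commutative and satisfies the Jordan identity $(xy)x^2=x(yx^2)$ for all $x,y$. *)

(* Defs.v *)
From HB Require Import structures.
From mathcomp Require Import all_boot all_order all_algebra.
From mathcomp Require Import all_classical all_reals all_analysis.
From mathcomp Require Import measurable_realfun.

Set Implicit Arguments.
Unset Strict Implicit.
Unset Printing Implicit Defensive.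

Import Order.TTheory GRing.Theory Num.Theory.
Import numFieldNormedType.Exports.
(* Required last so that Re and Im are the projections of R[i]. *)
From mathcomp Require Import complex.

Local Open Scope classical_set_scope.
Local Open Scope ring_scope.

Section integralC.
Context d (T : measurableType d) (R : realType).
Variable mu : {measure set T -> \bar R}.

Definition integrableC (f : T -> R[i]) : Prop :=
  mu.-integrable setT (fun x => (Re (f x))%:E) /\
  mu.-integrable setT (fun x => (Im (f x))%:E).

Definition integralC (f : T -> R[i]) : R[i] :=
  ((\int[mu]_x Re (f x)) +i* (\int[mu]_x Im (f x)))%C.

Definition L1pred : {pred T -> R[i]} := fun f => `[< integrableC f >].

Lemma L1predP (f : T -> R[i]) : reflect (integrableC f) (f \in L1pred).
Proof. exact: asboolP. Qed.

Let ReD (x y : R[i]) : Re (x + y) = Re x + Re y. Proof. by case: x; case: y. Qed.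
Let ImD (x y : R[i]) : Im (x + y) = Im x + Im y. Proof. by case: x; case: y. Qed.
Let ReM (x y : R[i]) : Re (x * y) = Re x * Re y - Im x * Im y.
Proof. by case: x; case: y. Qed.
Let ImM (x y : R[i]) : Im (x * y) = Re x * Im y + Im x * Re y.
Proof. by case: x; case: y. Qed.

Lemma L1pred_submod_closed : submod_closed L1pred.
Proof.
split.
  by apply/L1predP; split; exact: integrable0.
move=> a f g /L1predP[fr fi] /L1predP[gr gi]; apply/L1predP; split.
- have -> : (fun x => (Re ((a *: f + g) x))%:E) =
    (((fun x => (Re a)%:E * (Re (f x))%:E) \+
      (fun x => (- Im a)%:E * (Im (f x))%:E)) \+ (fun x => (Re (g x))%:E))%E.
    by apply/funext => x; rewrite /= ReD ReM -!EFinM -!EFinD mulNr.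
  by do 2?apply: integrableD => //; exact: integrableZl.
- have -> : (fun x => (Im ((a *: f + g) x))%:E) =
    (((fun x => (Re a)%:E * (Im (f x))%:E) \+
      (fun x => (Im a)%:E * (Re (f x))%:E)) \+ (fun x => (Im (g x))%:E))%E.
    by apply/funext => x; rewrite /= ImD ImM -!EFinM -!EFinD.
  by do 2?apply: integrableD => //; exact: integrableZl.
Qed.

HB.instance Definition _ := GRing.isSubmodClosed.Build R[i] (T -> R[i]) L1pred
  L1pred_submod_closed.

Record L1fun := MkL1fun { L1val :> T -> R[i]; L1valP : L1val \in L1pred }.

HB.instance Definition _ := [isSub for L1val].
HB.instance Definition _ := [Choice of L1fun by <:].
HB.instance Definition _ := [SubChoice_isSubLmodule of L1fun by <:].

Lemma L1funP (f : L1fun) : integrableC f.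
Proof. exact/L1predP/L1valP. Qed.

Definition ae_eqC (f g : L1fun) : bool := `[< \forall x \ae mu, f x = g x >].

Let ae_eqC_refl : reflexive ae_eqC.
Proof. by move=> f; apply/asboolP/nearW. Qed.

Let ae_eqC_sym : symmetric ae_eqC.
Proof.
by move=> f g; apply/asboolP/asboolP; apply: filterS => x ->.
Qed.

Let ae_eqC_trans : transitive ae_eqC.
Proof.
move=> f g h /asboolP gf /asboolP fh; apply/asboolP.
by apply: filterS2 gf fh => x -> ->.
Qed.

Canonical ae_eqC_equiv := EquivRel ae_eqC ae_eqC_refl ae_eqC_sym ae_eqC_trans.

Local Open Scope quotient_scope.

Definition L1 : Type := {eq_quot ae_eqC}.
HB.instance Definition _ := Choice.on L1.
HB.instance Definition _ := EqQuotient.on L1.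

Definition L1_to_fun (f : L1) : T -> R[i] := repr f : L1fun.
Coercion L1_to_fun : L1 >-> Funclass.

Definition L1class (f : L1fun) : L1 := \pi_L1 f.

Lemma L1classP (f g : L1fun) :
  L1class f = L1class g <-> \forall x \ae mu, f x = g x.
Proof.
split=> [/eqP|fg]; first by rewrite eqmodE => /asboolP.
by apply/eqP; rewrite eqmodE; exact/asboolP.
Qed.

Lemma L1class_repr (f : L1fun) : \forall x \ae mu, L1class f x = f x.
Proof. by apply/L1classP; rewrite /L1class reprK. Qed.

Let reprC (f : L1) : L1class (repr f) = f.
Proof. exact: reprK. Qed.

Definition L1_zero : L1 := L1class 0.
Definition L1_opp (f : L1) : L1 := L1class (- repr f).
Definition L1_add (f g : L1) : L1 := L1class (repr f + repr g).
Definition L1_scale (a : R[i]) (f : L1) : L1 := L1class (a *: repr f).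

Let oppC (f : L1fun) : L1_opp (L1class f) = L1class (- f).
Proof.
apply/L1classP; apply: filterS (L1class_repr f) => x fx.
by change (- L1class f x = - f x); rewrite fx.
Qed.

Let addC (f g : L1fun) : L1_add (L1class f) (L1class g) = L1class (f + g).
Proof.
apply/L1classP; apply: filterS2 (L1class_repr f) (L1class_repr g) => x fx gx.
by change (L1class f x + L1class g x = f x + g x); rewrite fx gx.
Qed.

Let scaleC a (f : L1fun) : L1_scale a (L1class f) = L1class (a *: f).
Proof.
apply/L1classP; apply: filterS (L1class_repr f) => x fx.
by change (a * L1class f x = a * f x); rewrite fx.
Qed.

Let L1_addA : associative L1_add.
Proof.
by move=> f g h; rewrite -(reprC f) -(reprC g) -(reprC h) !addC addrA.
Qed.

Let L1_addC : commutative L1_add.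
Proof. by move=> f g; rewrite -(reprC f) -(reprC g) !addC addrC. Qed.

Let L1_add0 : left_id L1_zero L1_add.
Proof. by move=> f; rewrite -(reprC f) addC add0r. Qed.

Let L1_addN : left_inverse L1_zero L1_opp L1_add.
Proof. by move=> f; rewrite -(reprC f) oppC addC addNr. Qed.

HB.instance Definition _ := GRing.isZmodule.Build L1
  L1_addA L1_addC L1_add0 L1_addN.

Let L1_scaleA a b (f : L1) : L1_scale a (L1_scale b f) = L1_scale (a * b) f.
Proof. by rewrite -(reprC f) !scaleC scalerA. Qed.

Let L1_scale1 : left_id 1 L1_scale.
Proof. by move=> f; rewrite -(reprC f) scaleC scale1r. Qed.

Let L1_scaleDr : right_distributive L1_scale +%R.
Proof.
move=> a f g; rewrite -(reprC f) -(reprC g).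
by rewrite -[_ + _]/(L1_add _ _) -[RHS]/(L1_add _ _) addC !scaleC addC scalerDr.
Qed.

Let L1_scaleDl (f : L1) : {morph L1_scale^~ f : a b / a + b}.
Proof.
move=> a b; rewrite -(reprC f) -[RHS]/(L1_add _ _) !scaleC addC.
by rewrite scalerDl.
Qed.

HB.instance Definition _ := GRing.Zmodule_isLmodule.Build R[i] L1
  L1_scaleA L1_scale1 L1_scaleDr L1_scaleDl.

Definition L1norm (f : L1) : R[i] := (\int[mu]_x Re `|f x|)%:C%C.

Let nrm (z : R[i]) : R := Re `|z|.

Let nrmE (z : R[i]) : (nrm z)%:C%C = `|z|.
Proof. by rewrite /nrm normc_def. Qed.

Let nrm_ge0 z : 0 <= nrm z.
Proof. by rewrite -lecR nrmE normr_ge0. Qed.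

Let nrmD x y : nrm (x + y) <= nrm x + nrm y.
Proof. by rewrite -lecR rmorphD/= !nrmE ler_normD. Qed.

Let nrmM x y : nrm (x * y) = nrm x * nrm y.
Proof. by apply: complexI; rewrite rmorphM/= !nrmE normrM. Qed.

Let nrm_eq0 x : nrm x = 0 -> x = 0.
Proof. by move=> x0; apply/eqP; rewrite -normr_eq0 -nrmE x0. Qed.

Let nrm_le z : nrm z <= `|Re z| + `|Im z|.
Proof.
rewrite /nrm normc_def /= -[leRHS]ger0_norm ?addr_ge0// -sqrtr_sqr.
rewrite ler_wsqrtr// sqrrD !real_normK ?num_real//.
by rewrite lerD2r lerDl mulrn_wge0// mulr_ge0.
Qed.

Let measurable_nrm (f : L1fun) : measurable_fun setT (fun x => nrm (f x)).
Proof.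
have [/measurable_int/measurable_EFinP fr /measurable_int/measurable_EFinP fi]
  := L1funP f.
have -> : (fun x => nrm (f x)) =
    @Num.sqrt R \o (fun x => Re (f x) ^+ 2 + Im (f x) ^+ 2).
  by apply/funext => x; rewrite /nrm normc_def.
apply: measurableT_comp.
  by apply: continuous_measurable_fun; exact: sqrt_continuous.
by apply: measurable_funD; exact: measurable_funX.
Qed.

Let integrable_nrm (f : L1fun) :
  mu.-integrable setT (EFin \o (fun x => nrm (f x))).
Proof.
have [fr fi] := L1funP f.
apply: (@le_integrable _ _ _ _ _ _ _
  ((abse \o (fun x => (Re (f x))%:E)) \+ (abse \o (fun x => (Im (f x))%:E)))%E).
- by [].
- exact/measurable_EFinP.
- move=> x _ /=; rewrite lee_fin [leLHS]ger0_norm// [leRHS]ger0_norm ?addr_ge0//.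
- by apply: integrableD => //; exact: integrable_abse.
Qed.

Let L1norm_class (f : L1fun) : L1norm (L1class f) = (\int[mu]_x nrm (f x))%:C%C.
Proof.
congr (_%:C)%C; rewrite /Rintegral; congr fine.
apply: ae_eq_integral => //.
- by apply/measurable_EFinP; exact: (measurable_nrm (repr (L1class f))).
- by apply/measurable_EFinP; exact: measurable_nrm.
- by apply: filterS (L1class_repr f) => x -> _.
Qed.

Let L1norm_ler_normD (f g : L1) : L1norm (f + g) <= L1norm f + L1norm g.
Proof.
rewrite -(reprC f) -(reprC g) -[X in L1norm X]/(L1_add _ _) addC !L1norm_class.
rewrite -rmorphD/= lecR -RintegralD//.
apply: le_Rintegral => //.
- exact: (integrable_nrm (repr f + repr g)).
- exact: (integrableD _ (integrable_nrm (repr f)) (integrable_nrm (repr g))).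
- by move=> x _; exact: nrmD.
Qed.

Let L1norm_normrZ (a : R[i]) (f : L1) : L1norm (a *: f) = `|a| * L1norm f.
Proof.
rewrite -(reprC f) -[X in L1norm X]/(L1_scale _ _) scaleC !L1norm_class.
rewrite -nrmE -rmorphM/=; congr (_%:C)%C.
rewrite -RintegralZl//.
by apply: eq_Rintegral => x _; rewrite /= -nrmM.
Qed.

Let L1norm_normr0_eq0 (f : L1) : L1norm f = 0 -> f = 0.
Proof.
rewrite -(reprC f) L1norm_class => /complexI f0.
apply/L1classP.
have := integrable_nrm (repr f).
move=> /[dup] /integrableP[mf _] /integrable_fin_num fn.
have : (\int[mu]_x `|(nrm (repr f x))%:E| = 0)%E.
  under eq_integral do rewrite gee0_abs ?lee_fin//.
  move: f0; rewrite /Rintegral => f0.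
  by rewrite -[LHS]fineK ?f0//; exact: fn.
move=> /(ae_eq_integral_abs mu measurableT mf).
by apply: filterS => x /(_ I) [] /nrm_eq0.
Qed.

HB.instance Definition _ := Lmodule_isNormed.Build R[i] L1
  L1norm_ler_normD L1norm_normrZ L1norm_normr0_eq0.

End integralC.

HB.mixin Record isTopGroup G of Group G & PointedTopological G := {
  mulg_continuous : continuous (fun x : G * G => (x.1 * x.2)%g);
  invg_continuous : continuous (fun x : G => (x^-1)%g)
}.

#[short(type="topGroupType")]
HB.structure Definition TopGroup :=
  {G of Group G & PointedTopological G & isTopGroup G}.

Definition lc_group (G : topGroupType) : Prop :=
  hausdorff_space G /\ locally_compact [set: G].

Record cont_hom_Aut (H K : topGroupType) := ContHomAut {
  autact :> H -> K -> K;
  autact_morph : forall h, {morph autact h : x y / (x * y)%g};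
  autact_bij : forall h, bijective (autact h);
  autact_hom : forall h h', autact (h * h')%g =1 autact h \o autact h';
  autact_continuous : continuous (fun x : H * K => autact x.1 x.2)
}.

Definition semidirect (H K : topGroupType) (tau : cont_hom_Aut H K) : Type :=
  (H * K)%type.

Section semidirect_topGroup.
Variables (H K : topGroupType) (tau : cont_hom_Aut H K).
Local Notation Gtau := (semidirect tau).

HB.instance Definition _ := Topological.copy Gtau (H * K)%type.
HB.instance Definition _ := isPointed.Build Gtau (1%g, 1%g).

Definition sd_one : Gtau := (1%g, 1%g).
Definition sd_mul (x y : Gtau) : Gtau :=
  ((x.1 * y.1)%g, (x.2 * tau x.1 y.2)%g).
Definition sd_inv (x : Gtau) : Gtau :=
  ((x.1^-1)%g, tau (x.1^-1)%g (x.2^-1)%g).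

Let tau1 k : tau 1%g k = k.
Proof.
apply: (bij_inj (autact_bij tau 1%g)).
by have /= <- := autact_hom tau 1%g 1%g k; rewrite mulg1.
Qed.

Let tauK1 h : tau h 1%g = 1%g.
Proof.
apply: (mulgI (tau h 1%g)).
by rewrite -autact_morph !mulg1.
Qed.

Let sd_mulA : associative sd_mul.
Proof.
move=> [a x] [b y] [c z]; rewrite /sd_mul/=; congr pair; first exact: mulgA.
by rewrite autact_morph mulgA (autact_hom tau a b).
Qed.

Let sd_mul1 : left_id sd_one sd_mul.
Proof. by move=> [a x]; rewrite /sd_mul/= !mul1g tau1. Qed.

Let sd_mulr1 : right_id sd_one sd_mul.
Proof. by move=> [a x]; rewrite /sd_mul/= tauK1 !mulg1. Qed.

Let sd_mulV : left_inverse sd_one sd_inv sd_mul.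
Proof.
by move=> [a x]; rewrite /sd_mul/= mulVg -autact_morph mulVg tauK1.
Qed.

Let sd_mulrV : right_inverse sd_one sd_inv sd_mul.
Proof.
move=> [a x]; rewrite /sd_mul/= mulgV.
by have /= <- := autact_hom tau a a^-1%g x^-1%g; rewrite mulgV tau1 mulgV.
Qed.

HB.instance Definition _ := isGroup.Build Gtau
  sd_mulA sd_mul1 sd_mulr1 sd_mulV sd_mulrV.

Let cont_mul2 (T : topologicalType) (G : topGroupType) (f g : T -> G) :
  continuous f -> continuous g -> continuous (fun x => (f x * g x)%g).
Proof.
move=> cf cg x.
apply: (@continuous_comp _ _ _ (fun x => (f x, g x))
  (fun y : G * G => (y.1 * y.2)%g)); last exact: mulg_continuous.
by apply: cvg_pair; [exact: cf|exact: cg].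
Qed.

Let cont_act (T : topologicalType) (f : T -> H) (g : T -> K) :
  continuous f -> continuous g -> continuous (fun x => tau (f x) (g x)).
Proof.
move=> cf cg x.
apply: (@continuous_comp _ _ _ (fun x => (f x, g x))
  (fun y : H * K => tau y.1 y.2)); last exact: autact_continuous.
by apply: cvg_pair; [exact: cf|exact: cg].
Qed.

Let cont_inv (T : topologicalType) (G : topGroupType) (f : T -> G) :
  continuous f -> continuous (fun x => (f x)^-1%g).
Proof.
move=> cf x; apply: (@continuous_comp _ _ _ f (fun y : G => y^-1%g)).
  exact: cf.
exact: invg_continuous.
Qed.

Let cont11 : continuous (fun x : Gtau * Gtau => x.1.1).
Proof.
move=> x; apply: (@continuous_comp _ _ _ fst (fun y : H * K => y.1)).
  exact: cvg_fst.
exact: cvg_fst.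
Qed.

Let cont12 : continuous (fun x : Gtau * Gtau => x.1.2).
Proof.
move=> x; apply: (@continuous_comp _ _ _ fst (fun y : H * K => y.2)).
  exact: cvg_fst.
exact: cvg_snd.
Qed.

Let cont21 : continuous (fun x : Gtau * Gtau => x.2.1).
Proof.
move=> x; apply: (@continuous_comp _ _ _ snd (fun y : H * K => y.1)).
  exact: cvg_snd.
exact: cvg_fst.
Qed.

Let cont22 : continuous (fun x : Gtau * Gtau => x.2.2).
Proof.
move=> x; apply: (@continuous_comp _ _ _ snd (fun y : H * K => y.2)).
  exact: cvg_snd.
exact: cvg_snd.
Qed.

Let sd_mul_continuous : continuous (fun x : Gtau * Gtau => (x.1 * x.2)%g).
Proof.
move=> x.
change ((fun y : Gtau * Gtau => ((y.1.1 * y.2.1)%g, (y.1.2 * tau y.1.1 y.2.2)%g))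
  @ x --> nbhs (((x.1.1 * x.2.1)%g, (x.1.2 * tau x.1.1 x.2.2)%g) : H * K)).
apply: cvg_pair.
  by apply: cont_mul2 x; [exact: cont11|exact: cont21].
apply: cont_mul2 x; first exact: cont12.
by apply: cont_act; [exact: cont11|exact: cont22].
Qed.

Let sd_inv_continuous : continuous (fun x : Gtau => x^-1%g).
Proof.
have c1 : continuous (fun x : Gtau => x.1) by move=> x; exact: cvg_fst.
have c2 : continuous (fun x : Gtau => x.2) by move=> x; exact: cvg_snd.
move=> x.
change ((fun y : Gtau => ((y.1^-1)%g, tau (y.1^-1)%g (y.2^-1)%g))
  @ x --> nbhs (((x.1^-1)%g, tau (x.1^-1)%g (x.2^-1)%g) : H * K)).
apply: cvg_pair.
  by apply: cont_inv x.
by apply: cont_act x; apply: cont_inv.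
Qed.

HB.instance Definition _ :=
  isTopGroup.Build Gtau sd_mul_continuous sd_inv_continuous.

End semidirect_topGroup.

Notation borel G := (g_sigma_algebraType (@open G)).

(* A nonzero left-invariant Radon measure: finite on compact sets, outer regular
   on Borel sets and inner regular on open sets. *)
Record left_haar (R : realType) (G : topGroupType)
    (mu : {measure set (borel G) -> \bar R}) : Prop := LeftHaar {
  haar_neq0 : mu setT != 0%E;
  haar_compact : forall C : set G, compact C -> (mu C < +oo)%E;
  haar_outer : forall A : set (borel G), measurable A ->
    mu A = ereal_inf [set mu U | U in [set U : set G | open U /\ A `<=` U]];
  haar_inner : forall U : set G, open U ->
    mu U = ereal_sup [set mu C | C in [set C : set G | compact C /\ C `<=` U]];
  haar_invariant : forall (x : G) (A : set (borel G)), measurable A ->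
    mu [set (x * y)%g | y in A] = mu A
}.

Record modular_function (R : realType) (G : topGroupType)
    (mu : {measure set (borel G) -> \bar R}) (Delta : G -> R) : Prop :=
    ModularFunction {
  modular_gt0 : forall x, 0 < Delta x;
  modularE : forall (x : G) (A : set (borel G)), measurable A ->
    mu [set (y * x)%g | y in A] = ((Delta x)%:E * mu A)%E
}.

Record aut_modulus (R : realType) (H K : topGroupType) (tau : cont_hom_Aut H K)
    (muK : {measure set (borel K) -> \bar R}) (delta : H -> R) : Prop :=
    AutModulus {
  modulus_gt0 : forall h, 0 < delta h;
  modulus_hom : forall h h', delta (h * h')%g = delta h * delta h';
  modulus_continuous : continuous delta;
  modulusE : forall h (A : set (borel K)), measurable A ->
    muK A = ((delta h)%:E * muK [set tau h k | k in A])%E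
}.

(* The meaning of "m is delta(h) dh dk": a Radon measure on the locally compact
   space H * K is determined by its integrals of the functions in C_c(H * K).
   The product of dh and dk as abstract measures is not available, since H and K
   need not be sigma-compact and the Borel sets of H * K need not be generated
   by measurable rectangles. *)
Definition weighted_product (R : realType) (H K : topGroupType)
    (tau : cont_hom_Aut H K)
    (muH : {measure set (borel H) -> \bar R})
    (muK : {measure set (borel K) -> \bar R}) (delta : H -> R)
    (m : {measure set (borel (semidirect tau)) -> \bar R}) : Prop :=
  forall phi : H * K -> R, continuous phi ->
    compact (closure [set x | phi x != 0]) ->
    (\int[m]_x (phi x)%:E =
     \int[muH]_h ((\int[muK]_k (phi (h, k))%:E) * (delta h)%:E))%E.

Section convolution.
Variables (R : realType) (K : topGroupType).
Variable muK : {measure set (borel K) -> \bar R}.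

Definition conv (phi psi : K -> R[i]) (k : K) : R[i] :=
  integralC muK (fun s => phi s * psi (s^-1 * k)%g).

Definition conv_defined (phi psi : K -> R[i]) (k : K) : Prop :=
  integrableC muK (fun s => phi s * psi (s^-1 * k)%g).

Definition involution (DeltaK : K -> R) (psi : K -> R[i]) (k : K) : R[i] :=
  (DeltaK k^-1%g)%:C%C * (psi k^-1%g)^*%C.

End convolution.

Section tau_operations.
Variables (R : realType) (H K : topGroupType) (tau : cont_hom_Aut H K).
Variable muH : {measure set (borel H) -> \bar R}.
Variable muK : {measure set (borel K) -> \bar R}.
Variables (DeltaK : K -> R) (delta : H -> R).
Variable m : {measure set (borel (semidirect tau)) -> \bar R}.
Implicit Types f g : H * K -> R[i].

Definition slice f (t : H) : K -> R[i] := fun k => f (t, k).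

Definition tau_convr_integrand f g (x : H * K) (t : H) : R[i] :=
  conv muK (slice f x.1) (slice g t) x.2 * (delta t)%:C%C.

Definition tau_convl_integrand f g (x : H * K) (t : H) : R[i] :=
  conv muK (slice f t) (slice g x.1) x.2 * (delta t)%:C%C.

Definition tau_convr f g (x : H * K) : R[i] :=
  integralC muH (tau_convr_integrand f g x).

Definition tau_convl f g (x : H * K) : R[i] :=
  integralC muH (tau_convl_integrand f g x).

Definition tau_conv f g (x : H * K) : R[i] :=
  2^-1 * (tau_convr f g x + tau_convl f g x).

Definition tau_inv f (x : H * K) : R[i] := involution DeltaK (slice f x.1) x.2.

(* Integrals are total functions here, with a meaningless value when they
   diverge, so the convergence of the integrals that define the convolution has
   to be asserted apart. *)
Definition tau_conv_defined f g (x : H * K) : Prop :=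
  [/\ \forall t \ae muH, conv_defined muK (slice f x.1) (slice g t) x.2,
      integrableC muH (tau_convr_integrand f g x),
      \forall t \ae muH, conv_defined muK (slice f t) (slice g x.1) x.2 &
      integrableC muH (tau_convl_integrand f g x)].

Definition is_tau_convolution (mul : L1 m -> L1 m -> L1 m) : Prop :=
  forall f g : L1fun m,
    (\forall x \ae m, tau_conv_defined f g x) /\
    (\forall x \ae m, mul (L1class f) (L1class g) x = tau_conv f g x).

Definition is_tau_involution (star : L1 m -> L1 m) : Prop :=
  forall f : L1fun m, \forall x \ae m, star (L1class f) x = tau_inv f x.

End tau_operations.

Record nonassoc_banach_star_algebra (R : realType) (A : normedModType R[i])
    (mul : A -> A -> A) (star : A -> A) : Prop :=
    NonassocBanachStarAlgebra {
  bsa_complete : forall F : set_system A, ProperFilter F -> cauchy F -> cvg F;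
  bsa_mull : forall (a : R[i]) (x y z : A),
    mul (a *: x + y) z = a *: mul x z + mul y z;
  bsa_mulr : forall (a : R[i]) (x y z : A),
    mul x (a *: y + z) = a *: mul x y + mul x z;
  bsa_norm_mul : forall x y : A, `|mul x y| <= `|x| * `|y|;
  bsa_star_semilinear : forall (a : R[i]) (x y : A),
    star (a *: x + y) = (a^*)%C *: star x + star y;
  bsa_norm_star : forall x : A, `|star x| = `|x|;
  bsa_starK : forall x : A, star (star x) = x;
  bsa_star_mul : forall x y : A, star (mul x y) = mul (star y) (star x)
}.

Record jordan_banach_star_algebra (R : realType) (A : normedModType R[i])
    (mul : A -> A -> A) (star : A -> A) : Prop := JordanBanachStarAlgebra {
  jbsa_banach_star : nonassoc_banach_star_algebra mul star;
  jbsa_mulC : forall x y : A, mul x y = mul y x;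
  jbsa_jordan : forall x y : A,
    mul (mul x y) (mul x x) = mul x (mul y (mul x x))
}.

(* Main.v *)
(* As K is abelian, write f > g for the function
   (h, k) |-> int_K F(s) g(h, s^-1 k) ds, where F(s) = int_H f(t, s) delta(t) dt.
   Fubini identifies it with the left tau-convolution of f and g, and the
   substitution s |-> s^-1 k turns the right tau-convolution of f and g into g > f.
   So the tau-convolution is the symmetrization of >, which is bilinear,
   associative and submultiplicative for the norm of L1, and it satisfies the
   Jordan identity as every special Jordan product does.  The modular function of K
   is 1, and the involution is multiplicative for >.

   Fubini needs care, as H and K need not be sigma-compact and the Borel sets of
   H * K need not be generated by rectangles.  Finitely many integrable functions
   vanish off a common S * T, where S and T are open subgroups that are increasing
   unions of relatively compact open sets.  On such subgroups inner regularity
   gives a Lindelof property: a union of open sets is, up to a null set, a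
   countable union.  It yields the measurability of the measure of sections, the
   equality of the two iterated integrals, and the identification of m with
   delta(h) dh dk starting from its values on C_c. *)
Require Import Defs.
From HB Require Import structures.
From mathcomp Require Import all_boot all_order all_algebra.
From mathcomp Require Import finmap.
From mathcomp Require Import all_classical all_reals all_analysis.
From mathcomp Require Import measurable_realfun.
From mathcomp Require Import lra.

Set Implicit Arguments.
Unset Strict Implicit.
Unset Printing Implicit Defensive.

Import Order.TTheory GRing.Theory Num.Theory.
Import numFieldNormedType.Exports.
From mathcomp Require Import complex.

Local Open Scope classical_set_scope.
Local Open Scope ring_scope.

(** The operation > is associative because f |-> F turns > into the convolution of K: f > g is the
    action of F, an element of L1(K), on g, and a convolution in L1(K) acts as the composite of the
    actions of its factors. Hence tau enters the product through delta alone. Integrals are total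
    functions with default values, so most identities between convolutions hold only where a
    nonnegative majorant is finite. The majorants come from Young's inequality, which is an equality
    for nonnegative functions, and they are finite almost everywhere. The convolution is formed on
    functions; it descends to classes because it is bilinear and bounded by the product of the
    norms. Inversion invariance of dk is read off a single double integral over K * K, in which the
    finite positive measure of a neighbourhood of 1 cancels. To identify m with delta(h) dh dk, each
    side is bounded by the other on open sets through bump functions, so both need the Lindelof
    property. That of m comes from its inner regularity; the iterated measure, about which no
    regularity is known, gets it from the factors. *)

Import HBNNSimple.

(** * Integration against mixtures of measures *)

Section mixture.
Local Open Scope ereal_scope.
Context d (T : measurableType d) (R : realType).

(** Approximating simple functions have finite range, so each is a finite combination of indicators,
    and f is their increasing limit. The principle is used for mixtures and for restricted
    measures. *)
Lemma ge0_measurable_ind (P : (T -> \bar R) -> Prop) :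
  (forall A, measurable A -> P (fun x => (\1_A x)%:E)) ->
  (forall (k : R) f, (0 <= k)%R -> measurable_fun setT f ->
    (forall x, 0 <= f x) -> P f -> P (fun x => k%:E * f x)) ->
  (forall f g, measurable_fun setT f -> measurable_fun setT g ->
    (forall x, 0 <= f x) -> (forall x, 0 <= g x) -> P f -> P g ->
    P (fun x => f x + g x)) ->
  (forall f_ : (T -> \bar R)^nat, (forall n, measurable_fun setT (f_ n)) ->
    (forall n x, 0 <= f_ n x) ->
    (forall x, {homo f_ ^~ x : n m / (n <= m)%N >-> n <= m}) ->
    (forall n, P (f_ n)) -> P (fun x => limn (f_ ^~ x))) ->
  forall f, measurable_fun setT f -> (forall x, 0 <= f x) -> P f.
Proof.
move=> Pind PZ PD Plim f mf f0.
pose f_ := nnsfun_approx measurableT mf.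
have -> : f = fun x => limn (fun n => (f_ n x)%:E).
  apply/funext => x; apply/esym/cvg_lim => //.
  exact: cvg_nnsfun_approx.
apply: Plim => [n|n x|x m n mn|n].
- exact/measurable_EFinP.
- by rewrite lee_fin.
- by rewrite lee_fin; exact/lefP/nd_nnsfun_approx.
have -> : (fun x => (f_ n x)%:E) = (fun x => \sum_(k <- fset_set (range (f_ n)))
    (k%:E * (\1_(f_ n @^-1` [set k]) x)%:E)).
  apply/funext => x; rewrite fimfunE fsbig_finite//=.
  by rewrite -sumEFin; apply: eq_bigr => k _; rewrite EFinM.
(* Nonnegativity of the values is stated along the list, so that sublists inherit it in the
   induction. *)
have : forall k, k \in (fset_set (range (f_ n)) : seq R) -> (0 <= k)%R.
  by move=> k; rewrite -[_ \in _]/(k \in fset_set _) in_fset_set// => /set_mem[x _ <-].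
elim: (fset_set _ : seq R) => [|k s IH] s0.
  have -> : (fun x => \sum_(k <- [::]) (k%:E * (\1_(f_ n @^-1` [set k]) x)%:E))
      = (fun x => (\1_(@set0 T) x)%:E).
    by apply/funext => x; rewrite big_nil indic0.
  exact: Pind.
have -> : (fun x => \sum_(j <- k :: s) (j%:E * (\1_(f_ n @^-1` [set j]) x)%:E))
  = (fun x => k%:E * (\1_(f_ n @^-1` [set k]) x)%:E +
      \sum_(j <- s) (j%:E * (\1_(f_ n @^-1` [set j]) x)%:E)).
  by apply/funext => x; rewrite big_cons.
have k0 : (0 <= k)%R by apply: s0; exact: mem_head.
have s1 j : j \in s -> (0 <= j)%R by move=> js; apply: s0; rewrite in_cons js orbT.
apply: PD.
- by apply: measurable_funeM; exact/measurable_EFinP.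
- apply: emeasurable_sum => j; apply: measurable_funeM.
  exact/measurable_EFinP.
- by move=> x; rewrite mule_ge0// lee_fin.
- move=> x; rewrite big_seq; apply: sume_ge0 => j js.
  by rewrite mule_ge0// lee_fin//; exact: s1.
- apply: PZ => //; first exact/measurable_EFinP.
  exact: Pind.
- exact: IH.
Qed.

Context d' (X : measurableType d').
Variable k : X -> {measure set T -> \bar R}.
Hypothesis mk : forall A, measurable A -> measurable_fun setT (fun x => k x A).
Variables (mu : {measure set X -> \bar R}) (M : {measure set T -> \bar R}).
Hypothesis ME : forall A, measurable A -> M A = \int[mu]_x k x A.

(** Both claims are proved at once: in the steps for sums and limits, the formula needs the inner
    integrals of the given functions to be measurable in x. *)
Lemma mixture_integral (f : T -> \bar R) :
  measurable_fun setT f -> (forall y, 0 <= f y) ->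
  measurable_fun setT (fun x => \int[k x]_y f y) /\
  \int[M]_y f y = \int[mu]_x \int[k x]_y f y.
Proof.
move=> mf f0; pattern f; move: f mf f0.
apply: ge0_measurable_ind.
- move=> A mA; split.
  + rewrite [X in measurable_fun _ X](_ : _ = fun x => k x A); first exact: mk.
    by apply/funext => x; rewrite integral_indic// setIT.
  + rewrite integral_indic// setIT ME//.
    by apply: eq_integral => x _; rewrite integral_indic// setIT.
- move=> r f r0 mf f0 [mif Mf].
  have E x : \int[k x]_y (r%:E * f y) = r%:E * \int[k x]_y f y.
    by rewrite ge0_integralZl_EFin.
  split.
    by rewrite (funext E); exact: measurable_funeM.
  under [RHS]eq_integral do rewrite E.
  rewrite (ge0_integralZl_EFin mu measurableT (fun x _ => integral_ge0 _ (fun y _ => f0 y)) mif r0).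
  by rewrite ge0_integralZl_EFin// Mf.
- move=> f g mf mg f0 g0 [mif Mf] [mig Mg].
  have E x : \int[k x]_y (f y + g y) = \int[k x]_y f y + \int[k x]_y g y.
    by rewrite ge0_integralD.
  split.
    by rewrite (funext E); exact: emeasurable_funD.
  under [RHS]eq_integral do rewrite E.
  rewrite (ge0_integralD mu measurableT
    (fun x _ => integral_ge0 _ (fun y _ => f0 y)) mif
    (fun x _ => integral_ge0 _ (fun y _ => g0 y)) mig).
  by rewrite ge0_integralD// Mf Mg.
- move=> f_ mf f0 nd Pf.
  have E x : \int[k x]_y limn (f_ ^~ y) = limn (fun n => \int[k x]_y f_ n y).
    by rewrite monotone_convergence//.
  have ndI x : {homo (fun n => \int[k x]_y f_ n y) : n m / (n <= m)%N >-> n <= m}.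
    by move=> n m nm; apply: ge0_le_integral => // y _; exact: nd.
  split.
    rewrite (funext E).
    apply: (emeasurable_fun_cvg (fun n x => \int[k x]_y f_ n y)).
      by move=> n; exact: (Pf n).1.
    move=> x _; apply: ereal_nondecreasing_is_cvgn; exact: ndI.
  rewrite monotone_convergence//.
  rewrite (_ : (fun n => _) = (fun n => \int[mu]_x \int[k x]_y f_ n y)); last first.
    by apply/funext => n; rewrite (Pf n).2.
  rewrite -monotone_convergence//.
  + by apply: eq_integral => x _; rewrite E.
  + by move=> n; exact: (Pf n).1.
  + by move=> n x _; exact: integral_ge0.
Qed.

End mixture.

(** * The Lindelof property of regular measures *)

(* Makes [borel (X * Y)] available: the pointed and the topological structures of
   a product are not joined otherwise. *)
HB.saturate prod.

Section borel.

Lemma borel_open (X : ptopologicalType) (A : set (borel X)) :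
  open (A : set X) -> measurable A.
Proof. exact: sub_sigma_algebra. Qed.

Lemma borel_bigcup_open (X : ptopologicalType) (F : set (set X)) :
  F `<=` open -> measurable (\bigcup_(A in F) A : set (borel X)).
Proof. by move=> Fo; apply: borel_open; apply: bigcup_open => A /Fo. Qed.

Lemma borel_closed (X : ptopologicalType) (A : set (borel X)) :
  closed (A : set X) -> measurable A.
Proof.
move=> cA; rewrite -(setCK A); apply: measurableC; apply: borel_open.
exact: closed_openC.
Qed.

Lemma continuous_borel d (T : measurableType d) (Y : ptopologicalType)
    (f : T -> Y) :
  (forall U : set Y, open U -> measurable (f @^-1` U)) ->
  measurable_fun setT (f : T -> borel Y).
Proof.
move=> cf; apply: (@measurability _ _ T (borel Y) setT f (@open Y)) => // _ [U oU <-].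
by rewrite setTI; exact: cf.
Qed.

Lemma continuous_borel_fun (X Y : ptopologicalType) (f : X -> Y) :
  continuous f -> measurable_fun setT (f : borel X -> borel Y).
Proof.
move=> /continuousP cf; apply: continuous_borel => U oU.
by apply: borel_open; exact: cf.
Qed.

Lemma borel_preimage (X Y : ptopologicalType) (f : X -> Y) (E : set (borel Y)) :
  continuous f -> measurable E -> measurable (f @^-1` E : set (borel X)).
Proof.
by move=> cf mE; rewrite -[X in measurable X]setTI; exact: (continuous_borel_fun cf).
Qed.

Lemma pair_continuous (X Y : topologicalType) (x : X) :
  continuous (fun y : Y => (x, y)).
Proof. by move=> y; apply: cvg_pair => //; exact: cvg_cst. Qed.

Lemma pairr_continuous (X Y : topologicalType) (y : Y) :
  continuous (fun x : X => (x, y)).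
Proof. by move=> x; apply: cvg_pair => //; exact: cvg_cst. Qed.

End borel.

(** Indices that code no member of G are filled with [set0], so empty and finite families are
    enumerated too and the union is unchanged. *)
Lemma countable_seq (T : Type) (G : set (set T)) : countable G ->
  exists u : nat -> set T, (forall n, G (u n) \/ u n = set0) /\
    \bigcup_(A in G) A = \bigcup_n u n.
Proof.
move=> /countable_injP[f finj].
pose P n (A : set T) := G A /\ f A = n.
pose u n := match pselect (exists A, P n A) with
  | left h => sval (cid h) | right _ => set0 end.
have uP n : (exists2 A, P n A & u n = A) \/ u n = set0.
  rewrite /u; case: pselect => [h|]; last by right.
  by left; exists (sval (cid h)) => //; exact: svalP (cid h).
exists u; split.
  by move=> n; have [[A [GA _] ->]|->] := uP n; [left|right].
apply/seteqP; split => [x [A GA Ax]|x [n _ ux]].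
  exists (f A) => //; have [[B [GB fB] ->]|] := uP (f A).
    by rewrite (finj B A) ?inE.
  rewrite /u; case: pselect => [h|]; last by move=> /(_ (ex_intro _ A (conj GA erefl))).
  case: (cid h) => B /= [GB fB] B0.
  by move: Ax; rewrite -(finj B A) ?inE// B0.
have [[A [GA _] uA]|un0] := uP n; last by rewrite un0 in ux.
by exists A => //; rewrite -uA.
Qed.

Section lindelof.
Local Open Scope ereal_scope.
Variables (R : realType) (X : ptopologicalType).
Variable mu : {measure set (borel X) -> \bar R}.

(* Up to a null set, unions of open sets are countable unions: what is left of
   second countability for a regular measure. *)
Definition lindelof_on (S : set X) := forall F : set (set X), F `<=` open ->
  exists G, [/\ countable G, G `<=` F &
    mu ((\bigcup_(A in F) A `\` \bigcup_(A in G) A) `&` S) = 0].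

(** What Tonelli asks of a factor: the Lindelof property together with sigma-finiteness along open
    sets, which makes S itself open. *)
Definition tame (S : set X) := lindelof_on S /\
  exists O : nat -> set X, [/\ forall n, open (O n), nondecreasing_seq O,
    \bigcup_n O n = S & forall n, mu (O n) < +oo].

Lemma tame_open S : tame S -> open S.
Proof.
by move=> [_ [V [oV _ <- _]]]; apply: bigcup_open => n _; exact: oV.
Qed.

(** A compact subset of the union that misses less than 1/(n+1) of its measure in O is covered by
    finitely many members of F. Collecting these finite families over n leaves a set of measure 0,
    as the measure of O is finite. *)
Lemma lindelof_inner_regular (O : set X) : hausdorff_space X ->
  (forall U : set X, open U -> mu U = ereal_sup [set mu C | C in
     [set C : set X | compact C /\ C `<=` U]]) ->
  open O -> mu O < +oo -> lindelof_on O.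
Proof.
move=> hX inner oO Ofin F Fo.
pose U := \bigcup_(A in F) A.
have oU : open U by apply: bigcup_open => A /Fo.
have oUO : open (U `&` O) by exact: openI.
have mUO : measurable (U `&` O : set (borel X)) by exact: borel_open.
have mO : measurable (O : set (borel X)) by exact: borel_open.
have UOfin : mu (U `&` O) \is a fin_num.
  rewrite ge0_fin_numE//; apply: le_lt_trans Ofin.
  by apply: le_measure; rewrite ?inE.
have approx n : exists G : set (set X), [/\ finite_set G, G `<=` F &
    mu (U `&` O) - (n.+1%:R^-1)%:E < mu (\bigcup_(A in G) A `&` O)].
  have n0 : (0 < n.+1%:R^-1 :> R)%R by rewrite invr_gt0.
  move: (UOfin); rewrite (inner _ oUO).
  move=> /(ub_ereal_sup_adherent n0)[_ [C [cC CUO] <-]].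
  rewrite -(inner _ oUO) => UC.
  have [D' D'F CD'] : finite_subset_cover F id C.
    move: cC; rewrite compact_cover; apply; first by move=> A /Fo.
    by move=> x /CUO[[A FA Ax] _]; exists A.
  exists [set` D']; split.
  - exact: finite_fset.
  - by move=> A /= /D'F; rewrite inE.
  - apply: lt_le_trans UC _; apply: le_measure; rewrite ?inE.
    + by apply: borel_closed; exact: compact_closed.
    + apply: measurableI => //; apply: borel_bigcup_open => A /= /D'F.
      by rewrite inE => /Fo.
    + by move=> x Cx; split; [exact: CD'|exact: (CUO _ Cx).2].
pose G n := sval (cid (approx n)).
have GP n : [/\ finite_set (G n), G n `<=` F &
    mu (U `&` O) - (n.+1%:R^-1)%:E < mu (\bigcup_(A in G n) A `&` O)].
  exact: svalP (cid (approx n)).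
exists (\bigcup_n G n); split.
- apply: bigcup_countable => // n _; apply: finite_set_countable.
  by have [] := GP n.
- by move=> A [n _ GnA]; have [_ GnF _] := GP n; exact: GnF.
- have GF : \bigcup_n G n `<=` F.
    by move=> A [n _ GnA]; have [_ GnF _] := GP n; exact: GnF.
  have mD : measurable ((U `\` \bigcup_(A in \bigcup_n G n) A) `&` O : set (borel X)).
    apply: measurableI => //; apply: measurableD; first exact: borel_open.
    by apply: borel_bigcup_open => A /GF/Fo.
  apply/eqP; rewrite eq_le measure_ge0 andbT; apply/lee_addgt0Pr => e e0.
  rewrite add0e; have [n] := ltr_add_invr e0; rewrite add0r => ne.
  have [_ GnF Gn] := GP n.
  have mGn : measurable (\bigcup_(A in G n) A `&` O : set (borel X)).
    by apply: measurableI => //; apply: borel_bigcup_open => A /GnF/Fo.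
  apply: (@le_trans _ _ (mu ((U `&` O) `\` (\bigcup_(A in G n) A `&` O)))).
    apply: le_measure; rewrite ?inE//; first exact: measurableD.
    move=> x [[Ux nGx] Ox]; split => // -[[A GnA Ax] _].
    by apply: nGx; exists A => //; exists n.
  rewrite measureD//; last by rewrite -ge0_fin_numE.
  have -> : (U `&` O) `&` (\bigcup_(A in G n) A `&` O) = \bigcup_(A in G n) A `&` O.
    by apply: setIidr => x [[A /GnF FA Ax] Ox]; split => //; exists A.
  apply: le_trans (_ : (n.+1%:R^-1)%:E <= _); last by rewrite lee_fin ltW.
  move: Gn; rewrite -(fineK UOfin).
  have Gfin : mu (\bigcup_(A in G n) A `&` O) \is a fin_num.
    rewrite ge0_fin_numE//; apply: le_lt_trans Ofin.
    by apply: le_measure; rewrite ?inE.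
  rewrite -(fineK Gfin) -!EFinB lte_fin => h.
  have : (fine (mu (U `&` O)))%:E - (fine (mu (\bigcup_(A in G n) A `&` O)))%:E
      <= (n.+1%:R^-1)%:E by rewrite lee_fin lerBlDr -lerBlDl ltW.
  by rewrite !fineK.
Qed.

Lemma lindelof_bigcup (O : nat -> set X) : (forall n, open (O n)) ->
  (forall n, lindelof_on (O n)) -> lindelof_on (\bigcup_n O n).
Proof.
move=> oO lO F Fo.
pose G n := sval (cid (lO n F Fo)).
have GP n : [/\ countable (G n), G n `<=` F &
    mu ((\bigcup_(A in F) A `\` \bigcup_(A in G n) A) `&` O n) = 0].
  exact: svalP (cid (lO n F Fo)).
have GF : \bigcup_n G n `<=` F.
  by move=> A [n _ GnA]; have [_ GnF _] := GP n; exact: GnF.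
exists (\bigcup_n G n); split => //.
- by apply: bigcup_countable => // n _; have [] := GP n.
- apply: measure_negligible.
    apply: measurableI; last first.
      by apply: borel_open; apply: bigcup_open => n _; exact: oO.
    by apply: measurableD; apply: borel_bigcup_open => // A /GF/Fo.
  apply: (@negligibleS _ (borel X) _ _ (\bigcup_n
      ((\bigcup_(A in F) A `\` \bigcup_(A in G n) A) `&` O n))).
    move=> x [[Fx nGx] [n _ Ox]]; exists n => //; split => //; split => //.
    by move=> [A GnA Ax]; apply: nGx; exists A => //; exists n.
  apply: negligible_bigcup => n; have [_ GnF Gn0] := GP n.
  exists ((\bigcup_(A in F) A `\` \bigcup_(A in G n) A) `&` O n); split => //.
  apply: measurableI; last exact: borel_open.
  by apply: measurableD; apply: borel_bigcup_open => // A /GnF/Fo.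
Qed.

Lemma lindelof_onS (S S' : set X) : open S -> open S' -> S `<=` S' ->
  lindelof_on S' -> lindelof_on S.
Proof.
move=> oS oS' SS' lS F Fo; have [G [cG GF G0]] := lS F Fo.
exists G; split => //; apply: subset_measure0 G0.
- apply: measurableI; last exact: borel_open.
  by apply: measurableD; apply: borel_bigcup_open => // A /GF/Fo.
- apply: measurableI; last exact: borel_open.
  by apply: measurableD; apply: borel_bigcup_open => // A /GF/Fo.
- by apply: setIS.
Qed.

(** This is tau-additivity on open sets. The Lindelof property replaces the family by a sequence,
    and continuity from below then reaches the bound after finitely many terms. *)
Lemma lindelof_finite (I : Type) (D : set I) (f : I -> set X) (O : set X) (r : R) :
  open O -> lindelof_on O -> (forall i, D i -> open (f i)) ->
  r%:E < mu (\bigcup_(i in D) f i `&` O) -> exists D' : set I,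
    [/\ finite_set D', D' `<=` D & r%:E < mu (\bigcup_(i in D') f i `&` O)].
Proof.
move=> oO lO fo rD.
have Fo : f @` D `<=` open by move=> _ [i Di <-]; exact: fo.
have [G [/countable_seq[u [uG uU]] GF G0]] := lO _ Fo.
have uo n : open (u n).
  by have [/GF/Fo|->] := uG n; last exact: open0.
pose B n := \big[setU/set0]_(i < n.+1) u i `&` O.
have Bo n : open (B n).
  apply: openI => //; rewrite -bigcup_mkord.
  by apply: bigcup_open => i _; exact: uo.
have mB n : measurable (B n : set (borel X)) by exact: borel_open.
have BU : \bigcup_n B n = (\bigcup_n u n) `&` O.
  by rewrite -setI_bigcupl bigcup_bigsetU_bigcup.
have ndB : nondecreasing_seq B.
  move=> n m nm; apply/subsetPset; apply: setSI.
  by apply: subset_bigsetU.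
have rB : r%:E < mu (\bigcup_n B n).
  apply: (lt_le_trans rD); rewrite BU -uU.
  have FE : \bigcup_(i in D) f i = \bigcup_(A in f @` D) A.
    by rewrite bigcup_image.
  have mF : measurable (\bigcup_(A in f @` D) A `&` O : set (borel X)).
    by apply: measurableI; [exact: borel_bigcup_open|exact: borel_open].
  have mG : measurable (\bigcup_(A in G) A `&` O : set (borel X)).
    apply: measurableI; last exact: borel_open.
    by apply: borel_bigcup_open => A /GF/Fo.
  have mD : measurable ((\bigcup_(A in f @` D) A `\`
      \bigcup_(A in G) A) `&` O : set (borel X)).
    apply: measurableI; last exact: borel_open.
    by apply: measurableD; apply: borel_bigcup_open => // A /GF/Fo.
  rewrite FE -[leRHS](measureU0 mG mD G0); apply: le_measure; rewrite ?inE//.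
    exact: measurableU.
  move=> y [Fy Oy]; have [Gy|nGy] := pselect ((\bigcup_(A in G) A) y).
    by left.
  by right.
have Bcvg : mu \o B @ \oo --> mu (\bigcup_n B n).
  apply: nondecreasing_cvg_mu => //.
  by apply: borel_open; apply: bigcup_open => n _; exact: Bo.
have [n rn] : exists n, r%:E < mu (B n).
  apply: contrapT => /forallNP nB; move: rB; apply/negP; rewrite -leNgt.
  rewrite -(cvg_lim _ Bcvg)//; apply: lime_le; first exact: cvgP Bcvg.
  by apply: nearW => n; rewrite leNgt; apply/negP; exact: nB.
(* Back from sets to indices: each [u i] is some [f j] with j in D, or is empty. *)
have [D' [finD' D'D uD']] : exists D' : set I, [/\ finite_set D', D' `<=` D &
    \big[setU/set0]_(i < n.+1) u i `<=` \bigcup_(i in D') f i].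
  elim: n.+1 => [|k [D' [finD' D'D uD']]].
    by exists set0; split => //; rewrite big_ord0.
  have [/GF[i Di fi]|uk0] := uG k; last first.
    by exists D'; split => //; rewrite big_ord_recr/= uk0 setU0.
  exists (D' `|` [set i]); split => //.
  - by rewrite finite_setU.
  - by move=> j [/D'D //|->].
  - rewrite big_ord_recr/= -fi => x [/uD'[j D'j fjx]|fix_].
      by exists j => //; left.
    by exists i => //; right.
exists D'; split => //; apply: (lt_le_trans rn).
apply: le_measure; rewrite ?inE//.
  apply: borel_open; apply: openI => //.
  by apply: bigcup_open => i /D'D; exact: fo.
exact: setSI.
Qed.

End lindelof.

(** * Iterated measures on products *)

Section mixture_measure.
Local Open Scope ereal_scope.
Context d (T : measurableType d) d' (X : measurableType d') (R : realType).
Variable k : X -> {measure set T -> \bar R}.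
Hypothesis mk : forall A, measurable A -> measurable_fun setT (fun x => k x A).
Variable mu : {measure set X -> \bar R}.

Definition mixture (A : set T) : \bar R := \int[mu]_x k x A.

Let mixture0 : mixture set0 = 0.
Proof. by rewrite /mixture integral0_eq// => x _; rewrite measure0. Qed.

Let mixture_ge0 A : 0 <= mixture A.
Proof. by apply: integral_ge0 => x _; exact: measure_ge0. Qed.

Let mixture_sigma_additive : semi_sigma_additive mixture.
Proof.
move=> F mF tF mUF.
rewrite [X in _ --> X](_ : _ = \sum_(n <oo) mixture (F n)).
  apply/cvg_closeP; split; last by rewrite closeE.
  by apply: is_cvg_nneseries => *; exact: integral_ge0.
rewrite /mixture -integral_nneseries//; last by move=> n; exact: mk.
by apply: eq_integral => x _; exact: measure_semi_bigcup.
Qed.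

HB.instance Definition _ := isMeasure.Build _ _ _ mixture
  mixture0 mixture_ge0 mixture_sigma_additive.

Definition mixture_measure : {measure set T -> \bar R} := mixture.

End mixture_measure.

Section restriction.
Local Open Scope ereal_scope.
Context d (T : measurableType d) (R : realType).
Variables (mu : {measure set T -> \bar R}) (S : set T) (mS : measurable S).

Lemma ge0_integral_mrestr (f : T -> \bar R) : measurable_fun setT f ->
  (forall x, 0 <= f x) -> \int[mrestr mu mS]_x f x = \int[mu]_(x in S) f x.
Proof.
move=> mf f0; pattern f; move: f mf f0; apply: ge0_measurable_ind.
- by move=> A mA; rewrite !integral_indic// setIT.
- move=> k f k0 mf f0 IH.
  rewrite !ge0_integralZl_EFin// ?IH//; exact: measurable_funTS.
- move=> f g mf mg f0 g0 If Ig.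
  by rewrite !ge0_integralD// ?If ?Ig//; exact: measurable_funTS.
- move=> f_ mf f0 nd IH.
  rewrite !monotone_convergence//.
  + by congr (limn _); apply/funext => n; rewrite IH.
  + by move=> n; exact: measurable_funTS.
Qed.

Lemma ge0_integral_mrestr_support (f : T -> \bar R) : measurable_fun setT f ->
  (forall x, 0 <= f x) -> (forall x, ~ S x -> f x = 0) ->
  \int[mrestr mu mS]_x f x = \int[mu]_x f x.
Proof.
move=> mf f0 fS; rewrite ge0_integral_mrestr// integral_mkcond.
apply: eq_integral => x _; rewrite patchE; case: ifPn => // /negP xS.
by rewrite fS// => Sx; apply: xS; rewrite inE.
Qed.

End restriction.

(** * Measurability of the measure of sections *)

Section sections.
Local Open Scope ereal_scope.
Variables (R : realType) (X Y : ptopologicalType).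
Variables (nu : {measure set (borel Y) -> \bar R}).

Lemma borel_preimage_pair (E : set (borel (X * Y)%type)) x : measurable E ->
  measurable (pair x @^-1` E : set (borel Y)).
Proof.
exact: borel_preimage (@pair_continuous X Y x).
Qed.

(** The section of E at x is the union of the open V such that U * V lies in E for some
    neighbourhood U of x. Finitely many of these V already have measure above r, and on the
    intersection of their U every section contains them. *)
Lemma open_section_lower_semicontinuous (O : set Y) (E : set (X * Y)) (r : R) :
  open O -> lindelof_on nu O -> open E ->
  open [set x | r%:E < nu (pair x @^-1` E `&` O)].
Proof.
move=> oO lO oE; rewrite openE => x /= rx.
pose F := [set V : set Y | open V /\
  exists2 U : set X, open_nbhs x U & U `*` V `<=` E].
have Fo : F `<=` open by move=> V [].
have EF : pair x @^-1` E = \bigcup_(V in F) V.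
  apply/seteqP; split => [y /= Exy|y [V [oV [U xU UVE]] Vy]]; last first.
    by apply: UVE; split => //=; case: xU.
  have [[A B] [/= xA yB] ABE] : nbhs (x, y) E by apply: open_nbhs_nbhs.
  move: xA yB; rewrite !nbhsE => -[A' xA' AA'] [B' [oB' yB'] BB'].
  exists B' => //; split => //; exists A' => // -[a b] [/= A'a B'b].
  by apply: ABE; split; [exact: AA'|exact: BB'].
rewrite EF in rx.
have [D' [/finite_fsetP[A D'A] D'F rA]] :=
  lindelof_finite oO lO (fun V FV => Fo V FV) rx.
rewrite {}D'A in D'F rA.
have : nbhs x (\bigcap_(V in [set` A]) [set x' | V `<=` pair x' @^-1` E]).
  apply: filter_bigI => V /D'F[_ [U xU UVE]].
  move/open_nbhs_nbhs : xU; apply: filterS => x' Ux' y Vy.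
  exact: UVE.
apply: filterS => x' AE.
apply: (lt_le_trans rA); apply: le_measure; rewrite ?inE//.
- apply: measurableI; last exact: borel_open.
  by apply: borel_bigcup_open => V /D'F/Fo.
- apply: measurableI; last exact: borel_open.
  by apply: borel_preimage_pair; exact: borel_open.
- by apply: setSI => y [V AV Vy]; exact: AE Vy.
Qed.

(** The pi-system is that of all open sets of the product, as rectangles need not generate the Borel
    sets; on it, lower semicontinuity gives measurability. The finite measure of O turns the
    complement step into a subtraction. *)
Lemma measurable_section_fin (O : set Y) (E : set (borel (X * Y)%type)) :
  open O -> nu O < +oo -> lindelof_on nu O -> measurable E ->
  measurable_fun setT
    (fun x : borel X => nu (pair (x : X) @^-1` (E : set (X * Y)) `&` O)).
Proof.
move=> oO Ofin lO mE.
have mO : measurable (O : set (borel Y)) by exact: borel_open.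
pose phi (E : set (borel (X * Y)%type)) (x : borel X) :=
  nu (pair (x : X) @^-1` (E : set (X * Y)) `&` O).
have finphi E' x : measurable E' -> phi E' x < +oo.
  move=> mE'; apply: le_lt_trans Ofin; apply: le_measure; rewrite ?inE//.
  by apply: measurableI => //; exact: borel_preimage_pair.
pose P (E : set (borel (X * Y)%type)) := measurable_fun setT (phi E).
suff : P E by [].
apply: (@dynkin_induction _ (borel (X * Y)%type) (@open (X * Y)%type) P) => //.
- by move=> A B; exact: openI.
- rewrite /P /phi (_ : (fun _ => _) = cst (nu O)); first exact: measurable_cst.
  by apply/funext => x /=; rewrite preimage_setT setTI.
- move=> A oA; rewrite /P.
  apply: (measurability _ (ErealGenOInfty.measurableE R)) => _ [_ [r ->] <-].
  rewrite setTI; apply: borel_open.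
  rewrite (_ : _ @^-1` _ = [set x | r%:E < phi A x]).
    exact: open_section_lower_semicontinuous.
  by apply/seteqP; split => x /=; rewrite in_itv/= andbT.
- move=> A mA PA; rewrite /P.
  rewrite (_ : phi (~` A) = fun x => nu O - phi A x).
    by apply: emeasurable_funB => //; exact: measurable_cst.
  apply/funext => x; rewrite /phi preimage_setC setIC -setDE measureD//.
  + by rewrite setIC.
  + exact: borel_preimage_pair.
- move=> F mF tF PF; rewrite /P.
  rewrite (_ : phi _ = fun x => \sum_(n <oo) phi (F n) x).
    have := @ge0_emeasurable_sum _ (borel X) R setT (fun n x => phi (F n) x) xpredT.
    by apply => [n x _ _|n _]; [exact: measure_ge0|exact: PF].
  apply/funext => x; rewrite /phi preimage_bigcup setI_bigcupl.
  apply: measure_semi_bigcup.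
  + by move=> n; apply: measurableI => //; exact: borel_preimage_pair.
  + apply/trivIsetP => i j _ _ ij.
    rewrite setIACA -preimage_setI.
    by move/trivIsetP : tF => /(_ _ _ _ _ ij) ->//; rewrite preimage_set0 set0I.
  + apply: bigcupT_measurable => n.
    by apply: measurableI => //; exact: borel_preimage_pair.
Qed.

End sections.

Section tame_sections.
Local Open Scope ereal_scope.
Variables (R : realType) (X Y : ptopologicalType).
Variable nu : {measure set (borel Y) -> \bar R}.
Variables (S : set Y) (tnu : tame nu S).
Hypothesis mS : measurable (S : set (borel Y)).

Lemma measurable_section (E : set (borel (X * Y)%type)) : measurable E ->
  measurable_fun setT
    (fun x : borel X => nu (pair (x : X) @^-1` (E : set (X * Y)) `&` S)).
Proof.
move=> mE; have [lS [V [oV ndV VS Vfin]]] := tnu.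
have oS : open S by exact: tame_open tnu.
apply: (emeasurable_fun_cvg
  (fun n (x : borel X) => nu (pair (x : X) @^-1` (E : set (X * Y)) `&` V n))).
  move=> n; apply: measurable_section_fin => //.
  by apply: lindelof_onS lS => //; rewrite -VS; exact: bigcup_sup.
move=> x _; rewrite -VS setI_bigcupr.
apply: (@nondecreasing_cvg_mu _ (borel Y) _ nu
  (fun n => pair (x : X) @^-1` (E : set (X * Y)) `&` V n)).
- by move=> n; apply: measurableI; [exact: borel_preimage_pair|exact: borel_open].
- apply: bigcupT_measurable => n.
  by apply: measurableI; [exact: borel_preimage_pair|exact: borel_open].
- by move=> n m nm; apply/subsetPset; apply: setIS; exact/subsetPset/ndV.
Qed.

(** The restriction of nu to S, moved onto the slice over x; tameness of S makes it depend
    measurably on x. *)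
Definition section_measure (x : borel X) :
    {measure set (borel (X * Y)%type) -> \bar R} :=
  measure_function_pushforward__canonical__measure_function_Measure
    (mrestr nu mS) (continuous_borel_fun (@pair_continuous X Y x)).

Lemma section_measureE x E : section_measure x E =
  nu (pair (x : X) @^-1` (E : set (X * Y)) `&` S).
Proof. by []. Qed.

Lemma measurable_section_measure E : measurable E ->
  measurable_fun setT (fun x => section_measure x E).
Proof. exact: measurable_section. Qed.

Lemma integral_section_measure x (F : X * Y -> \bar R) :
  measurable_fun setT (F : borel (X * Y)%type -> \bar R) ->
  (forall z, 0 <= F z) ->
  \int[section_measure x]_z F z = \int[mrestr nu mS]_y F (x, y).
Proof.
move=> mF F0.
have := @ge0_integral_pushforward _ _ (borel Y) (borel (X * Y)%type) R
  (pair (x : X)) (continuous_borel_fun (@pair_continuous X Y x))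
  (mrestr nu mS) setT F.
by apply.
Qed.

End tame_sections.

Section lindelof_product.
Local Open Scope ereal_scope.
Variables (R : realType) (X Y : ptopologicalType).
Variables (mu : {measure set (borel X) -> \bar R}) (A : set X).
Variables (nu : {measure set (borel Y) -> \bar R}) (B : set Y).
Hypotheses (tmu : tame mu A) (tnu : tame nu B).

(* The functions x |-> nu (E_x), for E a finite union of members of F, are lower
   semicontinuous; the Lindelof property of [mu] is applied to their level sets
   over rational numbers. *)
Lemma lindelof_product (F : set (set (X * Y))) : F `<=` open ->
  exists G, [/\ countable G, G `<=` F & mu.-negligible (A `&`
    [set x | nu (pair x @^-1` (\bigcup_(E in F) E `\` \bigcup_(E in G) E) `&` B)
       != 0])].
Proof.
move=> Fo; have [lA _] := tmu; have [lB [V [oV ndV VB Vfin]]] := tnu.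
have oB : open B by exact: tame_open tnu.
have lV n : lindelof_on nu (V n).
  by apply: lindelof_onS lB => //; rewrite -VB; exact: bigcup_sup.
pose g (G : set (set (X * Y))) n x :=
  nu (pair x @^-1` (\bigcup_(E in G) E) `&` V n).
pose L n (c : rat) := [set W : set X | exists G : set (set (X * Y)),
  [/\ finite_set G, G `<=` F & W = [set x | (ratr c)%:E < g G n x]]].
have Lo n c : L n c `<=` open.
  move=> _ [G [_ GF ->]]; apply: open_section_lower_semicontinuous => //.
  by apply: bigcup_open => E /GF/Fo.
pose M n c := sval (cid (lA _ (Lo n c))).
have MP n c : [/\ countable (M n c), M n c `<=` L n c &
  mu ((\bigcup_(W in L n c) W `\` \bigcup_(W in M n c) W) `&` A) = 0].
  exact: svalP (cid (lA _ (Lo n c))).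
(* [H n c W] chooses a finite subfamily of F that cuts out the level set W. *)
pose H n c W := match pselect (L n c W) with
  | left h => sval (cid h) | right _ => set0 end.
have HP n c W : L n c W -> [/\ finite_set (H n c W), H n c W `<=` F &
    W = [set x | (ratr c)%:E < g (H n c W) n x]].
  by rewrite /H; case: pselect => // h _; exact: svalP (cid h).
(* An enumeration of the rationals; the default 0 only produces repetitions. *)
pose q j : rat := odflt 0%R (@choice.unpickle rat j).
pose G := \bigcup_n \bigcup_j \bigcup_(W in M n (q j)) H n (q j) W.
have GF : G `<=` F.
  move=> E [n _ [j _ [W MW HE]]]; have [_ ML _] := MP n (q j).
  by have [_ HF _] := HP n (q j) W (ML _ MW); exact: HF.
have oF : open (\bigcup_(E in F) E) by apply: bigcup_open => E /Fo.
have oG : open (\bigcup_(E in G) E) by apply: bigcup_open => E /GF/Fo.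
have mpre (E : set (X * Y)) n x : open E ->
    measurable (pair x @^-1` E `&` V n : set (borel Y)).
  move=> oE; apply: measurableI; last exact: borel_open.
  by apply: borel_preimage_pair; exact: borel_open.
have gfin K n x : K `<=` F -> g K n x \is a fin_num.
  move=> KF; rewrite ge0_fin_numE//; apply: le_lt_trans (Vfin n).
  apply: le_measure; rewrite ?inE//; last exact: borel_open.
  by apply: mpre; apply: bigcup_open => E /KF/Fo.
exists G; split => //.
  apply: bigcup_countable => // n _; apply: bigcup_countable => // j _.
  apply: bigcup_countable; first by have [] := MP n (q j).
  move=> W MW; apply: finite_set_countable; have [_ ML _] := MP n (q j).
  by have [] := HP n (q j) W (ML _ MW).
pose N n c := (\bigcup_(W in L n c) W `\` \bigcup_(W in M n c) W) `&` A.
apply: (@negligibleS _ (borel X) _ _ (\bigcup_n \bigcup_j N n (q j))); last first.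
  apply: negligible_bigcup => n; apply: negligible_bigcup => j.
  have [_ ML N0] := MP n (q j).
  exists (N n (q j)); split => //; apply: measurableI.
    apply: measurableD; first exact: borel_bigcup_open (Lo _ _).
    by apply: borel_bigcup_open => W /ML/Lo.
  by apply: borel_open; exact: tame_open tmu.
move=> x [Ax /eqP gx]; apply: contrapT => nN; apply: gx.
have mD n : measurable (pair x @^-1` (\bigcup_(E in F) E `\` \bigcup_(E in G) E)
    `&` V n : set (borel Y)).
  apply: measurableI; last exact: borel_open.
  by apply: borel_preimage_pair; apply: measurableD; exact: borel_open.
rewrite -VB setI_bigcupr.
apply: measure_negligible; first exact: bigcupT_measurable.
apply: negligible_bigcup => n; exists (pair x @^-1` (\bigcup_(E in F) E `\`
  \bigcup_(E in G) E) `&` V n); split => //.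
(* Otherwise a rational c lies strictly between. A finite subfamily of F already gives x a section
   larger than c, so x is in the union of [L n c] and, being off the null set, in some W of [M n c].
   The finite family chosen for W is part of G and its section at x exceeds c, a contradiction. *)
have FG : g F n x <= g G n x.
  rewrite leNgt; apply/negP => lt.
  move: lt; rewrite -(fineK (gfin F n x _))// -(fineK (gfin G n x _))// lte_fin.
  move=> /rat_in_itvoo[c]; rewrite in_itv/= => /andP[Gc cF].
  apply: nN; exists n => //; exists (choice.pickle c) => //.
  rewrite /q choice.pickleK/=; split => //; split.
    have : (ratr c)%:E < nu (\bigcup_(E in F) (pair x @^-1` E) `&` V n).
      move: cF; rewrite -lte_fin fineK; last exact: gfin.
      by rewrite /g preimage_bigcup.
    move=> /(lindelof_finite (oV n) (lV n)).
    case=> [E FE|K [finK KF Kc]].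
      by move/continuousP: (@pair_continuous X Y x); apply; exact: Fo.
    exists [set x | (ratr c)%:E < g K n x]; first by exists K.
    by rewrite /= /g preimage_bigcup.
  move=> [W MW Wx]; have [_ ML _] := MP n c.
  have [_ HF WE] := HP n c W (ML _ MW).
  move: Wx; rewrite {1}WE /=; apply/negP; rewrite -leNgt.
  move: Gc; rewrite -lte_fin fineK; last exact: gfin.
  move=> /ltW; apply: le_trans; apply: le_measure; rewrite ?inE.
  - by apply: mpre; apply: bigcup_open => E /HF/Fo.
  - exact: mpre.
  - apply: setSI => y [E HE Ey]; exists E => //.
    exists n => //; exists (choice.pickle c) => //; rewrite /q choice.pickleK/=.
    by exists W.
rewrite (_ : _ `&` _ = (pair x @^-1` (\bigcup_(E in F) E) `&` V n) `\`
  pair x @^-1` (\bigcup_(E in G) E)); last first.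
  by apply/seteqP; split => [y [[? ?] ?]|y [[? ?] ?]].
rewrite measureD; last 3 first.
- exact: mpre.
- by apply: borel_preimage_pair; exact: borel_open.
- by rewrite -ge0_fin_numE//; exact: gfin.
have -> : (pair x @^-1` (\bigcup_(E in F) E) `&` V n) `&`
    pair x @^-1` (\bigcup_(E in G) E) = pair x @^-1` (\bigcup_(E in G) E) `&` V n.
  apply/seteqP; split => [y [[_ Vy] Gy]//|y [[E GE Ey] Vy]].
  by split; [split => //; exists E => //; exact: GF|exists E].
have GF' : g G n x <= g F n x.
  apply: le_measure; rewrite ?inE; [exact: mpre|exact: mpre|].
  by apply: setSI => y [E GE Ey]; exists E => //; exact: GF.
suff : g F n x - g G n x = 0 by [].
have -> : g G n x = g F n x by apply/eqP; rewrite eq_le GF' FG.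
by rewrite subee//; exact: gfin.
Qed.

End lindelof_product.

Lemma open_setX (X Y : topologicalType) (A : set X) (B : set Y) :
  open A -> open B -> open (A `*` B).
Proof.
move=> oA oB; have -> : A `*` B = fst @^-1` A `&` snd @^-1` B by [].
apply: openI.
  have /continuousP : continuous (@fst X Y) by move=> x; exact: cvg_fst.
  by apply.
have /continuousP : continuous (@snd X Y) by move=> x; exact: cvg_snd.
by apply.
Qed.

Section iterated.
Local Open Scope ereal_scope.
Variables (R : realType) (X Y : ptopologicalType).
Variables (mu : {measure set (borel X) -> \bar R}) (A : set X).
Variables (nu : {measure set (borel Y) -> \bar R}) (B : set Y).
Hypotheses (tmu : tame mu A) (tnu : tame nu B).
Hypotheses (mA : measurable (A : set (borel X))).
Hypotheses (mB : measurable (B : set (borel Y))).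

(** It lives on all Borel sets of the product, which may be more than the product sigma-algebra; the
    kernel is measurable in x on all of them. *)
Definition iterated_measure : {measure set (borel (X * Y)%type) -> \bar R} :=
  mixture_measure (measurable_section_measure tnu mB) (mrestr mu mA).

Lemma iterated_measureE E : iterated_measure E =
  \int[mrestr mu mA]_x nu (pair (x : X) @^-1` (E : set (X * Y)) `&` B).
Proof. by []. Qed.

Lemma ge0_integral_iterated (F : X * Y -> \bar R) :
  measurable_fun setT (F : borel (X * Y)%type -> \bar R) ->
  (forall z, 0 <= F z) ->
  measurable_fun setT (fun x : borel X => \int[mrestr nu mB]_y F ((x : X), (y : Y))) /\
  \int[iterated_measure]_z F z =
    \int[mrestr mu mA]_x \int[mrestr nu mB]_y F ((x : X), (y : Y)).
Proof.
move=> mF F0.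
have [m1 m2] := @mixture_integral _ _ _ _ _ _
  (measurable_section_measure tnu mB) (mrestr mu mA) iterated_measure
  (fun _ _ => erefl) F mF F0.
split.
  by under eq_fun do rewrite -(integral_section_measure nu mB _ mF F0).
by rewrite m2; apply: eq_integral => x _; rewrite integral_section_measure.
Qed.

Lemma iterated_measure_null (E : set (X * Y)) :
  measurable (E : set (borel (X * Y)%type)) ->
  mu.-negligible (A `&` [set x | nu (pair x @^-1` E `&` B) != 0]) ->
  iterated_measure E = 0.
Proof.
move=> mE E0; rewrite iterated_measureE.
rewrite ge0_integral_mrestr//; last exact: measurable_section.
rewrite -(integral0 mu A); apply: ge0_ae_eq_integral => //.
- exact: measurable_funTS (measurable_section tnu mE).
- move: E0; apply: negligibleS => x /= /not_implyP[Ax /eqP nE].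
  by split.
Qed.

Lemma iterated_measure_support (E : set (borel (X * Y)%type)) : measurable E ->
  iterated_measure E = iterated_measure (E `&` A `*` B).
Proof.
move=> mE; have oAB : open (A `*` B : set (X * Y)).
  by apply: open_setX; [exact: tame_open tmu|exact: tame_open tnu].
have mAB : measurable (A `*` B : set (borel (X * Y)%type)) by exact: borel_open.
rewrite (measureDI _ mE mAB) [X in X + _]iterated_measure_null ?add0e//.
  exact: measurableD.
apply: (@negligibleS _ (borel X) _ _ set0); last exact: negligible_set0.
move=> x [Ax /eqP[]].
rewrite (_ : _ `&` _ = set0) ?measure0//.
by rewrite -subset0 => y [[_ nAB] By]; apply: nAB.
Qed.

End iterated.

(** * Agreement of the two iterated measures *)

Section tonelli.
Local Open Scope ereal_scope.
Variables (R : realType) (X Y : ptopologicalType).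
Variables (mu : {measure set (borel X) -> \bar R}) (A : set X).
Variables (nu : {measure set (borel Y) -> \bar R}) (B : set Y).
Hypotheses (tmu : tame mu A) (tnu : tame nu B).
Hypotheses (mA : measurable (A : set (borel X))).
Hypotheses (mB : measurable (B : set (borel Y))).

Lemma tame_sigma_finite : sigma_finite setT (mrestr mu mA).
Proof.
have [_ [V [oV _ VA Vfin]]] := tmu.
(* The complement of A is null for the restriction, so adding it to every [V n] exhausts the space
   and keeps the measures finite. *)
exists (fun n => V n `|` ~` A).
  apply/seteqP; split => // x _; have [|nAx] := pselect (A x).
    by rewrite -VA => -[n _ Vx]; exists n => //; left.
  by exists 0%N => //; right.
move=> n; have mV : measurable (V n : set (borel X)) by exact: borel_open.
split; first by apply: measurableU => //; exact: measurableC.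
rewrite /mrestr setIUl setICl setU0; apply: le_lt_trans (Vfin n).
by apply: le_measure; rewrite ?inE//; exact: measurableI.
Qed.

End tonelli.

Section tonelli2.
Local Open Scope ereal_scope.
Variables (R : realType) (X Y : ptopologicalType).
Variables (mu : {measure set (borel X) -> \bar R}) (A : set X).
Variables (nu : {measure set (borel Y) -> \bar R}) (B : set Y).
Hypotheses (tmu : tame mu A) (tnu : tame nu B).
Hypotheses (mA : measurable (A : set (borel X))).
Hypotheses (mB : measurable (B : set (borel Y))).

Let flip (z : Y * X) : X * Y := (z.2, z.1).

Let flip_continuous : continuous flip.
Proof. by move=> z; apply: cvg_pair; [exact: cvg_snd|exact: cvg_fst]. Qed.

(** The two orders of integration become two measures on one space: [M2] is [N] carried back along
    [flip]. *)
Let M1 := iterated_measure mu tnu mA mB.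
Let N := iterated_measure nu tmu mB mA.
Let M2 : {measure set (borel (X * Y)%type) -> \bar R} :=
  measure_function_pushforward__canonical__measure_function_Measure
    N (continuous_borel_fun flip_continuous).

Let M1_indic (E : set (borel (X * Y)%type)) : measurable E -> M1 E =
  \int[mrestr mu mA]_x \int[mrestr nu mB]_y (\1_E ((x : X), (y : Y)))%:E.
Proof.
move=> mE; rewrite -(ge0_integral_iterated mu tnu mA mB (F := fun z => (\1_E z)%:E) _ _).2//.
  by rewrite integral_indic// setIT.
exact/measurable_EFinP.
Qed.

Let M2_indic (E : set (borel (X * Y)%type)) : measurable E -> M2 E =
  \int[mrestr nu mB]_y \int[mrestr mu mA]_x (\1_E ((x : X), (y : Y)))%:E.
Proof.
move=> mE.
have mE' : measurable (flip @^-1` E : set (borel (Y * X)%type)).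
  exact: borel_preimage flip_continuous mE.
rewrite /M2 /= /pushforward.
transitivity (\int[N]_z (\1_(flip @^-1` E) z)%:E).
  by rewrite integral_indic// setIT.
rewrite (ge0_integral_iterated nu tmu mB mA _ _).2//.
exact/measurable_EFinP.
Qed.

Let measures_agree_rect (E : set (X * Y)) :
  @measurable _ (borel X * borel Y)%type E ->
  measurable (E : set (borel (X * Y)%type)) -> M1 E = M2 E.
Proof.
move=> pE mE; rewrite M1_indic// M2_indic//.
pose m1 : {sigma_finite_measure set (borel X) -> \bar R} :=
  HB.pack (mrestr mu mA)
   (Measure_isSigmaFinite.Build _ _ _ (mrestr mu mA) (tame_sigma_finite tmu mA)).
pose m2 : {sigma_finite_measure set (borel Y) -> \bar R} :=
  HB.pack (mrestr nu mB)
   (Measure_isSigmaFinite.Build _ _ _ (mrestr nu mB) (tame_sigma_finite tnu mB)).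
apply: (@fubini_tonelli _ _ (borel X) (borel Y) R m1 m2 (fun z => (\1_E z)%:E)).
  exact/measurable_EFinP.
by move=> z; rewrite lee_fin.
Qed.

(* An open set is a union of open rectangles; finite unions of these belong to
   the product sigma-algebra, where Fubini holds, and they exhaust the open set up
   to a null set of either iterated measure. *)
Let measures_agree_open (E : set (X * Y)) : open E -> M1 E = M2 E.
Proof.
move=> oE.
pose F := [set Q | exists U V, [/\ open U, open V, Q = U `*` V & Q `<=` E]].
have Fo : F `<=` open by move=> _ [U [V [oU oV -> _]]]; exact: open_setX.
have FE : \bigcup_(Q in F) Q = E.
  apply/seteqP; split => [z [Q [U [V [_ _ _ QE]]] Qz]|[x y] Exy]; first exact: QE.
  have [[U V] [/= xU yV] UVE] : nbhs (x, y) E by apply: open_nbhs_nbhs.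
  move: xU yV; rewrite !nbhsE => -[U' [oU' xU'] UU'] [V' [oV' yV'] VV'].
  exists (U' `*` V') => //; exists U', V'; split => //.
  by move=> [a b] [/= U'a V'b]; apply: UVE; split; [exact: UU'|exact: VV'].
pose F' : set (set (Y * X)) := [set flip @^-1` Q | Q in F].
have F'o : F' `<=` open.
  move=> _ [Q FQ <-]; have /continuousP := flip_continuous; apply.
  exact: Fo.
have [G1 [cG1 G1F G1null]] := lindelof_product tmu tnu Fo.
have [G2 [cG2 G2F G2null]] := lindelof_product tnu tmu F'o.
pose back (W : set (Y * X)) : set (X * Y) := [set z | W (z.2, z.1)].
(* One family has to serve both measures: G1 exhausts E up to an [M1]-null set, the flipped G2 up to
   an [M2]-null set, and enlarging a family only shrinks what it leaves over. *)
pose G := G1 `|` back @` G2.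
have GF : G `<=` F.
  move=> Q [/G1F //|[W /G2F[Q' FQ' <-] <-]].
  by rewrite (_ : back _ = Q')//; apply/seteqP; split => -[].
have cG : countable G.
  rewrite /G (_ : _ `|` _ = \bigcup_(b : bool) (if b then G1 else back @` G2)).
    apply: bigcup_countable => // -[] _ //.
    by apply: sub_countable cG2; exact: card_image_le.
  by apply/seteqP; split => [x [?|?]|x [[] _ ?]];
    [exists true|exists false|left|right].
have oGU : open (\bigcup_(Q in G) Q) by apply: bigcup_open => Q /GF/Fo.
have mE : measurable (E : set (borel (X * Y)%type)) by exact: borel_open.
have mGU : measurable (\bigcup_(Q in G) Q : set (borel (X * Y)%type)).
  exact: borel_open.
have GE : \bigcup_(Q in G) Q `<=` E.
  by rewrite -FE => z [Q /GF FQ Qz]; exists Q.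
have agree : M1 (\bigcup_(Q in G) Q) = M2 (\bigcup_(Q in G) Q).
  apply: measures_agree_rect => //.
  have [u [uG ->]] := countable_seq cG.
  apply: bigcupT_measurable => n; have [|->//] := uG n.
  move=> /GF[U [V [oU oV -> _]]].
  by apply: (@measurableX _ _ (borel X) (borel Y)); exact: borel_open.
have M1D : M1 (E `\` \bigcup_(Q in G) Q) = 0.
  have mD1 : measurable (E `\` \bigcup_(Q in G1) Q : set (borel (X * Y)%type)).
    by apply: measurableD => //; apply: borel_bigcup_open => Q /G1F/Fo.
  apply: (@subset_measure0 _ (borel (X * Y)%type) _ M1 _ (E `\` \bigcup_(Q in G1) Q)).
  - exact: measurableD.
  - exact: mD1.
  - by apply: setDS => z [Q G1Q Qz]; exists Q => //; left.
  - by apply: iterated_measure_null => //; rewrite -{1}FE.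
have M2D : M2 (E `\` \bigcup_(Q in G) Q) = 0.
  have mD2 : measurable (flip @^-1` E `\` \bigcup_(Q in G2) Q : set (borel (Y * X)%type)).
    apply: measurableD; first exact: borel_preimage flip_continuous mE.
    by apply: borel_bigcup_open => Q /G2F/F'o.
  rewrite /M2 /= /pushforward.
  apply: (@subset_measure0 _ (borel (Y * X)%type) _ N _
    (flip @^-1` E `\` \bigcup_(Q in G2) Q)).
  - by apply: borel_preimage flip_continuous _; exact: measurableD.
  - exact: mD2.
  - move=> [y x] [/= Exy nG]; split => // -[Q G2Q Qz]; apply: nG.
    by exists (back Q) => //; right; exists Q.
  - apply: iterated_measure_null => //.
    have -> : flip @^-1` E = \bigcup_(Q in F') Q by rewrite bigcup_image -FE preimage_bigcup.
    exact: G2null.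
rewrite -(setDUK GE) measureU0 ?measureU0//.
all: exact: measurableD.
Qed.

(** A pi-system of open sets determines a finite measure, hence the cut to the open boxes [W n], of
    finite measure. They exhaust the product of A and B, off which both measures vanish. *)
Let measures_agree (E : set (borel (X * Y)%type)) : measurable E -> M1 E = M2 E.
Proof.
move=> mE.
have [_ [U [oU ndU UA Ufin]]] := tmu; have [_ [V [oV ndV VB Vfin]]] := tnu.
pose W n : set (borel (X * Y)%type) := U n `*` V n.
have oW n : open (U n `*` V n) by exact: open_setX.
have mW n : measurable (W n) by apply: borel_open; exact: oW.
have WAB : \bigcup_n W n = A `*` B.
  apply/seteqP; split => [[x y] [n _ [/= Ux Vy]]|[x y] [/= Ax By]].
    by rewrite -UA -VB; split; exists n.
  move: Ax By; rewrite -UA -VB => -[n _ Un] [m _ Vm].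
  exists (maxn n m) => //; split => /=.
    by have /subsetPset UU := ndU _ _ (leq_maxl n m); exact: UU.
  by have /subsetPset VV := ndV _ _ (leq_maxr n m); exact: VV.
have ndW : nondecreasing_seq W.
  move=> n m nm; apply/subsetPset => -[x y] [/= Ux Vy]; split => /=.
    by have /subsetPset UU := ndU _ _ nm; exact: UU.
  by have /subsetPset VV := ndV _ _ nm; exact: VV.
have M1fin n : M1 (W n) < +oo.
  rewrite /M1 iterated_measureE ge0_integral_mrestr//; last exact: measurable_section.
  have mUn : measurable (U n : set (borel X)) by exact: borel_open.
  have mVn : measurable (V n : set (borel Y)) by exact: borel_open.
  apply: (@le_lt_trans _ _ (\int[mu]_(x in A) (nu (V n) * (\1_(U n) x)%:E))).
    apply: ge0_le_integral => //.
    - exact: measurable_funTS (measurable_section tnu (mW n)).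
    - by apply: measurable_funTS; apply: measurable_funeM; exact/measurable_EFinP.
    - move=> x Ax; rewrite indicE; have [xU|xU] := boolP (x \in U n).
        rewrite mule1; apply: le_measure; rewrite ?inE//.
          by apply: measurableI => //; exact: borel_preimage_pair.
        by move=> y [[_ /=]].
      rewrite (_ : _ `&` _ = set0) ?measure0 ?mule0//.
      by rewrite -subset0 => y [[/= Ux _] _]; move: xU; rewrite notin_setE.
  rewrite ge0_integralZl//; last by apply: measurable_funTS; exact/measurable_EFinP.
  rewrite integral_indic// lte_mul_pinfty//; first by rewrite ge0_fin_numE.
  apply: le_lt_trans (Ufin n); apply: le_measure; rewrite ?inE//.
  exact: measurableI.
have agree_W n : M1 (E `&` W n) = M2 (E `&` W n).
  pose m1 := mrestr M1 (mW n); pose m2 := mrestr M2 (mW n).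
  have : m1 E = m2 E; last by [].
  apply: (@measure_unique _ R (borel (X * Y)%type) (@open (X * Y)%type)
    (fun=> setT)) => //.
  - by move=> P Q; exact: openI.
  - by move=> _; exact: openT.
  - by rewrite bigcup_const//; exists 0%N.
  - move=> P oP; apply: measures_agree_open; apply: openI => //; exact: oW.
  - by move=> _; rewrite -[X in X < _]/(M1 (setT `&` W n)) setTI.
have mEf : measurable (flip @^-1` E : set (borel (Y * X)%type)).
  exact: borel_preimage flip_continuous mE.
have mEW n : measurable (E `&` W n) by exact: measurableI.
have mEAB : measurable (\bigcup_n (E `&` W n)) by exact: bigcupT_measurable.
have ndEW : nondecreasing_seq (fun n => E `&` W n).
  by move=> n m nm; apply/subsetPset; apply: setIS; exact/subsetPset/ndW.
have M1E : M1 E = M1 (\bigcup_n (E `&` W n)).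
  by rewrite -setI_bigcupr WAB; exact: iterated_measure_support.
have M2E : M2 E = M2 (\bigcup_n (E `&` W n)).
  rewrite -setI_bigcupr WAB /M2 /= /pushforward.
  rewrite [LHS]iterated_measure_support//.
  by congr (N _); apply/seteqP; split => [[y x] [? [? ?]]|[y x] [? [? ?]]].
rewrite M1E M2E.
have c1 := nondecreasing_cvg_mu (mu := M1) mEW mEAB ndEW.
have c2 := nondecreasing_cvg_mu (mu := M2) mEW mEAB ndEW.
rewrite -(cvg_lim _ c1)// -(cvg_lim _ c2)//; congr (limn _).
by apply/funext => n /=; exact: agree_W.
Qed.

Lemma tonelli_mrestr (F : X * Y -> \bar R) :
  measurable_fun setT (F : borel (X * Y)%type -> \bar R) ->
  (forall z, 0 <= F z) ->
  \int[mrestr mu mA]_x \int[mrestr nu mB]_y F ((x : X), (y : Y)) =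
  \int[mrestr nu mB]_y \int[mrestr mu mA]_x F ((x : X), (y : Y)).
Proof.
move=> mF F0.
rewrite -(ge0_integral_iterated mu tnu mA mB mF F0).2.
rewrite (eq_measure_integral M2); last by move=> E mE _; exact: measures_agree.
have := @ge0_integral_pushforward _ _ (borel (Y * X)%type) (borel (X * Y)%type) R
  flip (continuous_borel_fun flip_continuous) N setT F measurableT mF (fun y _ => F0 y).
rewrite preimage_setT => ->.
rewrite (ge0_integral_iterated nu tmu mB mA (F := F \o flip) _ _).2//; last first.
  by move=> z; exact: F0.
apply: measurableT_comp mF _; exact: (continuous_borel_fun flip_continuous).
Qed.

End tonelli2.

(** * Tonelli and Fubini for Borel functions on products *)

Section ae.
Context d (T : measurableType d) (R : realType).
Variable mu : {measure set T -> \bar R}.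

Lemma ae_imply (P Q : T -> Prop) : {ae mu, forall x, P x} ->
  (forall x, P x -> Q x) -> {ae mu, forall x, Q x}.
Proof. by move=> aeP PQ; apply: filterS aeP. Qed.

Lemma ae_imply2 (P Q S : T -> Prop) : {ae mu, forall x, P x} ->
  {ae mu, forall x, Q x} -> (forall x, P x -> Q x -> S x) ->
  {ae mu, forall x, S x}.
Proof. by move=> aeP aeQ PQ; apply: filterS2 aeP aeQ. Qed.

Lemma ae_fin_integral (G : T -> \bar R) : measurable_fun setT G ->
  (forall z, 0 <= G z)%E -> (\int[mu]_z G z < +oo)%E ->
  {ae mu, forall z, (G z < +oo)%E}.
Proof.
move=> mG G0 Gfin.
have : mu.-integrable setT G.
  apply/integrableP; split => //; apply: le_lt_trans Gfin.
  by under eq_integral do rewrite gee0_abs//.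
move=> /integrable_ae => /(_ measurableT) aeG; apply: (ae_imply aeG) => z /(_ I).
by rewrite ge0_fin_numE.
Qed.

End ae.

Section supported_tonelli.
Local Open Scope ereal_scope.
Variables (R : realType) (X Y : ptopologicalType).

Lemma borel_section d (T : measurableType d) (F : X * Y -> T) x :
  measurable_fun setT (F : borel (X * Y)%type -> T) ->
  measurable_fun setT ((fun y => F (x, y)) : borel Y -> T).
Proof.
move=> mF; apply: measurableT_comp mF _.
exact: (continuous_borel_fun (@pair_continuous X Y x)).
Qed.

Lemma borel_sectionr d (T : measurableType d) (F : X * Y -> T) y :
  measurable_fun setT (F : borel (X * Y)%type -> T) ->
  measurable_fun setT ((fun x => F (x, y)) : borel X -> T).
Proof.
move=> mF; apply: measurableT_comp mF _.
exact: (continuous_borel_fun (@pairr_continuous X Y y)).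
Qed.

Variables (mu : {measure set (borel X) -> \bar R}) (A : set X).
Variables (nu : {measure set (borel Y) -> \bar R}) (B : set Y).

Lemma measurable_integral_section (F : X * Y -> \bar R) : tame nu B ->
  measurable_fun setT (F : borel (X * Y)%type -> \bar R) ->
  (forall z, 0 <= F z) -> (forall x y, ~ B y -> F (x, y) = 0) ->
  measurable_fun setT ((fun x => \int[nu]_y F (x, y)) : borel X -> \bar R).
Proof.
move=> tnu mF F0 FB.
have mB : measurable (B : set (borel Y)) by apply: borel_open; exact: tame_open tnu.
(* The measurability half of [mixture_integral] is wanted, and it concerns the kernel; the outer
   measure is set to zero. *)
have [+ _] := mixture_integral (measurable_section_measure tnu mB)
  (mu := mzero) (M := mixture_measure (measurable_section_measure tnu mB) mzero)
  (fun _ _ => erefl) mF F0.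
congr (measurable_fun _ _); apply/funext => x.
rewrite integral_section_measure// ge0_integral_mrestr_support//.
  exact: borel_section mF.
exact: FB.
Qed.

(** The support conditions stand in for sigma-finiteness: restricting the measures to A and B makes
    them sigma-finite and changes none of these integrals. *)
Lemma tonelli (F : X * Y -> \bar R) : tame mu A -> tame nu B ->
  measurable_fun setT (F : borel (X * Y)%type -> \bar R) ->
  (forall z, 0 <= F z) ->
  (forall x y, ~ A x -> F (x, y) = 0) -> (forall x y, ~ B y -> F (x, y) = 0) ->
  \int[mu]_x \int[nu]_y F (x, y) = \int[nu]_y \int[mu]_x F (x, y).
Proof.
move=> tmu tnu mF F0 FA FB.
have mB : measurable (B : set (borel Y)) by apply: borel_open; exact: tame_open tnu.
have mA : measurable (A : set (borel X)) by apply: borel_open; exact: tame_open tmu.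
have E1 x : \int[mrestr nu mB]_y F (x, y) = \int[nu]_y F (x, y).
  rewrite ge0_integral_mrestr_support//; first exact: borel_section mF.
  exact: FB.
have E2 y : \int[mrestr mu mA]_x F (x, y) = \int[mu]_x F (x, y).
  rewrite ge0_integral_mrestr_support//; first exact: borel_sectionr mF.
  by move=> x; exact: FA.
have [m1 _] := ge0_integral_iterated mu tnu mA mB mF F0.
have mF' : measurable_fun setT ((fun z => F (z.2, z.1)) : borel (Y * X)%type -> \bar R).
  apply: measurableT_comp mF _; apply: (@continuous_borel_fun (Y * X)%type (X * Y)%type).
  by move=> z; apply: cvg_pair; [exact: cvg_snd|exact: cvg_fst].
have [m2 _] := ge0_integral_iterated nu tmu mB mA mF' (fun z => F0 _).
have := tonelli_mrestr tmu tnu mA mB mF F0.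
have I1 x : 0 <= \int[mrestr nu mB]_y F (x, y) by exact: integral_ge0.
have I2 y : 0 <= \int[mrestr mu mA]_x F (x, y) by exact: integral_ge0.
have S1 x : ~ A x -> \int[mrestr nu mB]_y F (x, y) = 0.
  by move=> nAx; rewrite integral0_eq// => y _; exact: FA.
have S2 y : ~ B y -> \int[mrestr mu mA]_x F (x, y) = 0.
  by move=> nBy; rewrite integral0_eq// => x _; exact: FB.
rewrite (ge0_integral_mrestr_support mu mA m1 I1 S1).
under eq_integral do rewrite E1.
move=> ->.
rewrite (ge0_integral_mrestr_support nu mB m2 I2 S2).
by under eq_integral do rewrite E2.
Qed.

End supported_tonelli.

Section supported_fubini.
Local Open Scope ereal_scope.
Variables (R : realType) (X Y : ptopologicalType).
Variables (mu : {measure set (borel X) -> \bar R}) (A : set X).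
Variables (nu : {measure set (borel Y) -> \bar R}) (B : set Y).
Hypotheses (tmu : tame mu A) (tnu : tame nu B).
Variable f : X * Y -> R.
Hypothesis mf : measurable_fun setT (f : borel (X * Y)%type -> R).
Hypothesis fA : forall x y, ~ A x -> f (x, y) = 0%R.
Hypothesis fB : forall x y, ~ B y -> f (x, y) = 0%R.
Hypothesis fint : \int[mu]_x \int[nu]_y `|f (x, y)|%:E < +oo.

Let p x := \int[nu]_y (EFin \o f)^\+ (x, y).
Let n x := \int[nu]_y (EFin \o f)^\- (x, y).

Let mEf : measurable_fun setT ((EFin \o f) : borel (X * Y)%type -> \bar R).
Proof. exact/measurable_EFinP. Qed.

Let mp : measurable_fun setT (p : borel X -> \bar R).
Proof.
apply: measurable_integral_section tnu _ _ _ => //.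
  exact: measurable_funepos.
by move=> x y By; rewrite funeposE /= fB// maxxx.
Qed.

Let mn : measurable_fun setT (n : borel X -> \bar R).
Proof.
apply: measurable_integral_section tnu _ _ _ => //.
  exact: measurable_funeneg.
by move=> x y By; rewrite funenegE /= fB// oppr0 maxxx.
Qed.

Let mabs : measurable_fun setT ((fun x => \int[nu]_y `|f (x, y)|%:E) : borel X -> \bar R).
Proof.
apply: (measurable_integral_section (B := B) (F := fun z => `|f z|%:E) tnu) => //.
- by apply/measurable_EFinP; exact: measurableT_comp.
- by move=> x y By /=; rewrite fB// normr0.
Qed.

Let p_le x : p x <= \int[nu]_y `|f (x, y)|%:E.
Proof.
apply: ge0_le_integral => //.
- by apply: borel_section; exact: measurable_funepos.
- by apply/measurable_EFinP; apply: measurableT_comp => //; exact: borel_section.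
- by move=> y _; rewrite funeposE ge_max; apply/andP; split; rewrite lee_fin ?ler_norm.
Qed.

Let n_le x : n x <= \int[nu]_y `|f (x, y)|%:E.
Proof.
apply: ge0_le_integral => //.
- by apply: borel_section; exact: measurable_funeneg.
- by apply/measurable_EFinP; apply: measurableT_comp => //; exact: borel_section.
- by move=> y _; rewrite funenegE ge_max; apply/andP; split; rewrite lee_fin// -normrN ler_norm.
Qed.

Let ip : mu.-integrable setT p.
Proof.
apply/integrableP; split => //; apply: le_lt_trans fint.
under eq_integral do rewrite gee0_abs ?integral_ge0//.
by apply: ge0_le_integral => // x _; exact: integral_ge0.
Qed.

Let in_ : mu.-integrable setT n.
Proof.
apply/integrableP; split => //; apply: le_lt_trans fint.
under eq_integral do rewrite gee0_abs ?integral_ge0//.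
by apply: ge0_le_integral => // x _; exact: integral_ge0.
Qed.

Let pn x : \int[nu]_y (f (x, y))%:E = p x - n x.
Proof.
rewrite integralE; congr (_ - _); apply: eq_integral => y _.
  by rewrite !funeposE.
by rewrite !funenegE.
Qed.

Lemma ae_integrable_section :
  {ae mu, forall x, nu.-integrable setT (fun y => (f (x, y))%:E)}.
Proof.
have : mu.-integrable setT (fun x => \int[nu]_y `|f (x, y)|%:E).
  apply/integrableP; split => //; apply: le_lt_trans fint.
  by under eq_integral do rewrite gee0_abs ?integral_ge0//.
move=> /integrable_ae => /(_ measurableT); apply: filterS => x /= /(_ I) fin.
apply/integrableP; split; first exact: (borel_section x mEf).
by rewrite -ge0_fin_numE ?integral_ge0.
Qed.

(** [fine] sends infinite values to 0, so the equality is claimed only where the section is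
    integrable, that is almost everywhere. *)
Let pn_ae : {ae mu, forall x, setT x ->
  (fine (\int[nu]_y (f (x, y))%:E))%:E = p x - n x}.
Proof.
apply: (ae_imply ae_integrable_section) => x ix _.
by rewrite -pn fineK//; exact: (integrable_fin_num measurableT ix).
Qed.

(** Default values are included: the extended difference [p - n] and [fine] stay measurable across
    the sections that diverge. *)
Lemma measurable_Rintegral_section :
  measurable_fun setT ((fun x => \int[nu]_y f (x, y))%R : borel X -> R).
Proof.
rewrite /Rintegral; apply: measurableT_comp => //.
by under eq_fun do rewrite pn; exact: emeasurable_funB.
Qed.

Lemma integral_Rintegral_section :
  \int[mu]_x (\int[nu]_y f (x, y))%R%:E = \int[mu]_x p x - \int[mu]_x n x.
Proof.
rewrite -integralB//; apply: ae_eq_integral => //.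
- by apply/measurable_EFinP; exact: measurable_Rintegral_section.
- exact: emeasurable_funB.
Qed.

End supported_fubini.

(** * Complex-valued integrals *)

Section complex_norm.
Variable R : realType.
Implicit Types x y z : R[i].

(** The modulus as an element of R; the norm of R[i] takes its values in R[i]. *)
Definition nrm z : R := Re `|z|.

Lemma nrmE z : (nrm z)%:C%C = `|z|.
Proof. by rewrite /nrm normc_def. Qed.

Lemma nrm_ge0 z : 0 <= nrm z.
Proof. by rewrite -lecR nrmE normr_ge0. Qed.

Lemma nrmM x y : nrm (x * y) = nrm x * nrm y.
Proof. by apply: complexI; rewrite rmorphM/= !nrmE normrM. Qed.

Lemma nrm0 : nrm 0 = 0.
Proof. by apply: complexI; rewrite nrmE normr0. Qed.

Lemma nrm_eq0 x : nrm x = 0 -> x = 0.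
Proof. by move=> x0; apply/eqP; rewrite -normr_eq0 -nrmE x0. Qed.

Lemma nrm_real (r : R) : nrm r%:C%C = `|r|.
Proof. by rewrite /nrm normc_def /= expr0n/= addr0 sqrtr_sqr. Qed.

Lemma nrm_conj z : nrm (z^*)%C = nrm z.
Proof. by case: z => a b; rewrite /nrm !normc_def /= sqrrN. Qed.

Lemma normRe_le_nrm z : `|Re z| <= nrm z.
Proof.
rewrite /nrm normc_def /= -sqrtr_sqr ler_wsqrtr//.
by rewrite lerDl sqr_ge0.
Qed.

Lemma normIm_le_nrm z : `|Im z| <= nrm z.
Proof.
rewrite /nrm normc_def /= -sqrtr_sqr ler_wsqrtr//.
by rewrite lerDr sqr_ge0.
Qed.

Lemma nrm_le z : nrm z <= `|Re z| + `|Im z|.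
Proof.
rewrite /nrm normc_def /= -[leRHS]ger0_norm ?addr_ge0// -sqrtr_sqr.
rewrite ler_wsqrtr// sqrrD !real_normK ?num_real//.
by rewrite lerD2r lerDl mulrn_wge0// mulr_ge0.
Qed.

Lemma Re_mul x y : Re (x * y) = Re x * Re y - Im x * Im y.
Proof. by case: x; case: y. Qed.

Lemma Im_mul x y : Im (x * y) = Re x * Im y + Im x * Re y.
Proof. by case: x; case: y. Qed.

Lemma complex_eq x y : Re x = Re y -> Im x = Im y -> x = y.
Proof. by case: x => a b; case: y => c d /= -> ->. Qed.

End complex_norm.

Section complex_integral.
Context d (T : measurableType d) (R : realType).
Implicit Types f g : T -> R[i].

Definition measurableC f : Prop := measurable_fun setT (fun x => Re (f x)) /\
  measurable_fun setT (fun x => Im (f x)).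

Lemma measurableC_mul f g : measurableC f -> measurableC g ->
  measurableC (fun x => f x * g x).
Proof.
move=> [f1 f2] [g1 g2]; split.
  under eq_fun do rewrite Re_mul.
  by apply: measurable_funB; exact: measurable_funM.
under eq_fun do rewrite Im_mul.
by apply: measurable_funD; exact: measurable_funM.
Qed.

Lemma measurableC_add f g : measurableC f -> measurableC g ->
  measurableC (fun x => f x + g x).
Proof.
move=> [f1 f2] [g1 g2]; split.
  rewrite (_ : (fun x => _) = (fun x => Re (f x) + Re (g x))).
    exact: measurable_funD.
  by apply/funext => x; case: (f x); case: (g x).
rewrite (_ : (fun x => _) = (fun x => Im (f x) + Im (g x))).
  exact: measurable_funD.
by apply/funext => x; case: (f x); case: (g x).
Qed.

Lemma measurableC_cst (c : R[i]) : measurableC (fun=> c).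
Proof. by split; exact: measurable_cst. Qed.

Lemma measurableC_real (r : T -> R) : measurable_fun setT r ->
  measurableC (fun x => (r x)%:C%C).
Proof. by move=> mr; split => //=; exact: measurable_cst. Qed.

Lemma measurableC_conj f : measurableC f -> measurableC (fun x => (f x)^*%C).
Proof.
move=> [f1 f2]; split.
  by rewrite (_ : (fun x => _) = (fun x => Re (f x)))//; apply/funext => x; case: (f x).
rewrite (_ : (fun x => _) = (fun x => - Im (f x))).
  exact: measurableT_comp.
by apply/funext => x; case: (f x).
Qed.

Lemma measurable_nrm f : measurableC f -> measurable_fun setT (fun x => nrm (f x)).
Proof.
move=> [fr fi].
have -> : (fun x => nrm (f x)) =
    @Num.sqrt R \o (fun x => Re (f x) ^+ 2 + Im (f x) ^+ 2).
  by apply/funext => x; rewrite /nrm normc_def.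
apply: measurableT_comp.
  by apply: continuous_measurable_fun; exact: sqrt_continuous.
by apply: measurable_funD; exact: measurable_funX.
Qed.

Lemma measurable_Enrm f : measurableC f ->
  measurable_fun setT (fun x => (nrm (f x))%:E).
Proof. by move=> mf; apply/measurable_EFinP; exact: measurable_nrm. Qed.

Variable mu : {measure set T -> \bar R}.

Lemma integral_nrm_ge0 f : (0 <= \int[mu]_x (nrm (f x))%:E)%E.
Proof. by apply: integral_ge0 => x _; rewrite lee_fin nrm_ge0. Qed.

Lemma eq_integralC f g : f =1 g -> integralC mu f = integralC mu g.
Proof. by move=> /funext ->. Qed.

Lemma integrableC_measurable f : integrableC mu f -> measurableC f.
Proof.
by move=> [/measurable_int/measurable_EFinP fr /measurable_int/measurable_EFinP fi].
Qed.

Lemma integrableCP f : integrableC mu f <->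
  measurableC f /\ (\int[mu]_x (nrm (f x))%:E < +oo)%E.
Proof.
split=> [fi|[mf fi]].
  have mf := integrableC_measurable fi; split => //; move: fi => [fr fi].
  have := integrableD measurableT (integrable_abse fr) (integrable_abse fi).
  move=> /integrableP[_]; apply: le_lt_trans; apply: ge0_le_integral => //.
  - by move=> x _; rewrite lee_fin nrm_ge0.
  - exact: measurable_Enrm.
  - by apply: measurableT_comp => //; apply: emeasurable_funD;
      apply: measurableT_comp => //; apply/measurable_EFinP; case: mf.
  - move=> x _ /=; rewrite lee_fin ger0_norm ?addr_ge0//.
    exact: nrm_le.
split; apply/integrableP; split; try by apply/measurable_EFinP; case: mf.
  apply: le_lt_trans fi; apply: ge0_le_integral => //.
  - by apply: measurableT_comp => //; apply/measurable_EFinP; case: mf.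
  - exact: measurable_Enrm.
  - by move=> x _ /=; rewrite lee_fin normRe_le_nrm.
apply: le_lt_trans fi; apply: ge0_le_integral => //.
- by apply: measurableT_comp => //; apply/measurable_EFinP; case: mf.
- exact: measurable_Enrm.
- by move=> x _ /=; rewrite lee_fin normIm_le_nrm.
Qed.

Lemma integrableC_lin (a : R[i]) f g : integrableC mu f -> integrableC mu g ->
  integrableC mu (fun x => a * f x + g x).
Proof.
move=> /L1predP fi /L1predP gi; have [_ H] := L1pred_submod_closed mu.
by have /L1predP := H a f g fi gi.
Qed.

Lemma integrableC_add f g : integrableC mu f -> integrableC mu g ->
  integrableC mu (fun x => f x + g x).
Proof.
move=> fi gi; have := integrableC_lin 1 fi gi.
by congr (integrableC _ _); apply/funext => x; rewrite mul1r.
Qed.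

Lemma integralC0 : integralC mu (fun=> 0) = 0 :> R[i].
Proof. by rewrite /integralC /= !Rintegral_cst//= !mul0r. Qed.

Lemma integrableC0 : integrableC mu (fun=> 0).
Proof. by split; exact: integrable0. Qed.

Lemma integrableC_Zl (a : R[i]) f : integrableC mu f ->
  integrableC mu (fun x => a * f x).
Proof.
move=> fi; have := integrableC_lin a fi integrableC0.
by congr (integrableC _ _); apply/funext => x; rewrite addr0.
Qed.

Lemma integralC_add f g : integrableC mu f -> integrableC mu g ->
  integralC mu (fun x => f x + g x) = integralC mu f + integralC mu g.
Proof.
move=> [fr fi] [gr gi]; apply: complex_eq => /=.
  rewrite -RintegralD//; apply: eq_Rintegral => x _.
  by case: (f x); case: (g x).
rewrite -RintegralD//; apply: eq_Rintegral => x _.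
by case: (f x); case: (g x).
Qed.

Lemma integralC_Zl (a : R[i]) f : integrableC mu f ->
  integralC mu (fun x => a * f x) = a * integralC mu f.
Proof.
move=> [fr fi]; apply: complex_eq; rewrite ?Re_mul ?Im_mul /=.
  rewrite -!RintegralZl// -RintegralB//; last 2 first.
  - exact: (integrableZl measurableT (Re a) fr).
  - exact: (integrableZl measurableT (Im a) fi).
  by apply: eq_Rintegral => x _; rewrite Re_mul.
rewrite -!RintegralZl// -RintegralD//; last 2 first.
- exact: (integrableZl measurableT (Re a) fi).
- exact: (integrableZl measurableT (Im a) fr).
by apply: eq_Rintegral => x _; rewrite Im_mul.
Qed.

(** Integrability is asked of the product, as this is what Fubini delivers; for a = 0 both sides are
    0, whatever value [integralC] gives to f. *)
Lemma integralC_scale (a : R[i]) f : integrableC mu (fun x => a * f x) ->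
  integralC mu (fun x => a * f x) = a * integralC mu f.
Proof.
have [->|a0] := eqVneq a 0.
  by move=> _; rewrite mul0r -[RHS]integralC0; congr integralC;
    apply/funext => x; rewrite mul0r.
move=> afi; rewrite integralC_Zl//.
have := integrableC_Zl a^-1 afi; congr (integrableC _ _).
by apply/funext => x; rewrite mulKf.
Qed.

Lemma nrm_integralC_le f : measurableC f ->
  ((nrm (integralC mu f))%:E <= \int[mu]_x (nrm (f x))%:E)%E.
Proof.
move=> mf; have [->|] := eqVneq (\int[mu]_x (nrm (f x))%:E)%E +oo%E.
  by rewrite leey.
rewrite -ltey => fi.
have fI : integrableC mu f by apply/integrableCP.
have [->|z0] := eqVneq (integralC mu f) 0.
  by rewrite nrm0; apply: integral_ge0 => x _; rewrite lee_fin nrm_ge0.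
(* [c] is the unimodular factor that rotates the integral onto its modulus, which thereby becomes
   the integral of a real part. *)
pose z := integralC mu f; pose c := z^-1 * (nrm z)%:C%C.
have nz0 : nrm z != 0 by apply: contra z0 => /eqP zz; apply/eqP; exact: nrm_eq0 zz.
have nc : nrm c = 1.
  rewrite /c nrmM nrm_real ger0_norm ?nrm_ge0// -nrmM mulVf//.
  by apply: complexI; rewrite nrmE normr1.
have cz : c * z = (nrm z)%:C%C by rewrite /c mulrAC mulVf// mul1r.
have cfI := integrableC_Zl c fI.
have -> : nrm (integralC mu f) = \int[mu]_x Re (c * f x).
  have := integralC_Zl c fI; rewrite -/z cz => /(congr1 (fun w => Re w)) /= h.
  exact: esym h.
rewrite /Rintegral fineK; last exact: integrable_fin_num cfI.1.
apply: le_trans (lee_abs _) _.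
apply: le_trans (le_abse_integral mu measurableT _) _.
  by apply/measurable_EFinP; case: (integrableC_measurable cfI).
apply: ge0_le_integral => //.
- by apply: measurableT_comp => //; apply/measurable_EFinP; case: (integrableC_measurable cfI).
- exact: measurable_Enrm.
- by move=> x _ /=; rewrite lee_fin (le_trans (normRe_le_nrm _))// nrmM nc mul1r.
Qed.

Lemma ae_eq_integralC f g : measurableC f -> measurableC g ->
  {ae mu, forall x, f x = g x} -> integralC mu f = integralC mu g.
Proof.
move=> [fr fi] [gr gi] fg; rewrite /integralC /Rintegral; congr (fine _ +i* fine _)%C.
  apply: ae_eq_integral => //; try exact/measurable_EFinP.
  by apply: (ae_imply fg) => x ->.
apply: ae_eq_integral => //; try exact/measurable_EFinP.
by apply: (ae_imply fg) => x ->.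
Qed.

Lemma ae_eq_integrableC f g : measurableC f ->
  {ae mu, forall x, f x = g x} -> integrableC mu g -> integrableC mu f.
Proof.
move=> mf fg /integrableCP[mg gi]; apply/integrableCP; split => //.
apply: le_lt_trans gi; rewrite le_eqVlt; apply/orP; left; apply/eqP.
apply: ae_eq_integral => //; try exact: measurable_Enrm.
by apply: (ae_imply fg) => x ->.
Qed.

Lemma integralC_conj f : integralC mu (fun x => (f x)^*%C) = (integralC mu f)^*%C.
Proof.
apply: complex_eq => /=.
  by apply: eq_Rintegral => x _; case: (f x).
transitivity (\int[mu]_x (- Im (f x))).
  by apply: eq_Rintegral => x _; case: (f x).
rewrite /Rintegral [in LHS]integralE [in RHS]integralE.
have -> : (fun x => (- Im (f x))%:E)^\+%E = (fun x => (Im (f x))%:E)^\-%E.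
  by rewrite -funeposN.
have -> : (fun x => (- Im (f x))%:E)^\-%E = (fun x => (Im (f x))%:E)^\+%E.
  by rewrite -funenegN.
have : (0 <= \int[mu]_x (fun x => (Im (f x))%:E)^\+ x)%E by exact: integral_ge0.
have : (0 <= \int[mu]_x (fun x => (Im (f x))%:E)^\- x)%E by exact: integral_ge0.
(* Both parts are nonnegative, hence finite or [+oo]; if one is infinite, [fine] gives 0 on either
   side. *)
case: (integral _ _ _) => [n| |]//; case: (integral _ _ _) => [p| |]//= _ _.
- by rewrite opprB.
- by rewrite oppr0.
- by rewrite oppr0.
- by rewrite oppr0.
Qed.

End complex_integral.

Section complex_fubini.
Variables (R : realType) (X Y : ptopologicalType).
Variables (mu : {measure set (borel X) -> \bar R}) (A : set X).
Variables (nu : {measure set (borel Y) -> \bar R}) (B : set Y).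
Hypotheses (tmu : tame mu A) (tnu : tame nu B).
Variable f : X * Y -> R[i].
Hypothesis mf : measurableC (f : borel (X * Y)%type -> R[i]).
Hypothesis fA : forall x y, ~ A x -> f (x, y) = 0.
Hypothesis fB : forall x y, ~ B y -> f (x, y) = 0.

Let mfr : measurable_fun setT ((fun z => Re (f z)) : borel (X * Y)%type -> R).
Proof. by case: mf. Qed.
Let mfi : measurable_fun setT ((fun z => Im (f z)) : borel (X * Y)%type -> R).
Proof. by case: mf. Qed.
Let fBr x y : ~ B y -> Re (f (x, y)) = 0. Proof. by move=> /fB ->. Qed.
Let fBi x y : ~ B y -> Im (f (x, y)) = 0. Proof. by move=> /fB ->. Qed.
Lemma measurableC_section x : measurableC ((fun y => f (x, y)) : borel Y -> R[i]).
Proof. by split; [exact: (borel_section x mfr)|exact: (borel_section x mfi)]. Qed.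

Lemma measurableC_sectionr y : measurableC ((fun x => f (x, y)) : borel X -> R[i]).
Proof. by split; [exact: (borel_sectionr y mfr)|exact: (borel_sectionr y mfi)]. Qed.

Lemma measurableC_integralC_section :
  measurableC ((fun x => integralC nu (fun y => f (x, y))) : borel X -> R[i]).
Proof.
split; [exact: (measurable_Rintegral_section tnu mfr fBr)|
  exact: (measurable_Rintegral_section tnu mfi fBi)].
Qed.

Hypothesis fint : (\int[mu]_x \int[nu]_y (nrm (f (x, y)))%:E < +oo)%E.

Lemma ae_integrableC_section :
  {ae mu, forall x, integrableC nu (fun y => f (x, y))}.
Proof.
have m1 : measurable_fun setT ((fun x => \int[nu]_y (nrm (f (x, y)))%:E)%E : borel X -> \bar R).
  apply: (measurable_integral_section (B := B) (F := fun z => (nrm (f z))%:E) tnu) => //.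
  - exact: measurable_Enrm.
  - by move=> z /=; rewrite lee_fin nrm_ge0.
  - by move=> x y By /=; rewrite fB// nrm0.
have : mu.-integrable setT (fun x => \int[nu]_y (nrm (f (x, y)))%:E)%E.
  apply/integrableP; split => //; apply: le_lt_trans fint.
  under eq_integral => x _.
    rewrite gee0_abs; last exact: integral_nrm_ge0.
    over.
  by [].
move=> /integrable_ae => /(_ measurableT); apply: filterS => x /= /(_ I) fin.
apply/integrableCP; split; first exact: measurableC_section.
by rewrite -ge0_fin_numE ?integral_ge0// => y _; rewrite lee_fin nrm_ge0.
Qed.

Lemma integrableC_integralC_section :
  integrableC mu (fun x => integralC nu (fun y => f (x, y))).
Proof.
apply/integrableCP; split; first exact: measurableC_integralC_section.
apply: le_lt_trans fint; apply: ge0_le_integral => //.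
- by move=> x _; rewrite lee_fin nrm_ge0.
- by apply: measurable_Enrm; exact: measurableC_integralC_section.
- apply: (measurable_integral_section (B := B) (F := fun z => (nrm (f z))%:E) tnu) => //.
  + exact: measurable_Enrm.
  + by move=> z /=; rewrite lee_fin nrm_ge0.
  + by move=> x y By /=; rewrite fB// nrm0.
- by move=> x _; apply: nrm_integralC_le; exact: measurableC_section.
Qed.

End complex_fubini.

Section complex_fubini_swap.
Variables (R : realType) (X Y : ptopologicalType).
Variables (mu : {measure set (borel X) -> \bar R}) (A : set X).
Variables (nu : {measure set (borel Y) -> \bar R}) (B : set Y).
Hypotheses (tmu : tame mu A) (tnu : tame nu B).

Let flip (z : Y * X) : X * Y := (z.2, z.1).

Let measurable_flip :
  measurable_fun setT (flip : borel (Y * X)%type -> borel (X * Y)%type).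
Proof.
apply: (@continuous_borel_fun (Y * X)%type (X * Y)%type) => z.
by apply: cvg_pair; [exact: cvg_snd|exact: cvg_fst].
Qed.

Lemma Rintegral_swap (f : X * Y -> R) :
  measurable_fun setT (f : borel (X * Y)%type -> R) ->
  (forall x y, ~ A x -> f (x, y) = 0) -> (forall x y, ~ B y -> f (x, y) = 0) ->
  (\int[mu]_x \int[nu]_y `|f (x, y)|%:E < +oo)%E ->
  (\int[mu]_x (\int[nu]_y f (x, y))%R%:E =
   \int[nu]_y (\int[mu]_x f (x, y))%R%:E)%E.
Proof.
move=> mf fA fB fint.
have mabs : measurable_fun setT ((fun z => `|f z|%:E) : borel (X * Y)%type -> \bar R).
  by apply/measurable_EFinP; exact: measurableT_comp.
have fint' : (\int[nu]_y \int[mu]_x `|f (x, y)|%:E < +oo)%E.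
  rewrite -(tonelli tmu tnu (F := fun z => `|f z|%:E))//.
  - by move=> x y Ax /=; rewrite fA// normr0.
  - by move=> x y By /=; rewrite fB// normr0.
have mf' : measurable_fun setT ((fun z => f (z.2, z.1)) : borel (Y * X)%type -> R).
  exact: measurableT_comp mf measurable_flip.
rewrite (integral_Rintegral_section tnu mf fB fint).
rewrite (integral_Rintegral_section (f := fun z => f (z.2, z.1)) tmu mf' _ fint'); last first.
  by move=> y x; exact: fA.
have mEf : measurable_fun setT ((EFin \o f) : borel (X * Y)%type -> \bar R).
  exact/measurable_EFinP.
congr (_ - _)%E.
- rewrite (tonelli tmu tnu (F := (EFin \o f)^\+%E)).
  + apply: eq_integral => y _; apply: eq_integral => x _.
    by rewrite !funeposE.
  + exact: measurable_funepos.
  + by [].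
  + by move=> x y Ax; rewrite funeposE /= fA// maxxx.
  + by move=> x y By; rewrite funeposE /= fB// maxxx.
- rewrite (tonelli tmu tnu (F := (EFin \o f)^\-%E)).
  + apply: eq_integral => y _; apply: eq_integral => x _.
    by rewrite !funenegE.
  + exact: measurable_funeneg.
  + by [].
  + by move=> x y Ax; rewrite funenegE /= fA// oppr0 maxxx.
  + by move=> x y By; rewrite funenegE /= fB// oppr0 maxxx.
Qed.

Lemma integralC_swap (f : X * Y -> R[i]) :
  measurableC (f : borel (X * Y)%type -> R[i]) ->
  (forall x y, ~ A x -> f (x, y) = 0) -> (forall x y, ~ B y -> f (x, y) = 0) ->
  (\int[mu]_x \int[nu]_y (nrm (f (x, y)))%:E < +oo)%E ->
  integralC mu (fun x => integralC nu (fun y => f (x, y))) =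
  integralC nu (fun y => integralC mu (fun x => f (x, y))).
Proof.
move=> [mfr mfi] fA fB fint.
have bound (g : X * Y -> R) : measurable_fun setT (g : borel (X * Y)%type -> R) ->
    (forall z, `|g z| <= nrm (f z)) ->
    (\int[mu]_x \int[nu]_y `|g (x, y)|%:E < +oo)%E.
  move=> mg gf; apply: le_lt_trans fint.
  have gB x y : ~ B y -> g (x, y) = 0.
    move=> By; apply/eqP; rewrite -normr_le0 (le_trans (gf _))//.
    by rewrite fB// nrm0.
  have mn := measurable_Enrm (conj mfr mfi).
  have mg' : measurable_fun setT ((fun z => `|g z|%:E) : borel (X * Y)%type -> \bar R).
    by apply/measurable_EFinP; exact: measurableT_comp.
  apply: ge0_le_integral => //.
  - by move=> x _; exact: integral_ge0.
  - apply: (measurable_integral_section (B := B) (F := fun z => `|g z|%:E) tnu) => //.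
    by move=> x y By /=; rewrite gB// normr0.
  - apply: (measurable_integral_section (B := B) (F := fun z => (nrm (f z))%:E) tnu) => //.
    + by move=> z /=; rewrite lee_fin nrm_ge0.
    + by move=> x y By /=; rewrite fB// nrm0.
  - move=> x _; apply: ge0_le_integral => //.
    + exact: (borel_section x mg').
    + exact: (borel_section x mn).
    + by move=> y _; rewrite lee_fin.
have mfr' : measurable_fun setT ((fun z => Re (f z)) : borel (X * Y)%type -> R) by [].
have mfi' : measurable_fun setT ((fun z => Im (f z)) : borel (X * Y)%type -> R) by [].
apply: complex_eq; rewrite /= /Rintegral; congr fine.
  apply: (Rintegral_swap mfr').
  - by move=> x y /fA ->.
  - by move=> x y /fB ->.
  - by apply: (bound _ mfr') => z; exact: normRe_le_nrm.
apply: (Rintegral_swap mfi').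
- by move=> x y /fA ->.
- by move=> x y /fB ->.
- by apply: (bound _ mfi') => z; exact: normIm_le_nrm.
Qed.

End complex_fubini_swap.

(** * Haar measure on locally compact groups *)

Section bounded_sets.
Variable G : topGroupType.
Implicit Types (A B : set G) (x y : G).

(** Relative compactness, in a form that passes to subsets at once; in a Hausdorff group it means
    compact closure. *)
Definition bounded_set A := exists2 C : set G, compact C & A `<=` C.

Lemma bounded_setS A B : A `<=` B -> bounded_set B -> bounded_set A.
Proof. by move=> AB [C cC BC]; exists C => // x /AB/BC. Qed.

Lemma bounded_setU A B : bounded_set A -> bounded_set B -> bounded_set (A `|` B).
Proof.
move=> [C cC AC] [D cD BD]; exists (C `|` D); first exact: compactU.
by move=> x [/AC|/BD]; [left|right].
Qed.

Lemma bounded_set_inv A : bounded_set A -> bounded_set [set x | A (x^-1)%g].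
Proof.
move=> [C cC AC]; exists [set (x^-1)%g | x in C].
  apply: (continuous_compact (f := fun x : G => (x^-1)%g)) => //.
  by apply: continuous_subspaceT; exact: invg_continuous.
by move=> x /AC Cx; exists (x^-1)%g => //; exact: invgK.
Qed.

Definition mulset A B := [set z | exists x y, [/\ A x, B y & z = (x * y)%g]].

Lemma bounded_mulset A B : bounded_set A -> bounded_set B -> bounded_set (mulset A B).
Proof.
move=> [C cC AC] [D cD BD].
exists [set (z.1 * z.2)%g | z in C `*` D].
  apply: (continuous_compact (f := fun z : G * G => (z.1 * z.2)%g)).
    by apply: continuous_subspaceT; exact: mulg_continuous.
  exact: compact_setX.
by move=> _ [x [y [/AC Cx /BD Dy ->]]]; exists (x, y).
Qed.

Lemma mulg_continuousl x : continuous (fun y : G => (x * y)%g).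
Proof.
move=> y; apply: (@continuous_comp _ _ _ (fun y => (x, y)) (fun z : G * G => (z.1 * z.2)%g)).
  exact: pair_continuous.
exact: mulg_continuous.
Qed.

Lemma mulg_continuousr x : continuous (fun y : G => (y * x)%g).
Proof.
move=> y; apply: (@continuous_comp _ _ _ (fun y => (y, x)) (fun z : G * G => (z.1 * z.2)%g)).
  exact: pairr_continuous.
exact: mulg_continuous.
Qed.

Lemma open_translate x A : open A -> open [set y | A (x * y)%g].
Proof. by move=> oA; move/continuousP: (@mulg_continuousl x); apply. Qed.

Lemma open_mulset A B : open B -> open (mulset A B).
Proof.
move=> oB; rewrite (_ : mulset A B = \bigcup_(x in A) [set z | B (x^-1 * z)%g]).
  by apply: bigcup_open => x _; exact: open_translate.
apply/seteqP; split => [_ [x [y [Ax By ->]]]|z [x Ax Bz]].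
  by exists x => //=; rewrite mulKg.
by exists x, (x^-1 * z)%g; split => //; rewrite mulVKg.
Qed.

Lemma open_invset A : open A -> open [set x : G | A (x^-1)%g].
Proof. by move=> oA; move/continuousP: (@invg_continuous G); apply. Qed.

(* Products of n + 1 elements. *)
Fixpoint powset A n := if n is k.+1 then mulset A (powset A k) else A.

Lemma open_powset A n : open A -> open (powset A n).
Proof. by move=> oA; elim: n => //= n; exact: open_mulset. Qed.

Lemma bounded_powset A n : bounded_set A -> bounded_set (powset A n).
Proof. by move=> bA; elim: n => //= n; exact: bounded_mulset. Qed.

Lemma powset_mul A i j x y : powset A i x -> powset A j y ->
  powset A (i + j).+1 (x * y)%g.
Proof.
elim: i x => [|i IH] x /=; first by move=> Ax Ay; exists x, y.
move=> [a [b [Aa Ab ->]]] Ay; exists a, (b * y)%g; split => //.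
  exact: IH.
by rewrite mulgA.
Qed.

Lemma powsetS A B i j : A `<=` B -> B 1%g -> (i <= j)%N ->
  powset A i `<=` powset B j.
Proof.
move=> AB B1 ij; have H : powset A i `<=` powset B i.
  elim: i {ij} => //= i IH _ [x [y [/AB Bx /IH By ->]]].
  by exists x, y.
apply: (subset_trans H); move: ij => /subnK <-.
elim: (j - i)%N => // n IH x /IH Bx; rewrite addSn /=.
by exists 1%g, x; rewrite mul1g.
Qed.

Lemma powset_inv A n x : (forall x, A x -> A (x^-1)%g) -> powset A n x ->
  powset A n (x^-1)%g.
Proof.
move=> Ainv; elim: n x => [|n IH] x /=; first exact: Ainv.
move=> [a [b [Aa Ab ->]]]; rewrite invgM.
have := powset_mul (IH _ Ab) (Ainv _ Aa : powset A 0 _).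
by rewrite addn0.
Qed.

Definition sigma_bounded A := exists U : nat -> set G,
  (forall n, open (U n) /\ bounded_set (U n)) /\ A `<=` \bigcup_n U n.

Lemma sigma_bounded_bigcup (A : nat -> set G) :
  (forall n, sigma_bounded (A n)) -> sigma_bounded (\bigcup_n A n).
Proof.
move=> sA; pose U n := sval (cid (sA n)).
have UP n : (forall k, open (U n k) /\ bounded_set (U n k)) /\
    A n `<=` \bigcup_k U n k.
  exact: svalP (cid (sA n)).
pose q j : nat * nat := odflt (0, 0)%N (@choice.unpickle (nat * nat)%type j).
exists (fun j => U (q j).1 (q j).2); split => [j|x [n _ Ax]].
  exact: (UP _).1.
have [k _ Ux] := (UP n).2 _ Ax.
by exists (choice.pickle (n, k)) => //; rewrite /q choice.pickleK.
Qed.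

Definition exhausted_subgroup A := [/\ A 1%g,
  forall x y, A x -> A y -> A (x * y)%g,
  forall x, A x -> A (x^-1)%g &
  exists U : nat -> set G, [/\ forall n, open (U n) /\ bounded_set (U n),
    nondecreasing_seq U & \bigcup_n U n = A]].

Hypothesis lcG : lc_group G.

Lemma lc_open_bounded x : exists U : set G, [/\ open U, U x & bounded_set U].
Proof.
have [_ lc] := lcG; have [V xV' [cV _]] := lc x I.
have xV : nbhs x V by move: xV'; rewrite /within /=; apply: filterS => y; apply.
exists V°; split; first exact: open_interior.
  by move: xV; rewrite /interior.
by exists V => //; exact: interior_subset.
Qed.

(** The subgroup is generated by the open sets covering A and a relatively compact neighbourhood [V]
    of 1. The latter puts 1 in every [B n], which makes the powers increase with the exponent. *)
Lemma sigma_bounded_subgroup A : sigma_bounded A ->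
  exists S, exhausted_subgroup S /\ A `<=` S.
Proof.
move=> [U [UP AU]].
have [V [oV V1 bV]] := lc_open_bounded 1%g.
pose sym (W : set G) := W `|` [set x | W (x^-1)%g].
have osym W : open W -> open (sym W).
  by move=> oW; apply: openU => //; exact: open_invset.
have bsym W : bounded_set W -> bounded_set (sym W).
  by move=> bW; apply: bounded_setU => //; exact: bounded_set_inv.
pose B n := sym (V `|` \big[setU/set0]_(i < n.+1) U i).
have oB n : open (B n).
  apply/osym/openU => //; rewrite -bigcup_mkord; apply: bigcup_open => i _.
  by have [] := UP i.
have bB n : bounded_set (B n).
  apply/bsym/bounded_setU => //; elim: n.+1 => [|k IH].
    by rewrite big_ord0; exact: bounded_setS bV.
  by rewrite big_ord_recr; apply: bounded_setU => //; have [] := UP k.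
have B1 n : B n 1%g by left; left.
have Binv n x : B n x -> B n (x^-1)%g.
  by move=> [Bx|Bx]; [right; rewrite /= invgK|left].
have ndB n m : (n <= m)%N -> B n `<=` B m.
  move=> nm; have sub : \big[setU/set0]_(i < n.+1) U i `<=`
      \big[setU/set0]_(i < m.+1) U i by apply: subset_bigsetU.
  by move=> x [[Vx|/sub Ux]|[Vx|/sub Ux]];
    [left; left|left; right|right; left|right; right].
(* The letters and the length of the words grow together: each [C n] stays open and relatively
   compact, while the union becomes closed under products. *)
pose C n := powset (B n) n.
have ndC n m : (n <= m)%N -> C n `<=` C m.
  by move=> nm; apply: powsetS => //; exact: ndB.
exists (\bigcup_n C n); split; last first.
  move=> x /AU[n _ Ux]; exists n => //.
  apply: (@powsetS (B n) (B n) 0 n) => //; left; right.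
  by rewrite -bigcup_mkord; exists n => /=.
split.
- by exists 0%N => //; exact: (B1 0%N).
(* [powset] with index n consists of words of n+1 letters, so words of n+1 and m+1 letters
   concatenate to index n+m+1. *)
- move=> x y [n _ Cx] [m _ Cy]; exists (n + m).+1 => //.
  apply: (@powsetS (B (n + m)%N)) (powset_mul _ _) => //.
  + exact: ndB.
  + by move: Cx; apply: powsetS => //; apply: ndB; exact: leq_addr.
  + by move: Cy; apply: powsetS => //; apply: ndB; exact: leq_addl.
- move=> x [n _ Cx]; exists n => //; apply: powset_inv => //.
  exact: Binv.
- exists C; split => //.
  + by move=> n; split; [exact: open_powset|exact: bounded_powset].
  + by move=> n m nm; apply/subsetPset; exact: ndC.
Qed.

Lemma exhausted_subgroup_exists : exists S, exhausted_subgroup S.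
Proof.
have [S [? _]] : exists S, exhausted_subgroup S /\ set0 `<=` S.
  apply: sigma_bounded_subgroup; exists (fun=> set0); split => // _.
  by split; [exact: open0|exists set0 => //; exact: compact0].
by exists S.
Qed.

Lemma exhausted_sigma_bounded S : exhausted_subgroup S -> sigma_bounded S.
Proof. by move=> [_ _ _ [U [UP _ <-]]]; exists U; split. Qed.

Lemma sigma_bounded_translate x S : sigma_bounded S ->
  sigma_bounded [set y | S (x * y)%g].
Proof.
move=> [U [UP SU]]; exists (fun n => [set y | U n (x * y)%g]); split.
  move=> n; have [oU bU] := UP n; split; first exact: open_translate.
  apply: (@bounded_setS _ (mulset [set (x^-1)%g] (U n))); last first.
    by apply: bounded_mulset => //; exists [set (x^-1)%g] => //; exact: compact_set1.
  by move=> y /= Uy; exists (x^-1)%g, (x * y)%g; split => //; rewrite mulKg.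
by move=> y /= /SU[n _ Uy]; exists n.
Qed.

End bounded_sets.

Section haar.
Local Open Scope ereal_scope.
Variables (R : realType) (G : topGroupType).
Hypothesis lcG : lc_group G.
Variable mu : {measure set (borel G) -> \bar R}.
Hypothesis haar : left_haar mu.

Lemma haar_bounded (A : set (borel G)) : measurable A ->
  bounded_set (A : set G) -> mu A < +oo.
Proof.
move=> mA [C cC AC]; apply: le_lt_trans (haar_compact haar cC).
apply: le_measure; rewrite ?inE//.
by apply: borel_closed; exact: compact_closed lcG.1 cC.
Qed.

Lemma haar_lindelof (V : set G) : open V -> mu V < +oo -> lindelof_on mu V.
Proof.
by apply: lindelof_inner_regular; [exact: lcG.1|exact: haar_inner haar].
Qed.

Lemma haar_tame (S : set G) : exhausted_subgroup S -> tame mu S.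
Proof.
move=> [_ _ _ [U [UP ndU US]]].
have Ufin n : mu (U n) < +oo.
  by have [oU bU] := UP n; apply: haar_bounded => //; exact: borel_open.
split; last by exists U; split => // n; have [] := UP n.
rewrite -US; apply: lindelof_bigcup => n; have [oU _] := UP n => //.
exact: haar_lindelof.
Qed.

Lemma haar_translate (x : G) (A : set (borel G)) : measurable A ->
  mu [set y | (A : set G) (x * y)%g] = mu A.
Proof.
move=> mA; rewrite -(haar_invariant haar x^-1%g mA); congr (mu _).
apply/seteqP; split => [y Ay|_ [y Ay <-]] /=.
  by exists (x * y)%g => //; rewrite mulKg.
by rewrite mulVKg.
Qed.

Lemma ge0_integral_translate (x : G) (b : G -> \bar R) :
  measurable_fun setT (b : borel G -> \bar R) -> (forall y, 0 <= b y) ->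
  \int[mu]_y b (x * y)%g = \int[mu]_y b y.
Proof.
move=> mb b0.
have mt := continuous_borel_fun (@mulg_continuousl G x).
rewrite [RHS](eq_measure_integral
  (measure_function_pushforward__canonical__measure_function_Measure mu mt)); last first.
  by move=> A mA _; exact/esym/haar_translate.
have := @ge0_integral_pushforward _ _ (borel G) (borel G) R _ mt mu setT b
  measurableT mb (fun y _ => b0 y).
by rewrite preimage_setT => ->.
Qed.

(** If U were null, so would be its translates; finitely many of them cover any given compact set,
    and inner regularity would make the whole group null. *)
Lemma haar_open_gt0 (U : set G) : open U -> U !=set0 -> 0 < mu U.
Proof.
move=> oU [u Uu]; rewrite lt0e measure_ge0 andbT; apply/eqP => U0.
have := haar_neq0 haar; apply/negP; rewrite negbK.
rewrite (haar_inner haar openT) eq_le; apply/andP; split; last first.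
  apply: ereal_sup_ubound; exists set0; last exact: measure0.
  by split => //; exact: compact0.
apply: ge_ereal_sup => _ [C [cC _] <-].
(* The set attached to x is the left translate of U that moves u to x. *)
have [D _ CD] : finite_subset_cover setT (fun x : G => [set y | U (u * (x^-1 * y))%g]) C.
  move: (cC); rewrite compact_cover; apply.
    move=> x _; apply: (@open_translate _ _ [set y | U (u * y)%g]).
    exact: open_translate.
  by move=> x Cx; exists x => //=; rewrite mulVg mulg1.
have mC : measurable (C : set (borel G)).
  by apply: borel_closed; exact: compact_closed lcG.1 cC.
rewrite measure_le0; apply/eqP.
apply: measure_negligible => //.
apply: (@negligibleS _ (borel G) _ _ _ _ CD); rewrite /cover bigcup_fset.
elim/big_ind : _ => [|A B|x _]; [exact: negligible_set0|exact: negligibleU|].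
have mV : measurable ([set y | U (u * y)%g] : set (borel G)).
  by apply: borel_open; exact: open_translate.
exists [set y | U (u * (x^-1 * y))%g]; split => //.
  apply: borel_open; apply: (@open_translate _ _ [set y | U (u * y)%g]).
  exact: open_translate.
transitivity (mu [set y | U (u * y)%g]); first exact: (haar_translate x^-1%g mV).
by rewrite -U0; apply: haar_translate; exact: borel_open.
Qed.

End haar.

Section continuous_group.
Variables (T : topologicalType) (G : topGroupType).

Lemma continuous_mulg2 (f g : T -> G) : continuous f -> continuous g ->
  continuous (fun x => (f x * g x)%g).
Proof.
move=> cf cg x.
apply: (@continuous_comp _ _ _ (fun x => (f x, g x))
  (fun y : G * G => (y.1 * y.2)%g)); last exact: mulg_continuous.
by apply: cvg_pair; [exact: cf|exact: cg].
Qed.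

Lemma continuous_invg1 (f : T -> G) : continuous f ->
  continuous (fun x => (f x)^-1%g).
Proof.
move=> cf x; apply: (@continuous_comp _ _ _ f (fun y : G => y^-1%g)).
  exact: cf.
exact: invg_continuous.
Qed.

End continuous_group.

Lemma measurable_comp_continuous (X Y : ptopologicalType) d (T : measurableType d)
    (f : Y -> T) (h : X -> Y) : measurable_fun setT (f : borel Y -> T) ->
  continuous h -> measurable_fun setT ((fun x => f (h x)) : borel X -> T).
Proof.
move=> mf ch; apply: measurableT_comp mf _; exact: continuous_borel_fun.
Qed.

(** * Inversion and the modular function on an abelian group *)

Section inversion.
Local Open Scope ereal_scope.
Variables (R : realType) (K : topGroupType).
Hypothesis lcK : lc_group K.
Hypothesis abK : forall x y : K, (x * y)%g = (y * x)%g.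
Variable mu : {measure set (borel K) -> \bar R}.
Hypothesis haar : left_haar mu.

Lemma ge0_integral_inv (S : set K) (f : K -> \bar R) : exhausted_subgroup S ->
  measurable_fun setT (f : borel K -> \bar R) -> (forall y, 0 <= f y) ->
  (forall y, ~ S y -> f y = 0) ->
  \int[mu]_y f (y^-1)%g = \int[mu]_y f y.
Proof.
move=> eS mf f0 fS; have tS := haar_tame lcK haar eS.
have [S1 SM SV [U [UP ndU US]]] := eS.
have [n _ Un1] : (\bigcup_n U n) 1%g by rewrite US.
have [oU bU] := UP n.
pose V := U n `&` [set x | U n (x^-1)%g].
have oV : open V by apply: openI => //; exact: open_invset.
have V1 : V 1%g by split => //=; rewrite invg1.
have VS x : V x -> S x by move=> [Ux _]; rewrite -US; exists n.
have mV : measurable (V : set (borel K)) by exact: borel_open.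
have Vfin : mu V < +oo.
  by apply: haar_bounded => //; apply: bounded_setS bU => x [].
have V0 : 0 < mu V by apply: haar_open_gt0 => //; exists 1%g.
(* For V symmetric, the integral of f (y^-1 x) 1_V (y) in x and y is mu V times
   the integral of f in one order, and mu V times that of y |-> f (y^-1) in the
   other. *)
pose g x : \bar R := (\1_V x)%:E.
have g0 x : 0 <= g x by rewrite lee_fin.
have mg : measurable_fun setT (g : borel K -> \bar R) by exact/measurable_EFinP.
have gS x : ~ S x -> g x = 0.
  by move=> nSx; rewrite /g indicE memNset// => /VS.
have ig : \int[mu]_x g x = mu V by rewrite integral_indic// setIT.
have cfst : continuous (fun z : K * K => z.1) by move=> z; exact: cvg_fst.
have csnd : continuous (fun z : K * K => z.2) by move=> z; exact: cvg_snd.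
pose F1 (z : K * K) := f (z.2^-1 * z.1)%g * g z.2.
have mF1 : measurable_fun setT (F1 : borel (K * K)%type -> \bar R).
  apply: emeasurable_funM; last exact: measurable_comp_continuous mg csnd.
  apply: measurable_comp_continuous mf _.
  by apply: continuous_mulg2 => //; exact: continuous_invg1.
have F1S2 x y : ~ S y -> F1 (x, y) = 0 by move=> nS; rewrite /F1 gS// mule0.
have F1S1 x y : ~ S x -> F1 (x, y) = 0.
  move=> nSx; have [Sy|nSy] := pselect (S y); last exact: F1S2.
  rewrite /F1 fS ?mul0e//= => Syx; apply: nSx.
  by rewrite -(mulVKg y x); exact: SM.
pose F2 (z : K * K) := f (z.2^-1)%g * g (z.1 * z.2)%g.
have mF2 : measurable_fun setT (F2 : borel (K * K)%type -> \bar R).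
  apply: emeasurable_funM.
    by apply: measurable_comp_continuous mf _; exact: continuous_invg1.
  by apply: measurable_comp_continuous mg _; exact: continuous_mulg2.
have F2S2 x y : ~ S y -> F2 (x, y) = 0.
  by move=> nS; rewrite /F2 fS ?mul0e//= => /SV; rewrite invgK.
have F2S1 x y : ~ S x -> F2 (x, y) = 0.
  move=> nSx; have [Sy|nSy] := pselect (S y); last exact: F2S2.
  rewrite /F2 gS ?mule0//= => Sxy; apply: nSx.
  by rewrite -(mulgK y x); apply: SM => //; exact: SV.
have F1_0 z : 0 <= F1 z by rewrite mule_ge0.
have F2_0 z : 0 <= F2 z by rewrite mule_ge0.
have E1 : (\int[mu]_x f x) * mu V = \int[mu]_y \int[mu]_x F1 (x, y).
  rewrite -ig -ge0_integralZl//; last exact: integral_ge0.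
  apply: eq_integral => y _.
  have mft : measurable_fun setT ((fun x => f (y^-1 * x)%g) : borel K -> \bar R).
    by apply: measurable_comp_continuous mf _; exact: mulg_continuousl.
  rewrite /F1 /= (ge0_integralZr mu measurableT mft (fun x _ => f0 _) (g0 y)).
  by rewrite ge0_integral_translate.
have E2 : (\int[mu]_x f x^-1%g) * mu V = \int[mu]_x \int[mu]_y F2 (x, y).
  have mfV : measurable_fun setT ((fun x => f x^-1%g) : borel K -> \bar R).
    by apply: measurable_comp_continuous mf _; exact: invg_continuous.
  rewrite (tonelli tS tS mF2 F2_0 F2S1 F2S2).
  rewrite -(ge0_integralZr mu measurableT mfV (fun x _ => f0 _) (ltW V0)).
  apply: eq_integral => y _.
  have mgt : measurable_fun setT ((fun x => g (x * y)%g) : borel K -> \bar R).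
    by apply: measurable_comp_continuous mg _; exact: mulg_continuousr.
  rewrite /F2 /= (ge0_integralZl mu measurableT mgt (fun x _ => g0 _) (f0 _)).
  rewrite -ig; congr (_ * _).
  under [RHS]eq_integral do rewrite abK.
  by rewrite ge0_integral_translate.
(* For fixed x the translation of y into x y turns [F1] into [F2], since (x y)^-1 x = y^-1. *)
have : (\int[mu]_x f x^-1%g) * mu V = (\int[mu]_x f x) * mu V.
  rewrite E1 E2 -(tonelli tS tS mF1 F1_0 F1S1 F1S2).
  apply: eq_integral => x _.
  rewrite -(ge0_integral_translate haar x (b := fun y => F1 (x, y))).
  - by apply: eq_integral => y _; rewrite /F1 /F2 /= invgM -mulgA mulVg mulg1.
  - exact: (borel_section x mF1).
  - by move=> y; rewrite mule_ge0.
have Vf : mu V \is a fin_num by rewrite ge0_fin_numE.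
have Vn0 : fine (mu V) != 0%R by rewrite fine_eq0// gt_eqF.
rewrite -(fineK Vf) => /(congr1 (fun z => z * ((fine (mu V))^-1)%:E)).
by rewrite -!muleA -EFinM divff// !mule1.
Qed.

End inversion.

Section modular.
Local Open Scope ereal_scope.
Variables (R : realType) (K : topGroupType).
Hypothesis lcK : lc_group K.
Hypothesis abK : forall x y : K, (x * y)%g = (y * x)%g.
Variable mu : {measure set (borel K) -> \bar R}.
Hypothesis haar : left_haar mu.

(** Right translates are left translates here, so a set of positive finite measure keeps its
    measure, and this measure cancels. *)
Lemma abelian_modular (Delta : K -> R) : modular_function mu Delta ->
  forall x, Delta x = 1%R.
Proof.
move=> modD x; have [U [oU U1 bU]] := lc_open_bounded lcK 1%g.
have mU : measurable (U : set (borel K)) by exact: borel_open.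
have Ufin : mu U \is a fin_num.
  by rewrite ge0_fin_numE//; exact: haar_bounded.
have U0 : 0 < mu U by apply: haar_open_gt0 => //; exists 1%g.
have := modularE modD x mU.
rewrite (_ : [set (y * x)%g | y in U] = [set (x * y)%g | y in U]); last first.
  by apply: eq_imagel => y _; exact: abK.
rewrite (haar_invariant haar) // -(fineK Ufin) => /(congr1 fine) /= h.
have Un0 : fine (mu U) != 0%R by rewrite fine_eq0// gt_eqF.
by apply: (mulIf Un0); rewrite -h mul1r.
Qed.

End modular.

(** * Products of locally compact spaces, and bump functions *)

Lemma hausdorff_prod (X Y : topologicalType) : hausdorff_space X ->
  hausdorff_space Y -> hausdorff_space (X * Y)%type.
Proof.
move=> hX hY [p1 p2] [q1 q2] pq; congr pair.
- apply: hX => A B Ap Bq.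
  have nA : nbhs (p1, p2) (fst @^-1` A) by exact: cvg_fst.
  have nB : nbhs (q1, q2) (fst @^-1` B) by exact: cvg_fst.
  by have [[a b] [/= Aa Bb]] := pq _ _ nA nB; exists a.
- apply: hY => A B Ap Bq.
  have nA : nbhs (p1, p2) (snd @^-1` A) by exact: cvg_snd.
  have nB : nbhs (q1, q2) (snd @^-1` B) by exact: cvg_snd.
  by have [[a b] [/= Aa Bb]] := pq _ _ nA nB; exists b.
Qed.

Lemma closed_setX (X Y : topologicalType) (A : set X) (B : set Y) :
  closed A -> closed B -> closed (A `*` B).
Proof.
move=> cA cB; have -> : A `*` B = fst @^-1` A `&` snd @^-1` B by [].
apply: closedI.
  have /continuous_closedP : continuous (@fst X Y) by move=> x; exact: cvg_fst.
  by apply.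
have /continuous_closedP : continuous (@snd X Y) by move=> x; exact: cvg_snd.
by apply.
Qed.

Lemma locally_compact_prod (X Y : topologicalType) :
  locally_compact [set: X] -> locally_compact [set: Y] ->
  locally_compact [set: X * Y].
Proof.
move=> lX lY [x y] _; have [A xA [cA clA]] := lX x I.
have [B yB [cB clB]] := lY y I.
exists (A `*` B); last by split; [exact: compact_setX|exact: closed_setX].
exists (A, B); last by move=> z [/= Az Bz] _.
by split => /=; [move: xA|move: yB]; rewrite /within /=; apply: filterS => z; apply.
Qed.

Lemma lc_semidirect (H K : topGroupType) (tau : cont_hom_Aut H K) :
  lc_group H -> lc_group K -> lc_group (semidirect tau).
Proof.
move=> [hH cH] [hK cK]; split.
  exact: (@hausdorff_prod H K hH hK).
exact: (@locally_compact_prod H K cH cK).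
Qed.

Section bump.
Variables (R : realType) (G : topologicalType).
Hypothesis lcG : locally_compact [set: G].
Hypothesis hG : hausdorff_space G.

(** The compactly supported test functions of [weighted_product] that lie below the indicator of
    E. *)
Definition bump (E : set G) (phi : G -> R) :=
  [/\ continuous phi, compact (closure [set x | phi x != 0]),
      forall x, 0 <= phi x <= 1 & forall x, ~ E x -> phi x = 0].

Lemma bump_max E phi psi : bump E phi -> bump E psi -> bump E (phi \max psi).
Proof.
move=> [c1 k1 b1 z1] [c2 k2 b2 z2]; split.
- move=> x; exact: continuous_max (c1 x) (c2 x).
- apply: (subclosed_compact _ (compactU k1 k2)); first exact: closed_closure.
  rewrite -closureU; apply: closureS => x /=.
  have [p0|p0 _] := eqVneq (phi x) 0; last by left.
  have [q0|q0 _] := eqVneq (psi x) 0; last by right.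
  by rewrite p0 q0 maxxx eqxx.
- move=> x; move: (b1 x) (b2 x) => /andP[? ?] /andP[? ?] /=.
  by rewrite le_max ge_max; apply/andP; split; [apply/orP; left|apply/andP].
- by move=> x Ex; rewrite /= z1// z2// maxxx.
Qed.

Lemma bump_exists (E : set G) (x : G) : open E -> E x ->
  exists phi V, [/\ bump E phi, open V, V x & forall y, V y -> phi y = 1].
Proof.
move=> oE Ex; have [C xC' [cC clC]] := lcG I (x := x).
have xC : nbhs x C by move: xC'; rewrite /within /=; apply: filterS => y; apply.
pose E' := E `&` C°.
have oE' : open E' by apply: openI => //; exact: open_interior.
have E'x : E' x by split => //; rewrite /interior.
have : uniform_separator [set x] (~` E').
  apply: (@locally_compact_completely_regular _ R lcG hG).
    exact: open_closedC.
  by move=> /(_ E'x).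
move=> /(uniform_separatorP (R := R))[f [cf f01 fx fE']].
have f01' y : 0 <= f y <= 1.
  by have := f01 (f y); rewrite /= in_itv/=; apply; exists y.
have fx0 : f x = 0 by apply: fx; exists x.
have fE y : ~ E' y -> f y = 1 by move=> nE; apply: fE'; exists y.
(* Doubling and truncating makes phi equal to 1 on the whole open set where f is below 1/2, and not
   merely at x. *)
pose phi y := Num.min 1 (2 * (1 - f y)).
have phiE' y : ~ E' y -> phi y = 0.
  by move=> /fE fy1; rewrite /phi fy1 subrr mulr0; apply/min_idPr.
exists phi, (f @^-1` [set r | r < 2^-1]); split.
- split.
  + have c1 : continuous ((fun=> 1) : G -> R) by move=> z; exact: cvg_cst.
    have c2 : continuous ((fun z => 2 * (1 - f z)) : G -> R).
      move=> z; apply: cvgM; first exact: cvg_cst.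
      by apply: cvgB; [exact: cvg_cst|exact: cf].
    by move=> y; exact: (continuous_min (c1 y) (c2 y)).
  + apply: (subclosed_compact _ cC); first exact: closed_closure.
    rewrite (closure_id C).1//; apply: closureS => y /= /eqP phiy.
    apply: contrapT => nCy; apply: phiy; apply: phiE' => -[_ /interior_subset].
    exact: nCy.
  + move=> y; have /andP[f0 f1] := f01' y; rewrite /phi le_min ler01/=.
    by rewrite mulr_ge0 ?subr_ge0//= ge_min lexx.
  + by move=> y nEy; apply: phiE' => -[].
- by move/continuousP : cf; apply; exact: open_lt.
- by rewrite /= fx0 invr_gt0.
- move=> y /= fy; apply/min_idPl.
  by lra.
Qed.

End bump.

(** * The Haar measure of the semidirect product *)

(** If [mu E] exceeded c, so would the measure of a finite union of members of F; as F is closed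
    under unions, that union is a member and is bounded by c. *)
Lemma lindelof_le (R : realType) (X : ptopologicalType)
    (mu : {measure set (borel X) -> \bar R}) (E : set X) (F : set (set X)) (c : \bar R) :
  open E -> lindelof_on mu E -> F `<=` open -> E `<=` \bigcup_(V in F) V ->
  F set0 -> (forall V W, F V -> F W -> F (V `|` W)) ->
  (forall V, F V -> mu V <= c)%E -> (mu E <= c)%E.
Proof.
move=> oE lE Fo EF F0 FU Fc; rewrite leNgt; apply/negP => cE.
have c0 : (0 <= c)%E by apply: le_trans (Fc _ F0); exact: measure_ge0.
have cfin : c \is a fin_num.
  by rewrite ge0_fin_numE//; apply: lt_le_trans cE _; rewrite leey.
have cE' : ((fine c)%:E < mu (\bigcup_(V in F) V `&` E))%E.
  by rewrite fineK// (_ : _ `&` E = E)//; exact: setIidr.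
have [D [/finite_fsetP[A ->] DF Dc]] :=
  lindelof_finite oE lE (fun V FV => Fo V FV) cE'.
have FD : F (\bigcup_(V in [set` A]) V).
  rewrite bigcup_fset big_seq; by elim/big_ind : _.
move: Dc; apply/negP; rewrite -leNgt fineK//.
apply: le_trans (Fc _ FD); apply: le_measure; rewrite ?inE.
- apply: borel_open; apply: openI => //; exact: Fo.
- by apply: borel_open; exact: Fo.
- by move=> x [].
Qed.

Section semidirect_integral.
Local Open Scope ereal_scope.
Variables (R : realType) (H K : topGroupType) (tau : cont_hom_Aut H K).
Hypotheses (lcH : lc_group H) (lcK : lc_group K).
Variable muH : {measure set (borel H) -> \bar R}.
Variable muK : {measure set (borel K) -> \bar R}.
Hypotheses (haarH : left_haar muH) (haarK : left_haar muK).
Variable delta : H -> R.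
Hypothesis delta_gt0 : forall h, (0 < delta h)%R.
Hypothesis delta_continuous : continuous delta.
Variable m : {measure set (borel (semidirect tau)) -> \bar R}.
Hypotheses (haarm : left_haar m) (mE : weighted_product muH muK delta m).

Lemma measurable_delta : measurable_fun setT (delta : borel H -> R).
Proof.
apply: (measurability _ (RGenOpens.measurableE R)) => _ [_ [a [b ->]] <-].
rewrite setTI; apply: borel_open.
by move/continuousP : delta_continuous; apply; exact: interval_open.
Qed.

(* [borel (semidirect tau)] and [borel (H * K)] have the same measurable sets but
   different base points, so measures have to be transported along the identity. *)
Let m' : {measure set (borel (H * K)%type) -> \bar R} :=
  measure_function_pushforward__canonical__measure_function_Measure m
    (f := (fun x => x) : borel (semidirect tau) -> borel (H * K)%type)
    (fun (_ : measurable setT) E mE => eq_ind_r (fun A => measurable A) mE (setTI _)).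

Variables (A : set H) (B : set K).
Hypotheses (eA : exhausted_subgroup A) (eB : exhausted_subgroup B).

Let tA : tame muH A := haar_tame lcH haarH eA.
Let tB : tame muK B := haar_tame lcK haarK eB.
Let oA : open A := tame_open tA.
Let oB : open B := tame_open tB.
Let mA : measurable (A : set (borel H)) := borel_open oA.
Let mB : measurable (B : set (borel K)) := borel_open oB.

Let dn h : {nonneg R} := NngNum (ltW (delta_gt0 h)).
(** The kernel of delta(h) dh dk on the product of A and B: the weight delta(h) is put on the slice
    over h. *)
Let kap (h : borel H) : {measure set (borel (H * K)%type) -> \bar R} :=
  mscale (dn h) (section_measure muK mB h).

Let measurable_k E : measurable E -> measurable_fun setT (fun h => kap h E).
Proof.
move=> mE'; rewrite (_ : (fun h => _) =
  fun h => (delta h)%:E * section_measure muK mB h E)//.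
apply: emeasurable_funM; first by apply/measurable_EFinP; exact: measurable_delta.
exact: measurable_section_measure tB mB E mE'.
Qed.

Let M := mixture_measure measurable_k (mrestr muH mA).

Let integral_M (F : H * K -> \bar R) :
  measurable_fun setT (F : borel (H * K)%type -> \bar R) ->
  (forall z, 0 <= F z) ->
  (forall h k, ~ A h -> F (h, k) = 0) -> (forall h k, ~ B k -> F (h, k) = 0) ->
  \int[M]_z F z = \int[muH]_h ((\int[muK]_k F (h, k)) * (delta h)%:E).
Proof.
move=> mF F0 FA FB.
have [m1 ->] := @mixture_integral _ _ _ _ _ _ measurable_k (mrestr muH mA) M
  (fun _ _ => erefl) F mF F0.
have E h : \int[kap h]_z F z = (\int[muK]_k F (h, k)) * (delta h)%:E.
  rewrite ge0_integral_mscale// integral_section_measure//.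
  rewrite ge0_integral_mrestr_support//; [|exact: borel_section mF|exact: FB].
  by rewrite muleC.
rewrite ge0_integral_mrestr_support//.
- by apply: eq_integral => h _; exact: E.
- by move=> h; exact: integral_ge0.
- by move=> h nAh; rewrite E integral0_eq ?mul0e// => y _; exact: FA.
Qed.

Let lindelof_m (E : set (H * K)) : open E -> E `<=` A `*` B -> lindelof_on m' E.
Proof.
move=> oE EAB; have [_ _ _ [U [UP ndU UA]]] := eA.
have [_ _ _ [V [VP ndV VB]]] := eB.
pose W n : set (semidirect tau) := U n `*` V n.
have oW n : open (W n).
  by have [oU _] := UP n; have [oV _] := VP n; exact: open_setX.
suff lW : lindelof_on m (\bigcup_n W n).
  apply: (@lindelof_onS R (semidirect tau) m E (\bigcup_n W n)) => //.
    by apply: bigcup_open => n _; exact: oW.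
  move=> [h k] /EAB[/= Ah Bk]; move: Ah Bk; rewrite -UA -VB => -[n _ Un] [p _ Vp].
  exists (maxn n p) => //; split => /=.
    by have /subsetPset UU := ndU _ _ (leq_maxl n p); exact: UU.
  by have /subsetPset VV := ndV _ _ (leq_maxr n p); exact: VV.
apply: lindelof_bigcup => // n; apply: haar_lindelof => //.
  exact: lc_semidirect.
apply: haar_bounded => //; first exact: lc_semidirect.
  by apply: borel_open; exact: oW.
have [_ [C cC UC]] := UP n; have [_ [D cD VD]] := VP n.
exists (C `*` D); first exact: (@compact_setX H K).
by move=> z [/= /UC ? /VD ?].
Qed.

(** Inner regularity of [M] is not at hand, so the property is inherited from the two factors; the
    weight preserves null slices. *)
Let lindelof_M (E : set (H * K)) : open E -> lindelof_on M E.
Proof.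
move=> oE F Fo; have [G [cG GF G0]] := lindelof_product tA tB Fo.
exists G; split => //.
have mD : measurable (\bigcup_(V in F) V `\` \bigcup_(V in G) V : set (borel (H * K)%type)).
  by apply: measurableD; apply: borel_bigcup_open => // V /GF/Fo.
apply: (@subset_measure0 _ (borel (H * K)%type) _ M _
  (\bigcup_(V in F) V `\` \bigcup_(V in G) V)) => //.
  by apply: measurableI => //; exact: borel_open.
change (\int[mrestr muH mA]_h kap h (\bigcup_(V in F) V `\` \bigcup_(V in G) V) = 0).
rewrite ge0_integral_mrestr//; last exact: measurable_k.
rewrite -(integral0 muH A); apply: ge0_ae_eq_integral => //.
- exact: measurable_funTS (measurable_k mD).
- move: G0; apply: negligibleS => h /= /not_implyP[Ah kh]; split => //.
  apply/eqP => h0; apply: kh; rewrite /kap /mscale /= section_measureE h0 mule0//.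
Qed.

Let agree_bump (E : set (H * K)) (phi : H * K -> R) : open E -> E `<=` A `*` B ->
  bump E phi -> \int[m']_z (phi z)%:E = \int[M]_z (phi z)%:E.
Proof.
move=> oE EAB [cphi kphi phi01 phiE].
have mphi : measurable_fun setT ((EFin \o phi) : borel (H * K)%type -> \bar R).
  apply/measurable_EFinP.
  apply: (measurability _ (RGenOpens.measurableE R)) => _ [_ [a [b ->]] <-].
  rewrite setTI; apply: borel_open.
  by move/continuousP : cphi; apply; exact: interval_open.
have phi0 z : 0 <= (phi z)%:E by rewrite lee_fin; have /andP[] := phi01 z.
rewrite integral_M//.
- rewrite -(mE cphi kphi).
  have := @ge0_integral_pushforward _ _ (borel (semidirect tau)) (borel (H * K)%type)
    R _ _ m setT _ measurableT mphi (fun y _ => phi0 y).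
  by move=> ->.
- by move=> h z nAh /=; rewrite phiE// => /EAB[].
- by move=> h z nBz /=; rewrite phiE// => /EAB[].
Qed.

(** E is covered by open sets V on each of which some bump function phi of E equals 1, and P V <=
    int phi dP = int phi dQ <= Q E. The maximum of two bump functions keeps the family of such V
    closed under unions. Stated for P and Q, the bound is used in both directions. *)
Let bump_le (P : {measure set (borel (H * K)%type) -> \bar R})
    (Q : {measure set (borel (H * K)%type) -> \bar R}) (E : set (H * K)) :
  open E -> lindelof_on P E ->
  (forall phi : H * K -> R, bump E phi ->
    \int[P]_z (phi z)%:E = \int[Q]_z (phi z)%:E) ->
  P E <= Q E.
Proof.
move=> oE lE PQ.
pose F := [set V : set (H * K) | open V /\
  exists2 phi : H * K -> R, bump E phi & forall z, V z -> phi z = 1%R].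
have hHK := hausdorff_prod lcH.1 lcK.1.
have cHK := locally_compact_prod lcH.2 lcK.2.
apply: (@lindelof_le R (H * K)%type P E F) => //.
- by move=> V [].
- move=> z Ez; have [phi [V [bphi oV Vz phi1]]] := bump_exists R cHK hHK oE Ez.
  by exists V => //; split => //; exists phi.
- split; first exact: open0.
  exists (fun=> 0%R) => //; split => //.
  + by move=> z; exact: cvg_cst.
  + rewrite (_ : [set _ | _] = set0) ?closure0; first exact: compact0.
    by rewrite -subset0 => z /=; rewrite eqxx.
  + by move=> z; rewrite lexx ler01.
- move=> V W [oV [phi bphi phi1]] [oW [psi bpsi psi1]]; split; first exact: openU.
  exists (phi \max psi)%R; first exact: bump_max.
  have [_ _ p01 _] := bphi; have [_ _ q01 _] := bpsi.
  move=> z [/phi1 phiz|/psi1 psiz] /=.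
    by rewrite phiz; apply/max_idPl; have /andP[] := q01 z.
  by rewrite psiz; apply/max_idPr; have /andP[] := p01 z.
- move=> V [oV [phi bphi phi1]].
  have [cphi _ phi01 phiE] := bphi.
  have mphi : measurable_fun setT ((EFin \o phi) : borel (H * K)%type -> \bar R).
    apply/measurable_EFinP.
    apply: (measurability _ (RGenOpens.measurableE R)) => _ [_ [a [b ->]] <-].
    rewrite setTI; apply: borel_open.
    by move/continuousP : cphi; apply; exact: interval_open.
  have mV : measurable (V : set (borel (H * K)%type)) by exact: borel_open.
  have mE' : measurable (E : set (borel (H * K)%type)) by exact: borel_open.
  have phi0 z : 0 <= (phi z)%:E by rewrite lee_fin; have /andP[] := phi01 z.
  apply: (@le_trans _ _ (\int[P]_z (phi z)%:E)).
    have -> : P V = \int[P]_z (\1_V z)%:E by rewrite integral_indic// setIT.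
    apply: ge0_le_integral => //; first exact/measurable_EFinP.
    move=> z _; rewrite indicE; have [|] := boolP (z \in V); last by [].
    by rewrite inE => /phi1 ->.
  have -> : Q E = \int[Q]_z (\1_E z)%:E by rewrite integral_indic// setIT.
  rewrite PQ//.
  apply: ge0_le_integral => //; first exact/measurable_EFinP.
  move=> z _; rewrite indicE; have [_|] := boolP (z \in E).
    by rewrite lee_fin; have /andP[] := phi01 z.
  by rewrite notin_setE => nEz; rewrite phiE.
Qed.

Let agree_open (E : set (H * K)) : open E -> E `<=` A `*` B -> m' E = M E.
Proof.
move=> oE EAB; apply/eqP; rewrite eq_le; apply/andP; split.
  by apply: bump_le => //; [exact: lindelof_m|move=> phi; exact: agree_bump].
apply: bump_le => //; first exact: lindelof_M.
by move=> phi bphi; rewrite (agree_bump oE EAB bphi).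
Qed.

(** The boxes [W n] are relatively compact, hence of finite measure for m; on each of them the open
    sets determine the measure. *)
Let agree (E : set (borel (H * K)%type)) : measurable E ->
  E `<=` A `*` B -> m' E = M E.
Proof.
move=> mE' EAB; have [_ _ _ [U [UP ndU UA]]] := eA.
have [_ _ _ [V [VP ndV VB]]] := eB.
pose W n : set (borel (H * K)%type) := U n `*` V n.
have oW n : open (U n `*` V n).
  by have [oU _] := UP n; have [oV _] := VP n; exact: open_setX.
have mW n : measurable (W n) by apply: borel_open; exact: oW.
have WAB n : W n `<=` A `*` B.
  by move=> [h k'] [/= Un Vn]; rewrite -UA -VB; split; exists n.
have EW : E = \bigcup_n (E `&` W n).
  rewrite -setI_bigcupr; apply/esym/setIidl.
  move=> [h k'] /EAB[/= Ah Bk]; move: Ah Bk; rewrite -UA -VB => -[n _ Un] [p _ Vp].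
  exists (maxn n p) => //; split => /=.
    by have /subsetPset UU := ndU _ _ (leq_maxl n p); exact: UU.
  by have /subsetPset VV := ndV _ _ (leq_maxr n p); exact: VV.
have ndW : nondecreasing_seq (fun n => E `&` W n).
  move=> n p np; apply/subsetPset; apply: setIS => -[x y] [/= Ux Vy]; split => /=.
    by have /subsetPset UU := ndU _ _ np; exact: UU.
  by have /subsetPset VV := ndV _ _ np; exact: VV.
have mfin n : m' (W n) < +oo.
  apply: (haar_bounded (lc_semidirect tau lcH lcK) haarm (A := W n)).
    exact: mW.
  have [_ [C cC UC]] := UP n; have [_ [D cD VD]] := VP n.
  exists (C `*` D); first exact: (@compact_setX H K).
  by move=> z [/= /UC ? /VD ?].
have agree_W n : m' (E `&` W n) = M (E `&` W n).
  pose m1 := mrestr m' (mW n); pose m2 := mrestr M (mW n).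
  have : m1 E = m2 E; last by [].
  apply: (@measure_unique _ R (borel (H * K)%type) (@open (H * K)%type)
    (fun=> setT)) => //.
  - by move=> P Q; exact: openI.
  - by move=> _; exact: openT.
  - by rewrite bigcup_const//; exists 0%N.
  - move=> P oP; apply: agree_open; first by apply: openI => //; exact: oW.
    by move=> z [_ /WAB].
  - by move=> _; rewrite -[X in X < _]/(m' (setT `&` W n)) setTI.
have mEW n : measurable (E `&` W n) by exact: measurableI.
have mEAB : measurable (\bigcup_n (E `&` W n)) by exact: bigcupT_measurable.
rewrite EW.
have c1 := nondecreasing_cvg_mu (mu := m') mEW mEAB ndW.
have c2 := nondecreasing_cvg_mu (mu := M) mEW mEAB ndW.
rewrite -(cvg_lim _ c1)// -(cvg_lim _ c2)//; congr (limn _).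
by apply/funext => n /=; exact: agree_W.
Qed.

Lemma ge0_integral_semidirect (F : H * K -> \bar R) :
  measurable_fun setT (F : borel (H * K)%type -> \bar R) ->
  (forall z, 0 <= F z) ->
  (forall h k, ~ A h -> F (h, k) = 0) -> (forall h k, ~ B k -> F (h, k) = 0) ->
  \int[m]_z F z = \int[muH]_h ((\int[muK]_k F (h, k)) * (delta h)%:E).
Proof.
move=> mF F0 FA FB; rewrite -integral_M//.
have mAB : measurable (A `*` B : set (borel (H * K)%type)).
  by apply: borel_open; exact: open_setX.
have FAB z : ~ (A `*` B) z -> F z = 0.
  case: z => h k nAB; have [Ah|] := pselect (A h); last exact: FA.
  by apply: FB => Bk; apply: nAB.
transitivity (\int[m']_z F z).
  have := @ge0_integral_pushforward _ _ (borel (semidirect tau)) (borel (H * K)%type)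
    R _ _ m setT _ measurableT mF (fun y _ => F0 y).
  by move=> ->.
rewrite -(ge0_integral_mrestr_support m' mAB mF F0 FAB).
rewrite -(ge0_integral_mrestr_support M mAB mF F0 FAB).
apply: eq_measure_integral => E mE' _; apply: agree; first exact: measurableI.
by move=> z [].
Qed.

End semidirect_integral.

(** * Supports of integrable functions *)

Section supports.
Local Open Scope ereal_scope.
Variables (R : realType) (H K : topGroupType) (tau : cont_hom_Aut H K).
Hypotheses (lcH : lc_group H) (lcK : lc_group K).
Variable m : {measure set (borel (semidirect tau)) -> \bar R}.
Hypothesis haarm : left_haar m.

Definition carried (E : set (H * K)) := exists S T,
  [/\ sigma_bounded S, sigma_bounded T & E `<=` S `*` T].

Lemma carriedS (E E' : set (H * K)) : E `<=` E' -> carried E' -> carried E.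
Proof. by move=> EE' [S [T [sS sT EST]]]; exists S, T; split => // z /EE'/EST. Qed.

Lemma carried_bigcup (E : nat -> set (H * K)) : (forall n, carried (E n)) ->
  carried (\bigcup_n E n).
Proof.
move=> cE; pose S n := sval (cid (cE n)).
have SP n : exists T, [/\ sigma_bounded (S n), sigma_bounded T & E n `<=` S n `*` T].
  exact: svalP (cid (cE n)).
pose T n := sval (cid (SP n)).
have TP n : [/\ sigma_bounded (S n), sigma_bounded (T n) & E n `<=` S n `*` T n].
  exact: svalP (cid (SP n)).
exists (\bigcup_n S n), (\bigcup_n T n); split.
- by apply: sigma_bounded_bigcup => n; have [] := TP n.
- by apply: sigma_bounded_bigcup => n; have [] := TP n.
- by move=> z [n _ Ez]; have [_ _ /(_ _ Ez)[Sz Tz]] := TP n; split; exists n.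
Qed.

(* An open set of finite measure meets each coset of an open subgroup in a set of
   positive measure, unless it misses it; so it meets countably many of them. *)
Lemma carried_finite (E : set (borel (semidirect tau))) : measurable E ->
  m E < +oo -> carried E.
Proof.
move=> mE; rewrite (haar_outer haarm mE) => /ereal_inf_lt[_ [U [oU EU] <-] Ufin].
apply: (@carriedS _ (U : set (H * K))) => //.
have lcG := lc_semidirect tau lcH lcK.
have [S eS] := exhausted_subgroup_exists lcH.
have [T eT] := exhausted_subgroup_exists lcK.
have [S1 SM SV _] := eS; have [T1 TM TV _] := eT.
have oS : open S.
  by have [_ _ _ [W [WP _ <-]]] := eS; apply: bigcup_open => n _; have [] := WP n.
have oT : open T.
  by have [_ _ _ [W [WP _ <-]]] := eT; apply: bigcup_open => n _; have [] := WP n.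
(* Left cosets for the direct product of groups, whose topology is the one of [semidirect tau]; all
   that matters is that they partition the space into open boxes. *)
pose box (z : H * K) : set (semidirect tau) :=
  [set y | S (z.1 * y)%g] `*` [set y | T (z.2 * y)%g].
have obox z : open (box z).
  by apply: (@open_setX H K); exact: open_translate.
have box_sub z z' y : box z y -> box z' y -> box z `<=` box z'.
  move=> [/= Sy Ty] [/= Sy' Ty'] x [/= Sx Tx]; split => /=.
    rewrite (_ : (z'.1 * x.1)%g = ((z'.1 * y.1) * ((z.1 * y.1)^-1 * (z.1 * x.1)))%g).
      by apply: (SM) => //; apply: (SM) => //; exact: SV.
    by rewrite invgM !mulgA mulgK mulgVK.
  rewrite (_ : (z'.2 * x.2)%g = ((z'.2 * y.2) * ((z.2 * y.2)^-1 * (z.2 * x.2)))%g).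
    by apply: (TM) => //; apply: (TM) => //; exact: TV.
  by rewrite invgM !mulgA mulgK mulgVK.
have box_eq z z' y : box z y -> box z' y -> box z = box z'.
  move=> zy z'y; apply/seteqP; split; first exact: (box_sub _ _ _ zy z'y).
  exact: (box_sub _ _ _ z'y zy).
have box_self (y : H * K) : box ((y.1)^-1, (y.2)^-1)%g y.
  by split; rewrite /= mulVg.
pose F := range box.
have Fo : F `<=` open by move=> _ [z _ <-]; exact: obox.
have [G [cG GF G0]] := haar_lindelof lcG haarm oU Ufin Fo.
have UG : U `<=` \bigcup_(V in G) V.
  move=> y Uy; apply: contrapT => nGy.
  have : 0 < m ((\bigcup_(V in F) V `\` \bigcup_(V in G) V) `&` U).
    apply: haar_open_gt0 => //; last first.
      exists y; split => //; split => //.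
      by exists (box ((y.1)^-1, (y.2)^-1)%g) => //; exists ((y.1)^-1, (y.2)^-1)%g.
    apply: openI => //.
    (* Cosets are equal or disjoint, so removing those in G leaves the union of the others, which is
       open. *)
    rewrite (_ : _ `\` _ = \bigcup_(V in F `\` G) V).
      by apply: bigcup_open => V [/Fo].
    apply/seteqP; split => [x [[V FV Vx] nGx]|x [V [FV nGV] Vx]].
      by exists V => //; split => // GV; apply: nGx; exists V.
    split; first by exists V.
    move=> [V' GV' V'x]; apply: nGV.
    have [z' _ zV'] := GF _ GV'; have [z _ zV] := FV.
    rewrite -zV (box_eq z z' x) ?zV' ?zV//.
  by rewrite G0 ltxx.
apply: (carriedS UG); have [u [uG ->]] := countable_seq cG.
apply: carried_bigcup => n; have [/GF[z _ <-]|->] := uG n.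
  exists [set y | S (z.1 * y)%g], [set y | T (z.2 * y)%g]; split => //.
  - by apply: sigma_bounded_translate; exact: exhausted_sigma_bounded.
  - by apply: sigma_bounded_translate; exact: exhausted_sigma_bounded.
exists S, T; split => //; exact: exhausted_sigma_bounded.
Qed.

(** The support is the union over n of the sets where the modulus is at least 1/(n+1), and these
    have finite measure by Markov's inequality. *)
Lemma carried_integrable (f : semidirect tau -> R[i]) : integrableC m f ->
  carried [set z | f z != 0%R].
Proof.
move=> /integrableCP[mf fi].
pose E n : set (borel (semidirect tau)) := [set z | n.+1%:R^-1 <= nrm (f z)]%R.
have mE n : measurable (E n).
  have := measurable_nrm mf measurableT (measurable_itv `[n.+1%:R^-1, +oo[%R).
  rewrite setTI; congr measurable.
  by apply/seteqP; split => z /=; rewrite in_itv/= andbT.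
have Efin n : m (E n) < +oo.
  have n0 : (0 < n.+1%:R^-1 :> R)%R by rewrite invr_gt0.
  have : (n.+1%:R^-1)%:E * m (E n) < +oo.
    apply: le_lt_trans fi; rewrite -[E n]setIT -(integral_indic m)//.
    rewrite -ge0_integralZl_EFin//; last first.
      exact/measurable_EFinP.
    apply: ge0_le_integral => //.
    - apply: emeasurable_funM; first exact: measurable_cst.
      exact/measurable_EFinP.
    - exact: measurable_Enrm.
    - move=> z _; rewrite -EFinM lee_fin indicE.
      have [zE|_] := boolP (z \in E n); last by rewrite mulr0 nrm_ge0.
      by rewrite mulr1; move: zE; rewrite inE.
  have [->|] := eqVneq (m (E n)) +oo; last by move=> h _; rewrite ltey.
  by rewrite gt0_muley ?lte_fin.
apply: (@carriedS _ (\bigcup_n E n)); last first.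
  by apply: carried_bigcup => n; exact: carried_finite.
move=> z /= fz.
have : (0 < nrm (f z))%R.
  rewrite lt_neqAle nrm_ge0 andbT eq_sym; apply: contra fz => /eqP/nrm_eq0 ->.
  by [].
move=> /ltr_add_invr[n]; rewrite add0r => /ltW nz.
by exists n.
Qed.

Lemma carried_exhausted (E : set (H * K)) : carried E -> exists S T,
  [/\ exhausted_subgroup S, exhausted_subgroup T & E `<=` S `*` T].
Proof.
move=> [S [T [sS sT EST]]].
have [S' [eS' SS']] := sigma_bounded_subgroup lcH sS.
have [T' [eT' TT']] := sigma_bounded_subgroup lcK sT.
by exists S', T'; split => // z /EST[/SS' ? /TT' ?].
Qed.

End supports.

(** * Convolution on the semidirect product *)

Section swap_scale.
Variables (R : realType) (X Y : ptopologicalType).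
Variables (mu : {measure set (borel X) -> \bar R}) (A : set X).
Variables (nu : {measure set (borel Y) -> \bar R}) (B : set Y).
Hypotheses (tmu : tame mu A) (tnu : tame nu B).
Variables (p : X -> R[i]) (q : Y -> R[i]) (w : X * Y -> R[i]).
Hypothesis mp : measurableC (p : borel X -> R[i]).
Hypothesis mq : measurableC (q : borel Y -> R[i]).
Hypothesis mw : measurableC (w : borel (X * Y)%type -> R[i]).
Hypothesis wqB : forall x y, ~ B y -> w (x, y) * q y = 0.
Hypothesis pwA : forall x y, ~ A x -> p x * w (x, y) = 0.

Lemma measurableC_comp_continuous (Z W : ptopologicalType) (f : W -> R[i])
    (h : Z -> W) : measurableC (f : borel W -> R[i]) -> continuous h ->
  measurableC ((fun x => f (h x)) : borel Z -> R[i]).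
Proof.
move=> [f1 f2] ch; split; [exact: measurable_comp_continuous f1 ch|
  exact: measurable_comp_continuous f2 ch].
Qed.

Let fst_continuous : continuous (fun z : X * Y => z.1).
Proof. by move=> z; exact: cvg_fst. Qed.
Let snd_continuous : continuous (fun z : X * Y => z.2).
Proof. by move=> z; exact: cvg_snd. Qed.

Let mwq : measurableC ((fun z => w z * q z.2) : borel (X * Y)%type -> R[i]).
Proof.
apply: measurableC_mul mw _; exact: measurableC_comp_continuous mq snd_continuous.
Qed.

Let mpw : measurableC ((fun z => p z.1 * w z) : borel (X * Y)%type -> R[i]).
Proof.
apply: measurableC_mul mw; exact: measurableC_comp_continuous mp fst_continuous.
Qed.

Let F (z : X * Y) := p z.1 * (w z * q z.2).

Let mF : measurableC (F : borel (X * Y)%type -> R[i]).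
Proof.
apply: measurableC_mul mwq; exact: measurableC_comp_continuous mp fst_continuous.
Qed.

Let FB x y : ~ B y -> F (x, y) = 0.
Proof. by move=> By; rewrite /F /= wqB// mulr0. Qed.
Let FA x y : ~ A x -> F (x, y) = 0.
Proof. by move=> Ax; rewrite /F /= mulrA pwA// mul0r. Qed.

Let flip_continuous : continuous (fun z : Y * X => (z.2, z.1)).
Proof. by move=> z; apply: cvg_pair; [exact: cvg_snd|exact: cvg_fst]. Qed.

Lemma swap_scale_measurablel :
  measurableC ((fun x => p x * integralC nu (fun y => w (x, y) * q y)) : borel X -> R[i]).
Proof.
apply: measurableC_mul mp _.
exact: (measurableC_integralC_section tnu mwq wqB).
Qed.

Lemma swap_scale_measurabler :
  measurableC ((fun y => integralC mu (fun x => p x * w (x, y)) * q y) : borel Y -> R[i]).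
Proof.
apply: measurableC_mul _ mq.
have mpw' := measurableC_comp_continuous mpw flip_continuous.
exact: (measurableC_integralC_section tmu mpw' (fun y x => @pwA x y)).
Qed.

Hypothesis Fint :
  (\int[mu]_x \int[nu]_y (nrm (p x * (w (x, y) * q y)))%:E < +oo)%E.

Let Fint' : (\int[nu]_y \int[mu]_x (nrm (F (x, y)))%:E < +oo)%E.
Proof.
have F0 z : (0 <= (nrm (F z))%:E)%E by rewrite lee_fin nrm_ge0.
have FB' x y : ~ B y -> (nrm (F (x, y)))%:E = 0%E by move=> By; rewrite FB// nrm0.
have FA' x y : ~ A x -> (nrm (F (x, y)))%:E = 0%E by move=> Ax; rewrite FA// nrm0.
by rewrite -(tonelli tmu tnu (measurable_Enrm mF) F0 FA' FB').
Qed.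

Lemma swap_scale_ae_section :
  {ae mu, forall x, integrableC nu (fun y => p x * (w (x, y) * q y))}.
Proof. exact: (ae_integrableC_section tnu mF FB Fint). Qed.

Let mF' : measurableC ((fun z => F (z.2, z.1)) : borel (Y * X)%type -> R[i]).
Proof. exact: measurableC_comp_continuous mF flip_continuous. Qed.

Let ae_section' :
  {ae nu, forall y, integrableC mu (fun x => p x * (w (x, y) * q y))}.
Proof.
exact: (ae_integrableC_section tmu mF' (fun y x => @FA x y) Fint').
Qed.

Let ae_l : {ae mu, forall x, p x * integralC nu (fun y => w (x, y) * q y) =
  integralC nu (fun y => F (x, y))}.
Proof.
by apply: (ae_imply swap_scale_ae_section) => x ix; rewrite -integralC_scale.
Qed.

Let ae_r : {ae nu, forall y, integralC mu (fun x => p x * w (x, y)) * q y =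
  integralC mu (fun x => F (x, y))}.
Proof.
apply: (ae_imply ae_section') => y iy.
have E : (fun x => F (x, y)) = (fun x => q y * (p x * w (x, y))).
  by apply/funext => x; rewrite /F /= mulrA mulrC.
rewrite mulrC -integralC_scale; first by congr integralC.
by rewrite -E.
Qed.

Lemma swap_scale_integrable :
  integrableC mu (fun x => p x * integralC nu (fun y => w (x, y) * q y)).
Proof.
apply: (ae_eq_integrableC swap_scale_measurablel ae_l).
exact: (integrableC_integralC_section tnu mF FB Fint).
Qed.

(** Fubini in the shape that convolutions take, with one factor free of each inner variable. Pulling
    these factors out of the inner integrals is legitimate only where the sections of [F] are
    integrable, hence the almost everywhere statements [ae_l] and [ae_r]. *)
Lemma swap_scale :
  integralC mu (fun x => p x * integralC nu (fun y => w (x, y) * q y)) =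
  integralC nu (fun y => integralC mu (fun x => p x * w (x, y)) * q y).
Proof.
rewrite (ae_eq_integralC swap_scale_measurablel
  (measurableC_integralC_section tnu mF FB) ae_l).
rewrite (ae_eq_integralC swap_scale_measurabler
  (measurableC_integralC_section tmu mF' (fun y x => @FA x y)) ae_r).
exact: (integralC_swap tmu tnu mF FA FB Fint).
Qed.

End swap_scale.

Section reflect.
Local Open Scope ereal_scope.
Variables (R : realType) (K : topGroupType).
Hypothesis lcK : lc_group K.
Hypothesis abK : forall x y : K, (x * y)%g = (y * x)%g.
Variable mu : {measure set (borel K) -> \bar R}.
Hypothesis haar : left_haar mu.
Variable T : set K.
Hypothesis eT : exhausted_subgroup T.

Lemma ge0_integral_reflect (k : K) (f : K -> \bar R) :
  measurable_fun setT (f : borel K -> \bar R) -> (forall y, 0 <= f y) ->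
  (forall y, ~ T y -> f y = 0) ->
  \int[mu]_y f (y^-1 * k)%g = \int[mu]_y f y.
Proof.
move=> mf f0 fT.
(* The function y |-> f (k y) lives on a translate of T, which in general is not a subgroup; S is an
   exhausted subgroup that contains it. *)
have [S [eS TS]] := sigma_bounded_subgroup lcK
  (sigma_bounded_translate k (exhausted_sigma_bounded eT)).
have mfk : measurable_fun setT ((fun y => f (k * y)%g) : borel K -> \bar R).
  exact: measurable_comp_continuous mf (@mulg_continuousl K k).
rewrite -(ge0_integral_translate haar k mf f0).
rewrite -(ge0_integral_inv lcK abK haar eS mfk (fun y => f0 _)).
  by apply: eq_integral => y _; rewrite abK.
by move=> y nSy; apply: fT => Ty; apply: nSy; exact: TS.
Qed.

Lemma continuous_reflect (k : K) : continuous (fun y : K => (y^-1 * k)%g).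
Proof.
apply: continuous_mulg2; first exact: invg_continuous.
by move=> y; exact: cvg_cst.
Qed.

Lemma integral_reflect (k : K) (f : K -> R) :
  measurable_fun setT (f : borel K -> R) -> (forall y, ~ T y -> f y = 0%R) ->
  \int[mu]_y (f (y^-1 * k)%g)%:E = \int[mu]_y (f y)%:E.
Proof.
move=> mf fT.
have mEf : measurable_fun setT ((EFin \o f) : borel K -> \bar R) by exact/measurable_EFinP.
rewrite [LHS]integralE [RHS]integralE; congr (_ - _).
- rewrite -(@ge0_integral_reflect k (EFin \o f)^\+).
  + by apply: eq_integral => y _; rewrite !funeposE.
  + exact: measurable_funepos.
  + by [].
  + by move=> y Ty; rewrite funeposE /= fT// maxxx.
- rewrite -(@ge0_integral_reflect k (EFin \o f)^\-).
  + by apply: eq_integral => y _; rewrite !funenegE.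
  + exact: measurable_funeneg.
  + by [].
  + by move=> y Ty; rewrite funenegE /= fT// oppr0 maxxx.
Qed.

Lemma integralC_reflect (k : K) (f : K -> R[i]) :
  measurableC (f : borel K -> R[i]) -> (forall y, ~ T y -> f y = 0%R) ->
  integralC mu (fun y => f (y^-1 * k)%g) = integralC mu f.
Proof.
move=> [f1 f2] fT; apply: complex_eq; rewrite /= /Rintegral; congr fine.
  by apply: (integral_reflect k f1) => y /fT ->.
by apply: (integral_reflect k f2) => y /fT ->.
Qed.

Lemma integrableC_reflect (k : K) (f : K -> R[i]) :
  measurableC (f : borel K -> R[i]) -> (forall y, ~ T y -> f y = 0%R) ->
  integrableC mu f -> integrableC mu (fun y => f (y^-1 * k)%g).
Proof.
move=> mf fT /integrableCP[_ fi]; apply/integrableCP; split.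
  exact: (@measurableC_comp_continuous R K K f _ mf (@continuous_reflect k)).
rewrite (@ge0_integral_reflect k (fun y => (nrm (f y))%:E))//.
- exact: measurable_Enrm.
- by move=> y; rewrite lee_fin nrm_ge0.
- by move=> y /fT ->; rewrite nrm0.
Qed.

Lemma integralC_translate (x : K) (f : K -> R[i]) :
  measurableC (f : borel K -> R[i]) ->
  integralC mu (fun y => f (x * y)%g) = integralC mu f.
Proof.
move=> [f1 f2].
have E (g : K -> R) : measurable_fun setT (g : borel K -> R) ->
    \int[mu]_y (g (x * y)%g)%:E = \int[mu]_y (g y)%:E.
  move=> mg.
  have mEg : measurable_fun setT ((EFin \o g) : borel K -> \bar R) by exact/measurable_EFinP.
  rewrite [LHS]integralE [RHS]integralE; congr (_ - _).
  - rewrite -(ge0_integral_translate haar x (measurable_funepos mEg) (funepos_ge0 _)).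
    by apply: eq_integral => y _; rewrite !funeposE.
  - rewrite -(ge0_integral_translate haar x (measurable_funeneg mEg) (funeneg_ge0 _)).
    by apply: eq_integral => y _; rewrite !funenegE.
by apply: complex_eq; rewrite /= /Rintegral; congr fine; [exact: E f1|exact: E f2].
Qed.

End reflect.

(** * The associative product underlying the tau-convolution *)

Section operations.
Local Open Scope ereal_scope.
Variables (R : realType) (H K : topGroupType) (tau : cont_hom_Aut H K).
Hypotheses (lcH : lc_group H) (lcK : lc_group K).
Hypothesis abK : forall x y : K, (x * y)%g = (y * x)%g.
Variable muH : {measure set (borel H) -> \bar R}.
Variable muK : {measure set (borel K) -> \bar R}.
Hypotheses (haarH : left_haar muH) (haarK : left_haar muK).
Variable delta : H -> R.
Hypothesis delta_gt0 : forall h, (0 < delta h)%R.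
Hypothesis delta_continuous : continuous delta.
Variable m : {measure set (borel (semidirect tau)) -> \bar R}.
Hypotheses (haarm : left_haar m) (mE : weighted_product muH muK delta m).

(* [fconv f g] is the tau-convolution [tau_convl] with the integral over H taken
   first, which makes it visibly associative. *)
Definition tint (f : H * K -> R[i]) (s : K) : R[i] :=
  integralC muH (fun t => f (t, s) * (delta t)%:C%C)%R.

Definition fconv (f g : H * K -> R[i]) (z : H * K) : R[i] :=
  integralC muK (fun s => tint f s * g (z.1, (s^-1 * z.2)%g))%R.

Variables (S : set H) (T : set K).
Hypotheses (eS : exhausted_subgroup S) (eT : exhausted_subgroup T).

Let tS : tame muH S := haar_tame lcH haarH eS.
Let tT : tame muK T := haar_tame lcK haarK eT.

(** Functions and not classes: exact vanishing off the product of S and T is what gives access to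
    Tonelli. *)
Definition admissible (f : H * K -> R[i]) :=
  [/\ measurableC (f : borel (H * K)%type -> R[i]),
      forall h k, ~ S h -> f (h, k) = 0%R,
      forall h k, ~ T k -> f (h, k) = 0%R &
      \int[m]_z (nrm (f z))%:E < +oo].

Let measurable_deltaC : measurableC ((fun t => (delta t)%:C%C) : borel H -> R[i]).
Proof. by apply: measurableC_real; exact: measurable_delta. Qed.

Let fst_continuous (X Y : topologicalType) : continuous (fun z : X * Y => z.1).
Proof. by move=> z; exact: cvg_fst. Qed.
Let snd_continuous (X Y : topologicalType) : continuous (fun z : X * Y => z.2).
Proof. by move=> z; exact: cvg_snd. Qed.
Let flip_continuous (X Y : topologicalType) : continuous (fun z : X * Y => (z.2, z.1)).
Proof. by move=> z; apply: cvg_pair; [exact: cvg_snd|exact: cvg_fst]. Qed.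

Let T_mul s k : T s -> T (s^-1 * k)%g -> T k.
Proof. by have [_ TM _ _] := eT; move=> Ts Tsk; rewrite -(mulVKg s k); exact: TM. Qed.

Section young.
Variable a : K -> \bar R.
Hypotheses (ma : measurable_fun setT (a : borel K -> \bar R)).
Hypotheses (a0 : forall s, 0 <= a s) (aT : forall s, ~ T s -> a s = 0).

(** Young's inequality, with equality for nonnegative functions: after Tonelli, translation
    invariance frees the inner integral from s. *)
Lemma youngK (b : K -> \bar R) : measurable_fun setT (b : borel K -> \bar R) ->
  (forall s, 0 <= b s) -> (forall s, ~ T s -> b s = 0) ->
  \int[muK]_k \int[muK]_s (a s * b (s^-1 * k)%g) =
  (\int[muK]_s a s) * (\int[muK]_s b s).
Proof.
move=> mb b0 bT.
pose F (z : K * K) := a z.2 * b (z.2^-1 * z.1)%g.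
have mF : measurable_fun setT (F : borel (K * K)%type -> \bar R).
  apply: emeasurable_funM; first exact: measurable_comp_continuous ma (@snd_continuous K K).
  apply: measurable_comp_continuous mb _; apply: continuous_mulg2.
    by apply: continuous_invg1; exact: snd_continuous.
  exact: fst_continuous.
have F0 z : 0 <= F z by rewrite mule_ge0.
have FT2 k s : ~ T s -> F (k, s) = 0 by move=> nT; rewrite /F aT// mul0e.
have FT1 k s : ~ T k -> F (k, s) = 0.
  move=> nTk; have [Ts|nTs] := pselect (T s); last exact: FT2.
  by rewrite /F bT ?mule0//= => /(T_mul Ts).
rewrite (tonelli tT tT mF F0 FT1 FT2).
rewrite -(ge0_integralZr muK measurableT ma (fun s _ => a0 s)); last first.
  by apply: integral_ge0 => s _; exact: b0.
apply: eq_integral => s _; rewrite /F /=.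
have mbt : measurable_fun setT ((fun k => b (s^-1 * k)%g) : borel K -> \bar R).
  exact: measurable_comp_continuous mb (@mulg_continuousl K s^-1%g).
rewrite (ge0_integralZl muK measurableT mbt (fun k _ => b0 _) (a0 s)).
by rewrite (ge0_integral_translate haarK s^-1%g mb b0).
Qed.

Let reflect_continuous :
  continuous (fun z : H * K * K => (z.1.1, (z.2^-1 * z.1.2)%g) : H * K).
Proof.
have c11 : continuous (fun z : H * K * K => z.1.1).
  by move=> z; apply: (@continuous_comp _ _ _ fst fst); exact: fst_continuous.
have c12 : continuous (fun z : H * K * K => z.1.2).
  move=> z; apply: (@continuous_comp _ _ _ fst snd); first exact: fst_continuous.
  exact: snd_continuous.
have cr : continuous (fun z : H * K * K => (z.2^-1 * z.1.2)%g).
  by apply: continuous_mulg2 c12; apply: continuous_invg1; exact: snd_continuous.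
by move=> z; apply: cvg_pair; [exact: c11|exact: cr].
Qed.

Variable u : H * K -> \bar R.
Hypotheses (mu : measurable_fun setT (u : borel (H * K)%type -> \bar R)).
Hypotheses (u0 : forall z, 0 <= u z) (uS : forall h k, ~ S h -> u (h, k) = 0).
Hypotheses (uT : forall h k, ~ T k -> u (h, k) = 0).

(** The nonnegative model of [fconv], with [a] in the place of [tint f]; it supplies the
    majorants. *)
Definition young (z : H * K) := \int[muK]_s (a s * u (z.1, (s^-1 * z.2)%g)).

Lemma young_ge0 z : 0 <= young z.
Proof. by apply: integral_ge0 => s _; rewrite mule_ge0. Qed.

Lemma measurable_young : measurable_fun setT (young : borel (H * K)%type -> \bar R).
Proof.
apply: (measurable_integral_section (B := T)
  (F := fun z : H * K * K => a z.2 * u (z.1.1, (z.2^-1 * z.1.2)%g)) tT).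
- apply: emeasurable_funM.
    exact: measurable_comp_continuous ma (@snd_continuous (H * K)%type K).
  exact: measurable_comp_continuous mu reflect_continuous.
- by move=> z; rewrite mule_ge0.
- by move=> z s nTs /=; rewrite aT// mul0e.
Qed.

Lemma young_offl h k : ~ S h -> young (h, k) = 0.
Proof. by move=> nS; rewrite /young integral0_eq// => s _; rewrite uS// mule0. Qed.

Lemma young_offr h k : ~ T k -> young (h, k) = 0.
Proof.
move=> nT; rewrite /young integral0_eq// => s _.
have [Ts|nTs] := pselect (T s); last by rewrite aT// mul0e.
by rewrite uT ?mule0//= => /(T_mul Ts).
Qed.

Lemma integral_young :
  \int[m]_z young z = (\int[muK]_s a s) * \int[m]_z u z.
Proof.
have I := ge0_integral_semidirect lcH lcK haarH haarK delta_gt0 delta_continuous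
  haarm mE eS eT.
rewrite (I _ measurable_young young_ge0 young_offl young_offr) (I _ mu u0 uS uT).
have mku : measurable_fun setT ((fun h => (\int[muK]_k u (h, k)) * (delta h)%:E)
    : borel H -> \bar R).
  apply: emeasurable_funM.
    exact: (measurable_integral_section tT mu u0 uT).
  by apply/measurable_EFinP; exact: measurable_delta.
have ku0 h : setT h -> 0 <= (\int[muK]_k u (h, k)) * (delta h)%:E.
  move=> _; apply: mule_ge0; first by apply: integral_ge0 => k _; exact: u0.
  by rewrite lee_fin ltW.
have ia0 : 0 <= \int[muK]_s a s by apply: integral_ge0 => s _; exact: a0.
rewrite -(ge0_integralZl muH measurableT mku ku0 ia0).
apply: eq_integral => h _; rewrite muleA; congr (_ * _).
rewrite -(youngK (b := fun k => u (h, k)))//.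
- exact: (borel_section h mu).
- exact: uT.
Qed.

End young.

(** A form of [ae_fin_integral] across the two Borel structures: measurability refers to [H * K],
    the measure to [semidirect tau]. *)
Lemma ae_lty (G : H * K -> \bar R) :
  measurable_fun setT (G : borel (H * K)%type -> \bar R) ->
  (forall z, 0 <= G z) -> \int[m]_z G z < +oo -> {ae m, forall z, G z < +oo}.
Proof.
exact: (@ae_fin_integral _ (borel (semidirect tau)) R m G).
Qed.

(** [tint] of the modulus of f: it bounds the modulus of [tint f], and its integral over K is the
    norm of f. *)
Definition fnorm (f : H * K -> R[i]) (s : K) : \bar R :=
  \int[muH]_t (nrm (f (t, s) * (delta t)%:C%C)%R)%:E.

Section one.
Variable f : H * K -> R[i].
Hypothesis af : admissible f.

Let mf : measurableC (f : borel (H * K)%type -> R[i]). Proof. by case: af. Qed.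
Let fS h k : ~ S h -> f (h, k) = 0%R. Proof. by case: af => _ + _ _; exact. Qed.
Let fT h k : ~ T k -> f (h, k) = 0%R. Proof. by case: af => _ _ + _; exact. Qed.
Let fin : \int[m]_z (nrm (f z))%:E < +oo. Proof. by case: af. Qed.

Let fd (z : K * H) := (f (z.2, z.1) * (delta z.2)%:C%C)%R.

Let mfd : measurableC (fd : borel (K * H)%type -> R[i]).
Proof.
apply: measurableC_mul.
  exact: measurableC_comp_continuous mf (@flip_continuous K H).
exact: measurableC_comp_continuous measurable_deltaC (@snd_continuous K H).
Qed.

Let fdS s t : ~ S t -> fd (s, t) = 0%R.
Proof. by move=> nS; rewrite /fd /= fS// mul0r. Qed.
Let fdT s t : ~ T s -> fd (s, t) = 0%R.
Proof. by move=> nT; rewrite /fd /= fT// mul0r. Qed.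

Lemma fnorm_ge0 s : 0 <= fnorm f s.
Proof. exact: integral_nrm_ge0. Qed.

Lemma measurable_fnorm : measurable_fun setT (fnorm f : borel K -> \bar R).
Proof.
apply: (measurable_integral_section (B := S) (F := fun z => (nrm (fd z))%:E) tS).
- exact: measurable_Enrm.
- by move=> z; rewrite lee_fin nrm_ge0.
- by move=> s t nS; rewrite fdS// nrm0.
Qed.

Lemma fnorm_off s : ~ T s -> fnorm f s = 0.
Proof.
by move=> nT; rewrite /fnorm integral0_eq// => t _; rewrite fT// mul0r nrm0.
Qed.

Lemma integral_fnorm : \int[muK]_s fnorm f s = \int[m]_z (nrm (f z))%:E.
Proof.
rewrite (tonelli tT tS (F := fun z => (nrm (fd z))%:E)); last first.
- by move=> s t nS; rewrite fdS// nrm0.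
- by move=> s t nT; rewrite fdT// nrm0.
- by move=> z; rewrite lee_fin nrm_ge0.
- exact: measurable_Enrm.
rewrite (ge0_integral_semidirect lcH lcK haarH haarK delta_gt0 delta_continuous
  haarm mE eS eT (F := fun z => (nrm (f z))%:E)); last first.
- by move=> h k nT; rewrite fT// nrm0.
- by move=> h k nS; rewrite fS// nrm0.
- by move=> z; rewrite lee_fin nrm_ge0.
- exact: measurable_Enrm.
apply: eq_integral => t _.
have mft := measurableC_section mf t.
rewrite -(ge0_integralZr muK measurableT (measurable_Enrm mft)); last 2 first.
- by move=> s _; rewrite lee_fin nrm_ge0.
- by rewrite lee_fin ltW.
apply: eq_integral => s _; rewrite /fd /= nrmM EFinM nrm_real ger0_norm//.
exact: ltW.
Qed.

Lemma measurable_tint : measurableC (tint f : borel K -> R[i]).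
Proof. exact: (measurableC_integralC_section tS mfd fdS). Qed.

Lemma tint_off s : ~ T s -> tint f s = 0%R.
Proof.
move=> nT; rewrite /tint -[RHS](integralC0 muH); congr integralC.
by apply/funext => t; rewrite fT// mul0r.
Qed.

Lemma nrm_tint_le s : (nrm (tint f s))%:E <= fnorm f s.
Proof. exact: (nrm_integralC_le muH (measurableC_section mfd s)). Qed.

Lemma tint_ae : {ae muK, forall s,
  integrableC muH (fun t => f (t, s) * (delta t)%:C%C)%R}.
Proof.
apply: (ae_integrableC_section tS mfd fdS).
by rewrite -/(fnorm f _); move: fin; rewrite -integral_fnorm.
Qed.

End one.

Lemma admissible_measurable f : admissible f -> measurableC (f : borel (H * K)%type -> R[i]).
Proof. by case. Qed.
Lemma admissible_offl f h k : admissible f -> ~ S h -> f (h, k) = 0%R.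
Proof. by case=> _ + _ _; exact. Qed.
Lemma admissible_offr f h k : admissible f -> ~ T k -> f (h, k) = 0%R.
Proof. by case=> _ _ + _; exact. Qed.
Lemma admissible_fin f : admissible f -> \int[m]_z (nrm (f z))%:E < +oo.
Proof. by case. Qed.

Lemma admissible_lin (c : R[i]) f g : admissible f -> admissible g ->
  admissible (fun z => c * f z + g z)%R.
Proof.
move=> [mf fS fT ff] [mg gS gT gf].
have mfg : measurableC ((fun z => c * f z + g z)%R : borel (H * K)%type -> R[i]).
  by apply: measurableC_add mg; apply: measurableC_mul mf; exact: measurableC_cst.
split => //.
- by move=> h k nS; rewrite fS// gS// mulr0 addr0.
- by move=> h k nT; rewrite fT// gT// mulr0 addr0.
- have fI : integrableC m f by apply/integrableCP; split => //; exact: mf.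
  have gI : integrableC m g by apply/integrableCP; split => //; exact: mg.
  by have /integrableCP[] := integrableC_lin c fI gI.
Qed.

Section two.
Variables f g : H * K -> R[i].
Hypotheses (af : admissible f) (ag : admissible g).

Let mf := admissible_measurable af.
Let mg := admissible_measurable ag.
Let ng (z : H * K) := (nrm (g z))%:E.
Let mng : measurable_fun setT (ng : borel (H * K)%type -> \bar R).
Proof. exact: measurable_Enrm mg. Qed.
Let ng0 z : 0 <= ng z. Proof. by rewrite lee_fin nrm_ge0. Qed.
Let ngS h k : ~ S h -> ng (h, k) = 0.
Proof. by move=> nS; rewrite /ng (admissible_offl k ag)// nrm0. Qed.
Let ngT h k : ~ T k -> ng (h, k) = 0.
Proof. by move=> nT; rewrite /ng (admissible_offr h ag)// nrm0. Qed.

(** The majorant of [fconv f g]; at the points where it is finite, the integrals of [fconv] and of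
    [tau_convl] converge. *)
Definition fbound (z : H * K) := young (fnorm f) (fun z => (nrm (g z))%:E) z.

Lemma fbound_ae : {ae m, forall z, fbound z < +oo}.
Proof.
have If := integral_young (measurable_fnorm af) (fnorm_ge0 f) (fnorm_off af)
  mng ng0 ngS ngT.
apply: ae_lty.
- exact: (measurable_young (measurable_fnorm af) (fnorm_ge0 f) (fnorm_off af) mng ng0).
- by move=> z; apply: young_ge0 => //; exact: fnorm_ge0.
- rewrite If (integral_fnorm af) lte_mul_pinfty//.
  + exact: integral_nrm_ge0.
  + rewrite ge0_fin_numE; first exact: admissible_fin af.
    exact: integral_nrm_ge0.
  + exact: admissible_fin ag.
Qed.

Let reflect_continuous (z : H * K) : continuous (fun s : K => (z.1, (s^-1 * z.2)%g) : H * K).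
Proof.
have cr := @continuous_reflect K z.2.
by move=> s; apply: cvg_pair; [exact: cvg_cst|exact: cr].
Qed.

Let mgz z : measurableC ((fun s => g (z.1, (s^-1 * z.2)%g)) : borel K -> R[i]).
Proof. exact: measurableC_comp_continuous mg (@reflect_continuous z). Qed.

Let mphi z : measurableC ((fun s => tint f s * g (z.1, (s^-1 * z.2)%g))%R : borel K -> R[i]).
Proof. apply: measurableC_mul (measurable_tint af) _; exact: mgz. Qed.

Let phi_bound z :
  \int[muK]_s (nrm (tint f s * g (z.1, (s^-1 * z.2)%g))%R)%:E <= fbound z.
Proof.
have mfn := measurable_fnorm af.
apply: ge0_le_integral => //.
- by move=> s _; rewrite lee_fin nrm_ge0.
- exact: measurable_Enrm (mphi z).
- by apply: emeasurable_funM mfn _; exact: measurable_Enrm (mgz z).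
- move=> s _; rewrite nrmM EFinM; apply: lee_wpmul2r.
    by rewrite lee_fin nrm_ge0.
  exact: nrm_tint_le.
Qed.

Lemma fconv_integrable z : fbound z < +oo ->
  integrableC muK (fun s => tint f s * g (z.1, (s^-1 * z.2)%g))%R.
Proof.
move=> zfin; apply/integrableCP; split; first exact: mphi.
exact: le_lt_trans (phi_bound z) zfin.
Qed.

Lemma nrm_fconv_le z : (nrm (fconv f g z))%:E <= fbound z.
Proof. exact: le_trans (nrm_integralC_le muK (mphi z)) (phi_bound z). Qed.

Let reflect_continuous2 :
  continuous (fun z : H * K * K => (z.1.1, (z.2^-1 * z.1.2)%g) : H * K).
Proof.
have c11 : continuous (fun z : H * K * K => z.1.1).
  by move=> z; apply: (@continuous_comp _ _ _ fst fst); exact: fst_continuous.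
have c12 : continuous (fun z : H * K * K => z.1.2).
  move=> z; apply: (@continuous_comp _ _ _ fst snd); first exact: fst_continuous.
  exact: snd_continuous.
have cr : continuous (fun z : H * K * K => (z.2^-1 * z.1.2)%g).
  by apply: continuous_mulg2 c12; apply: continuous_invg1; exact: snd_continuous.
by move=> z; apply: cvg_pair; [exact: c11|exact: cr].
Qed.

Lemma measurable_fconv : measurableC (fconv f g : borel (H * K)%type -> R[i]).
Proof.
pose F (z : H * K * K) := (tint f z.2 * g (z.1.1, (z.2^-1 * z.1.2)%g))%R.
have mF : measurableC (F : borel (H * K * K)%type -> R[i]).
  apply: measurableC_mul.
    exact: measurableC_comp_continuous (measurable_tint af) (@snd_continuous (H * K)%type K).
  exact: measurableC_comp_continuous mg reflect_continuous2.
apply: (measurableC_integralC_section tT mF) => z s nT.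
by rewrite /F tint_off// mul0r.
Qed.

Lemma fconv_offl h k : ~ S h -> fconv f g (h, k) = 0%R.
Proof.
move=> nS; rewrite /fconv -[RHS](integralC0 muK); congr integralC.
by apply/funext => s; rewrite (admissible_offl _ ag)// mulr0.
Qed.

Lemma fconv_offr h k : ~ T k -> fconv f g (h, k) = 0%R.
Proof.
move=> nT; rewrite /fconv -[RHS](integralC0 muK); congr integralC.
apply/funext => s; have [Ts|nTs] := pselect (T s); last by rewrite tint_off// mul0r.
by rewrite (admissible_offr _ ag) ?mulr0//= => /(T_mul Ts).
Qed.

Lemma fconv_norm : \int[m]_z (nrm (fconv f g z))%:E <=
  \int[m]_z (nrm (f z))%:E * \int[m]_z (nrm (g z))%:E.
Proof.
rewrite -(integral_fnorm af).
rewrite -(integral_young (measurable_fnorm af) (fnorm_ge0 f) (fnorm_off af)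
  mng ng0 ngS ngT).
apply: ge0_le_integral => //.
- by move=> z _; rewrite lee_fin nrm_ge0.
- exact: measurable_Enrm measurable_fconv.
- exact: (measurable_young (measurable_fnorm af) (fnorm_ge0 f) (fnorm_off af) mng ng0).
- by move=> z _; exact: nrm_fconv_le.
Qed.

Lemma fconv_admissible : admissible (fconv f g).
Proof.
split; [exact: measurable_fconv|exact: fconv_offl|exact: fconv_offr|].
apply: le_lt_trans fconv_norm _; apply: lte_mul_pinfty.
- exact: integral_nrm_ge0.
- rewrite ge0_fin_numE; first exact: admissible_fin af.
  exact: integral_nrm_ge0.
- exact: admissible_fin ag.
Qed.

(** By Tonelli the double integral equals [fbound z]. *)
Let tau_int z : fbound z < +oo ->
  \int[muH]_t \int[muK]_s
   (nrm ((delta t)%:C%C * (f (t, s) * g (z.1, (s^-1 * z.2)%g)))%R)%:E < +oo.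
Proof.
move=> zfin.
pose F (x : H * K) := ((delta x.1)%:C%C * (f x * g (z.1, (x.2^-1 * z.2)%g)))%R.
have mF : measurableC (F : borel (H * K)%type -> R[i]).
  apply: measurableC_mul.
    exact: measurableC_comp_continuous measurable_deltaC (@fst_continuous H K).
  apply: measurableC_mul mf _.
  exact: measurableC_comp_continuous (mgz z) (@snd_continuous H K).
have F0 x : 0 <= (nrm (F x))%:E by rewrite lee_fin nrm_ge0.
have FS h k : ~ S h -> (nrm (F (h, k)))%:E = 0.
  by move=> nS; rewrite /F /= (admissible_offl k af)// mul0r mulr0 nrm0.
have FT h k : ~ T k -> (nrm (F (h, k)))%:E = 0.
  by move=> nT; rewrite /F /= (admissible_offr h af)// mul0r mulr0 nrm0.
rewrite (tonelli tS tT (measurable_Enrm mF) F0 FS FT).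
apply: le_lt_trans zfin; rewrite le_eqVlt; apply/orP; left; apply/eqP.
apply: eq_integral => s _; rewrite /fnorm.
have mfs : measurableC ((fun t => f (t, s) * (delta t)%:C%C)%R : borel H -> R[i]).
  by apply: measurableC_mul measurable_deltaC; exact: measurableC_sectionr mf s.
rewrite -(ge0_integralZr muH measurableT (measurable_Enrm mfs)); last 2 first.
- by move=> t _; rewrite lee_fin nrm_ge0.
- by rewrite lee_fin nrm_ge0.
apply: eq_integral => t _; rewrite -EFinM -nrmM /F /=; congr (nrm _)%:E.
by rewrite mulrA; congr (_ * _)%R; rewrite mulrC.
Qed.

(** This is [swap_scale] with [p = delta], [w = f] and q(s) = g(z.1, s^-1 z.2). *)
Lemma tau_convl_fconv z : fbound z < +oo ->
  [/\ \forall t \ae muH, conv_defined muK (slice f t) (slice g z.1) z.2,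
      integrableC muH (tau_convl_integrand muK delta f g z)
    & tau_convl muH muK delta f g z = fconv f g z].
Proof.
move=> zfin.
have wqT t s : ~ T s -> (f (t, s) * g (z.1, (s^-1 * z.2)%g) = 0)%R.
  by move=> nT; rewrite (admissible_offr _ af)// mul0r.
have pwS t s : ~ S t -> ((delta t)%:C%C * f (t, s) = 0)%R.
  by move=> nS; rewrite (admissible_offl _ af)// mulr0.
have Fin := tau_int zfin.
have mconv : measurableC ((fun t => (delta t)%:C%C *
    integralC muK (fun s => f (t, s) * g (z.1, (s^-1 * z.2)%g)))%R : borel H -> R[i]).
  exact: (swap_scale_measurablel tT measurable_deltaC (mgz z) mf wqT).
have E t : tau_convl_integrand muK delta f g z t = ((delta t)%:C%C *
    integralC muK (fun s => f (t, s) * g (z.1, (s^-1 * z.2)%g)))%R.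
  by rewrite /tau_convl_integrand mulrC.
split.
- have := swap_scale_ae_section tT measurable_deltaC (mgz z) mf wqT Fin.
  move=> ae; apply: (ae_imply ae) => t it.
  (* Fubini yields integrability of the section multiplied by delta(t), which is then divided
     out. *)
  have d0 : (delta t)%:C%C != 0%R :> R[i].
    by apply/eqP => /complexI/eqP; rewrite gt_eqF.
  have := integrableC_Zl ((delta t)%:C%C^-1)%R it.
  by congr (integrableC _ _); apply/funext => s; rewrite mulKf.
- rewrite (funext E).
  exact: (swap_scale_integrable tT measurable_deltaC (mgz z) mf wqT Fin).
- rewrite /tau_convl (funext E).
  rewrite (swap_scale tS tT measurable_deltaC (mgz z) mf wqT pwS Fin).
  congr integralC; apply/funext => s; congr (_ * _)%R; congr integralC.
  by apply/funext => t; rewrite mulrC.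
Qed.

End two.

Section reflect_conv.
Variables f g : H * K -> R[i].
Hypotheses (af : admissible f) (ag : admissible g).
Variables (h t : H) (k : K).

Let phi (s : K) := (g (t, s) * f (h, (s^-1 * k)%g))%R.

Let mphi : measurableC (phi : borel K -> R[i]).
Proof.
apply: measurableC_mul.
  exact: measurableC_section (admissible_measurable ag) t.
apply: measurableC_comp_continuous (admissible_measurable af) _.
have cr := @continuous_reflect K k.
by move=> s; apply: cvg_pair; [exact: cvg_cst|exact: cr].
Qed.

Let phiT s : ~ T s -> phi s = 0%R.
Proof. by move=> nT; rewrite /phi (admissible_offr _ ag)// mul0r. Qed.

Let phiE : (fun s => phi (s^-1 * k)%g) =
  (fun s => slice f h s * slice g t (s^-1 * k)%g)%R.
Proof.
apply/funext => s; rewrite /phi /slice mulrC; congr (f (h, _) * _)%R.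
by rewrite invgM invgK abK mulVKg.
Qed.

(** The substitution s |-> s^-1 k preserves the integral of every measurable function carried by T,
    convergent or not, so the equality holds at every point. *)
Lemma conv_commute : Defs.conv muK (slice f h) (slice g t) k =
  Defs.conv muK (slice g t) (slice f h) k.
Proof.
by rewrite /Defs.conv -phiE (integralC_reflect lcK abK haarK eT k mphi phiT).
Qed.

Lemma conv_defined_commute : conv_defined muK (slice g t) (slice f h) k ->
  conv_defined muK (slice f h) (slice g t) k.
Proof.
rewrite /conv_defined -phiE.
exact: (integrableC_reflect lcK abK haarK eT k mphi phiT).
Qed.

End reflect_conv.

Lemma tau_conv_fconv f g z : admissible f -> admissible g ->
  fbound f g z < +oo -> fbound g f z < +oo ->
  tau_conv_defined muH muK delta f g z /\
  tau_conv muH muK delta f g z = (2^-1 * (fconv f g z + fconv g f z))%R.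
Proof.
move=> af ag zf zg; have [d1 i1 e1] := tau_convl_fconv af ag zf.
have [d2 i2 e2] := tau_convl_fconv ag af zg.
have E : tau_convr_integrand muK delta f g z = tau_convl_integrand muK delta g f z.
  apply/funext => t; rewrite /tau_convr_integrand /tau_convl_integrand.
  by rewrite (conv_commute af ag).
split.
  split => //; last by rewrite E.
  by apply: (ae_imply d2) => t; exact: conv_defined_commute.
by rewrite /tau_conv /tau_convr E addrC -/(tau_convl _ _ _ _ _ _) e1 e2.
Qed.

(** Two exceptional sets occur: [tint] is linear at almost every s only, which the integral over K
    does not see, and that integral splits only at points z where both bounds are finite. *)
Lemma fconv_linl (c : R[i]) f f' g : admissible f -> admissible f' -> admissible g ->
  {ae m, forall z, fconv (fun z => c * f z + f' z)%R g z =
    (c * fconv f g z + fconv f' g z)%R}.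
Proof.
move=> af af' ag; have al := admissible_lin c af af'.
apply: (ae_imply2 (fbound_ae af ag) (fbound_ae af' ag)) => z zf zf'.
have i1 := fconv_integrable af ag zf; have i2 := fconv_integrable af' ag zf'.
rewrite /fconv -(integralC_Zl c i1) -(integralC_add (integrableC_Zl c i1) i2).
have := integrableC_add (integrableC_Zl c i1) i2.
move=> /integrableC_measurable mr.
apply: ae_eq_integralC mr _.
  apply: measurableC_mul (measurable_tint al) _.
  have cr := @continuous_reflect K z.2.
  apply: measurableC_comp_continuous (admissible_measurable ag) _.
  by move=> s; apply: cvg_pair; [exact: cvg_cst|exact: cr].
apply: (ae_imply2 (tint_ae af) (tint_ae af')) => s s1 s2.
rewrite mulrA -mulrDl; congr (_ * _)%R.
rewrite /tint -(integralC_Zl c s1) -(integralC_add (integrableC_Zl c s1) s2).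
by congr integralC; apply/funext => t; rewrite mulrDl mulrA.
Qed.

Lemma fconv_linr (c : R[i]) f g g' : admissible f -> admissible g -> admissible g' ->
  {ae m, forall z, fconv f (fun z => c * g z + g' z)%R z =
    (c * fconv f g z + fconv f g' z)%R}.
Proof.
move=> af ag ag'.
apply: (ae_imply2 (fbound_ae af ag) (fbound_ae af ag')) => z zf zf'.
have i1 := fconv_integrable af ag zf; have i2 := fconv_integrable af ag' zf'.
rewrite /fconv -(integralC_Zl c i1) -(integralC_add (integrableC_Zl c i1) i2).
by congr integralC; apply/funext => s; rewrite mulrDr mulrCA.
Qed.

Section assoc.
Variables f g c : H * K -> R[i].
Hypotheses (af : admissible f) (ag : admissible g) (ac : admissible c).

Let mtf := measurable_tint af.
Let mtg := measurable_tint ag.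
Let mnf := measurable_fnorm af.
Let mng := measurable_fnorm ag.

(** The convolution of [fnorm f] and [fnorm g] on K, integrable by [youngK]; it controls both
    exchanges of integrals behind associativity. *)
Definition tbound (s : K) := \int[muK]_r (fnorm f r * fnorm g (r^-1 * s)%g).

Let tbound_ge0 s : 0 <= tbound s.
Proof. by apply: integral_ge0 => r _; rewrite mule_ge0 ?fnorm_ge0. Qed.

Let measurable_tbound : measurable_fun setT (tbound : borel K -> \bar R).
Proof.
apply: (measurable_integral_section (B := T)
  (F := fun z : K * K => fnorm f z.2 * fnorm g (z.2^-1 * z.1)%g) tT).
- apply: emeasurable_funM; first exact: measurable_comp_continuous mnf (@snd_continuous K K).
  apply: measurable_comp_continuous mng _; apply: continuous_mulg2.
    by apply: continuous_invg1; exact: snd_continuous.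
  exact: fst_continuous.
- by move=> z; rewrite mule_ge0 ?fnorm_ge0.
- by move=> s r nT /=; rewrite fnorm_off// mul0e.
Qed.

Let tbound_off s : ~ T s -> tbound s = 0.
Proof.
move=> nT; rewrite /tbound integral0_eq// => r _.
have [Tr|nTr] := pselect (T r); last by rewrite fnorm_off// mul0e.
by rewrite [fnorm g _]fnorm_off ?mule0// => /(T_mul Tr).
Qed.

Let norm_fin e : admissible e -> \int[m]_z (nrm (e z))%:E \is a fin_num.
Proof.
move=> ae; rewrite ge0_fin_numE; first exact: admissible_fin ae.
exact: integral_nrm_ge0.
Qed.

Let norm_ge0 e : 0 <= \int[m]_z (nrm (e z))%:E.
Proof. exact: integral_nrm_ge0. Qed.

Let integral_tbound : \int[muK]_s tbound s =
  \int[m]_z (nrm (f z))%:E * \int[m]_z (nrm (g z))%:E.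
Proof.
rewrite /tbound (youngK mnf (fnorm_ge0 f) (fnorm_off af) mng (fnorm_ge0 g) (fnorm_off ag)).
by rewrite (integral_fnorm af) (integral_fnorm ag).
Qed.

Let tbound_fin : \int[muK]_s tbound s < +oo.
Proof.
rewrite integral_tbound; apply: lte_mul_pinfty; [exact: norm_ge0|exact: norm_fin af|].
exact: admissible_fin ag.
Qed.

Let nc (z : H * K) := (nrm (c z))%:E.
Let mnc : measurable_fun setT (nc : borel (H * K)%type -> \bar R).
Proof. exact: measurable_Enrm (admissible_measurable ac). Qed.
Let nc0 z : 0 <= nc z. Proof. by rewrite lee_fin nrm_ge0. Qed.
Let ncS h k : ~ S h -> nc (h, k) = 0.
Proof. by move=> nS; rewrite /nc (admissible_offl k ac)// nrm0. Qed.
Let ncT h k : ~ T k -> nc (h, k) = 0.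
Proof. by move=> nT; rewrite /nc (admissible_offr h ac)// nrm0. Qed.

Let bound3 z := young tbound nc z.

Let bound3_ae : {ae m, forall z, bound3 z < +oo}.
Proof.
have I3 := integral_young measurable_tbound tbound_ge0 tbound_off mnc nc0 ncS ncT.
apply: ae_lty.
- exact: (measurable_young measurable_tbound tbound_ge0 tbound_off mnc nc0).
- by move=> z; exact: young_ge0.
- rewrite I3; apply: lte_mul_pinfty.
  + by apply: integral_ge0 => s _.
  + by rewrite ge0_fin_numE//; apply: integral_ge0 => s _.
  + exact: admissible_fin ac.
Qed.

Let reflectK_continuous (s : K) : continuous (fun r : K => (r^-1 * s)%g) :=
  @continuous_reflect K s.

Let pair_reflect_continuous (h : H) (s : K) :
  continuous (fun r : K => (h, (r^-1 * s)%g) : H * K).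
Proof.
have cr := @continuous_reflect K s.
by move=> r; apply: cvg_pair; [exact: cvg_cst|exact: cr].
Qed.

(** This multiplicativity is the source of associativity, because [fconv f] depends on f through
    [tint f] only. It is [swap_scale] over H and K with [p = delta], w(t, r) = g(t, r^-1 s) and
    [q = tint f]. *)
Lemma tint_fconv : {ae muK, forall s, tint (fconv f g) s =
  integralC muK (fun r => tint f r * tint g (r^-1 * s)%g)%R}.
Proof.
have ae := ae_fin_integral measurable_tbound tbound_ge0 tbound_fin.
apply: (ae_imply ae) => s sfin.
pose w (z : H * K) := g (z.1, (z.2^-1 * s)%g).
have mw : measurableC (w : borel (H * K)%type -> R[i]).
  apply: measurableC_comp_continuous (admissible_measurable ag) _.
  have cr : continuous (fun z : H * K => (z.2^-1 * s)%g).
    apply: continuous_mulg2; last by move=> y; exact: cvg_cst.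
    by apply: continuous_invg1; exact: snd_continuous.
  by move=> z; apply: cvg_pair; [exact: cvg_fst|exact: cr].
have wqT t r : ~ T r -> (w (t, r) * tint f r = 0)%R.
  by move=> nT; rewrite tint_off// mulr0.
have pwS t r : ~ S t -> ((delta t)%:C%C * w (t, r) = 0)%R.
  by move=> nS; rewrite /w (admissible_offl _ ag)// mulr0.
pose F (z : H * K) := ((delta z.1)%:C%C * (w z * tint f z.2))%R.
have mF : measurableC (F : borel (H * K)%type -> R[i]).
  apply: measurableC_mul.
    exact: measurableC_comp_continuous measurable_deltaC (@fst_continuous H K).
  apply: measurableC_mul mw _.
  exact: measurableC_comp_continuous mtf (@snd_continuous H K).
have F0 z : 0 <= (nrm (F z))%:E by rewrite lee_fin nrm_ge0.
have FS t r : ~ S t -> (nrm (F (t, r)))%:E = 0.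
  by move=> nS; rewrite /F /= mulrA pwS// mul0r nrm0.
have FT t r : ~ T r -> (nrm (F (t, r)))%:E = 0.
  by move=> nT; rewrite /F /= wqT// mulr0 nrm0.
have Fin : \int[muH]_t \int[muK]_r (nrm (F (t, r)))%:E < +oo.
  rewrite (tonelli tS tT (measurable_Enrm mF) F0 FS FT).
  apply: le_lt_trans sfin; apply: ge0_le_integral => //.
  - by move=> r _; exact: integral_ge0.
  - have mF' := measurableC_comp_continuous mF (@flip_continuous K H).
    apply: (measurable_integral_section (B := S)
      (F := fun z : K * H => (nrm (F (z.2, z.1)))%:E) tS).
    + exact: measurable_Enrm mF'.
    + by move=> z; exact: F0.
    + by move=> r t; exact: FS.
  - apply: emeasurable_funM mnf _.
    exact: measurable_comp_continuous mng (@reflectK_continuous s).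
  - move=> r _.
    have mgr : measurableC ((fun t => g (t, (r^-1 * s)%g) * (delta t)%:C%C)%R : borel H -> R[i]).
      apply: measurableC_mul measurable_deltaC.
      exact: measurableC_sectionr (admissible_measurable ag) _.
    apply: (@le_trans _ _ ((nrm (tint f r))%:E * fnorm g (r^-1 * s)%g)).
      rewrite /fnorm -(ge0_integralZl muH measurableT (measurable_Enrm mgr)); last 2 first.
      - by move=> t _; rewrite lee_fin nrm_ge0.
      - by rewrite lee_fin nrm_ge0.
      rewrite le_eqVlt; apply/orP; left; apply/eqP.
      apply: eq_integral => t _; rewrite -EFinM -nrmM /F /w /=; congr (nrm _)%:E.
      by rewrite mulrA mulrC; congr (_ * _)%R; rewrite mulrC.
    by apply: lee_wpmul2r; [exact: fnorm_ge0|exact: nrm_tint_le].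
transitivity (integralC muH (fun t => (delta t)%:C%C *
    integralC muK (fun r => w (t, r) * tint f r))%R).
  rewrite /tint; congr integralC; apply/funext => t; rewrite mulrC.
  by congr (_ * _)%R; rewrite /fconv; congr integralC; apply/funext => r; rewrite mulrC.
rewrite (swap_scale tS tT measurable_deltaC mtf mw wqT pwS Fin).
congr integralC; apply/funext => r; rewrite mulrC; congr (_ * _)%R.
by rewrite /tint; congr integralC; apply/funext => t; rewrite mulrC.
Qed.

(** By [tint_fconv] both sides become double integrals over K, exchanged by [swap_scale] with
    [p = tint f], w(r, s) the value of [tint g] at r^-1 s, and q(s) = c(h, s^-1 k). *)
Lemma fconvA : {ae m, forall z, fconv (fconv f g) c z = fconv f (fconv g c) z}.
Proof.
have afg := fconv_admissible af ag; have agc := fconv_admissible ag ac.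
apply: (ae_imply bound3_ae) => -[h k] zfin.
(* Off T both sides vanish; for k in T the function [q] is carried by T, as the exchange
   requires. *)
have [Tk|nTk] := pselect (T k); last first.
  by rewrite (fconv_offr afg ac)// (fconv_offr af agc).
pose q s := c (h, (s^-1 * k)%g).
have mq : measurableC (q : borel K -> R[i]).
  exact: measurableC_comp_continuous (admissible_measurable ac) (@pair_reflect_continuous h k).
have qT s : ~ T s -> q s = 0%R.
  have [_ TM TV _] := eT.
  move=> nTs; rewrite /q (admissible_offr _ ac)// => Tsk; apply: nTs.
  rewrite (_ : s = k * (s^-1 * k)^-1)%g; first exact: TM Tk (TV _ Tsk).
  by rewrite invgM invgK mulVKg.
pose w (z : K * K) := tint g (z.1^-1 * z.2)%g.
have mw : measurableC (w : borel (K * K)%type -> R[i]).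
  apply: measurableC_comp_continuous mtg _; apply: continuous_mulg2.
    by apply: continuous_invg1; exact: fst_continuous.
  exact: snd_continuous.
have wqT r s : ~ T s -> (w (r, s) * q s = 0)%R by move=> nT; rewrite qT// mulr0.
have pwT r s : ~ T r -> (tint f r * w (r, s) = 0)%R.
  by move=> nT; rewrite tint_off// mul0r.
pose F (z : K * K) := (tint f z.1 * (w z * q z.2))%R.
have mF : measurableC (F : borel (K * K)%type -> R[i]).
  apply: measurableC_mul.
    exact: measurableC_comp_continuous mtf (@fst_continuous K K).
  apply: measurableC_mul mw _.
  exact: measurableC_comp_continuous mq (@snd_continuous K K).
have F0 z : 0 <= (nrm (F z))%:E by rewrite lee_fin nrm_ge0.
have FT1 r s : ~ T r -> (nrm (F (r, s)))%:E = 0.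
  by move=> nT; rewrite /F /= mulrA pwT// mul0r nrm0.
have FT2 r s : ~ T s -> (nrm (F (r, s)))%:E = 0.
  by move=> nT; rewrite /F /= wqT// mulr0 nrm0.
have Fin : \int[muK]_r \int[muK]_s (nrm (F (r, s)))%:E < +oo.
  rewrite (tonelli tT tT (measurable_Enrm mF) F0 FT1 FT2).
  apply: le_lt_trans zfin; apply: ge0_le_integral => //.
  - by move=> s _; exact: integral_ge0.
  - have mF' := measurableC_comp_continuous mF (@flip_continuous K K).
    apply: (measurable_integral_section (B := T)
      (F := fun z : K * K => (nrm (F (z.2, z.1)))%:E) tT).
    + exact: measurable_Enrm mF'.
    + by move=> z; exact: F0.
    + by move=> s r; exact: FT1.
  - apply: emeasurable_funM measurable_tbound _.
    exact: measurable_Enrm mq.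
  - move=> s _.
    have mfg : measurable_fun setT ((fun r => fnorm f r * fnorm g (r^-1 * s)%g) : borel K -> \bar R).
      apply: emeasurable_funM mnf _.
      exact: measurable_comp_continuous mng (@reflectK_continuous s).
    rewrite /tbound -(ge0_integralZr muK measurableT mfg); last 2 first.
    + by move=> r _; rewrite mule_ge0 ?fnorm_ge0.
    + by rewrite lee_fin nrm_ge0.
    apply: ge0_le_integral => //.
    + exact: measurable_Enrm (measurableC_sectionr mF s).
    + apply: emeasurable_funM mfg _; exact: measurable_cst.
    + move=> r _; rewrite /F /= mulrA !nrmM !EFinM.
      apply: lee_wpmul2r; first by rewrite lee_fin nrm_ge0.
      apply: lee_pmul; rewrite ?lee_fin ?nrm_ge0//; exact: nrm_tint_le.
(* Translating the variable by r^-1 moves r out of the argument of c and into that of [tint g]. *)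
have inner r : fconv g c (h, (r^-1 * k)%g) =
    integralC muK (fun s => w (r, s) * q s)%R.
  pose e s := (tint g s * c (h, (s^-1 * (r^-1 * k))%g))%R.
  have me : measurableC (e : borel K -> R[i]).
    apply: measurableC_mul mtg _.
    exact: measurableC_comp_continuous (admissible_measurable ac) (@pair_reflect_continuous h _).
  transitivity (integralC muK e); first by [].
  rewrite -(integralC_translate haarK (r^-1)%g me).
  apply: eq_integralC => s; rewrite /e /w /q /=; congr (_ * c (h, _))%R.
  by rewrite invgM invgK -!mulgA mulVKg.
have -> : fconv f (fconv g c) (h, k) =
    integralC muK (fun r => tint f r * integralC muK (fun s => w (r, s) * q s))%R.
  by apply: eq_integralC => r; rewrite -inner.
rewrite (swap_scale tT tT mtf mq mw wqT pwT Fin) /fconv.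
apply: ae_eq_integralC.
- by apply: measurableC_mul mq; exact: measurable_tint afg.
- exact: (swap_scale_measurabler tT mtf mq mw pwT).
- by apply: (ae_imply tint_fconv) => s ->.
Qed.

End assoc.

(** The tau-involution with the modular function already replaced by its value 1. *)
Definition fstar (f : H * K -> R[i]) (z : H * K) : R[i] :=
  ((f (z.1, (z.2^-1)%g))^*)%C.

Lemma fstar_integral (f : H * K -> R[i]) : admissible f ->
  \int[m]_z (nrm (fstar f z))%:E = \int[m]_z (nrm (f z))%:E.
Proof.
move=> af; have I := ge0_integral_semidirect lcH lcK haarH haarK delta_gt0
  delta_continuous haarm mE eS eT.
have mf := admissible_measurable af.
have cinv : continuous (fun z : H * K => (z.1, (z.2^-1)%g)).
  have c2 : continuous (fun z : H * K => (z.2^-1)%g).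
    by apply: continuous_invg1; exact: snd_continuous.
  by move=> z; apply: cvg_pair; [exact: cvg_fst|exact: c2].
have E : (fun z => (nrm (fstar f z))%:E) = (fun z : H * K => (nrm (f (z.1, (z.2^-1)%g)))%:E).
  by apply/funext => z; rewrite /fstar nrm_conj.
rewrite E.
have [_ _ TV _] := eT.
rewrite (I (fun z => (nrm (f (z.1, (z.2^-1)%g)))%:E)); last first.
- move=> h k nT /=; rewrite (admissible_offr _ af) ?nrm0// => /TV.
  by rewrite invgK.
- by move=> h k nS /=; rewrite (admissible_offl _ af) ?nrm0.
- by move=> z; rewrite lee_fin nrm_ge0.
- by apply: measurable_Enrm; exact: measurableC_comp_continuous mf cinv.
rewrite (I (fun z => (nrm (f z))%:E)); last first.
- by move=> h k nT /=; rewrite (admissible_offr _ af) ?nrm0.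
- by move=> h k nS /=; rewrite (admissible_offl _ af) ?nrm0.
- by move=> z; rewrite lee_fin nrm_ge0.
- exact: measurable_Enrm.
apply: eq_integral => h _; congr (_ * _).
apply: (ge0_integral_inv lcK abK haarK (f := fun k => (nrm (f (h, k)))%:E) eT).
- exact: measurable_Enrm (measurableC_section mf h).
- by move=> k; rewrite lee_fin nrm_ge0.
- by move=> k nT; rewrite (admissible_offr _ af)// nrm0.
Qed.

Lemma fstar_admissible f : admissible f -> admissible (fstar f).
Proof.
move=> af; have [_ _ TV _] := eT; split.
- apply: measurableC_conj.
  apply: measurableC_comp_continuous (admissible_measurable af) _.
  have c2 : continuous (fun z : H * K => (z.2^-1)%g).
    by apply: continuous_invg1; exact: snd_continuous.
  by move=> z; apply: cvg_pair; [exact: cvg_fst|exact: c2].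
- by move=> h k nS; rewrite /fstar (admissible_offl _ af)// conjc0.
- move=> h k nT; rewrite /fstar (admissible_offr _ af) ?conjc0// => /TV.
  by rewrite invgK.
- by rewrite fstar_integral//; exact: admissible_fin af.
Qed.

Lemma tint_fstar f s : tint (fstar f) s = ((tint f s^-1%g)^*)%C.
Proof.
rewrite /tint -integralC_conj; congr integralC; apply/funext => t.
by rewrite /fstar rmorphM/=; congr (_ * _)%R; apply: complex_eq; rewrite /= ?oppr0.
Qed.

(** The equality holds at every point, since conjugation and reflection are compatible with
    [integralC] even at its default values. *)
Lemma fconv_fstar f g z : admissible f -> admissible g ->
  fconv (fstar f) (fstar g) z = fstar (fconv f g) z.
Proof.
move=> af ag; case: z => h k.
pose psi (s : K) := (tint f s * g (h, (s^-1 * k^-1)%g))%R.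
have mpsi : measurableC (psi : borel K -> R[i]).
  apply: measurableC_mul (measurable_tint af) _.
  apply: measurableC_comp_continuous (admissible_measurable ag) _.
  have cr := @continuous_reflect K (k^-1)%g.
  by move=> s; apply: cvg_pair; [exact: cvg_cst|exact: cr].
have psiT s : ~ T s -> psi s = 0%R.
  by move=> nT; rewrite /psi tint_off// mul0r.
transitivity ((integralC muK psi)^*)%C; last by [].
(* Reflection with k = 1 is the inversion of s. *)
rewrite -(integralC_reflect lcK abK haarK eT 1%g mpsi psiT) -integralC_conj.
rewrite /fconv; congr (integralC muK _); apply/funext => s.
rewrite tint_fstar /psi mulg1 rmorphM invgK; congr (_ * (g (h, _))^*%C)%R.
by rewrite invgM invgK abK.
Qed.

End operations.

(** * Completeness of L1 *)

Section L1_complete.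
Context d (T : measurableType d) (R : realType).
Variable mu : {measure set T -> \bar R}.

Section real_limit.
Local Open Scope ereal_scope.
Variable f : (T -> R)^nat.
Hypothesis fi : forall n, mu.-integrable setT (EFin \o f n).
Hypothesis f_sum : \sum_(n <oo) \int[mu]_x `|(f n.+1 x - f n x)%R|%:E < +oo.

Let D n x := `|(f n.+1 x - f n x)%R|%:E.
Let G x := \sum_(n <oo) D n x.

Let mf n : measurable_fun setT (f n).
Proof. by apply/measurable_EFinP; exact: measurable_int (fi n). Qed.

Let mD n : measurable_fun setT (D n).
Proof.
apply/measurable_EFinP; apply: measurableT_comp => //.
exact: measurable_funB.
Qed.

Let D0 n x : 0 <= D n x. Proof. by rewrite lee_fin. Qed.

Let mG : measurable_fun setT G.
Proof. by apply: (@ge0_emeasurable_sum _ _ _ setT D xpredT). Qed.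

Let G0 x : 0 <= G x. Proof. exact: nneseries_ge0. Qed.

Let G_int : \int[mu]_x G x < +oo.
Proof. by rewrite integral_nneseries. Qed.

Let f_bound x n : `|(f n x - f 0%N x)%R|%:E <= G x.
Proof.
have -> : (f n x - f 0%N x)%R = series (telescope (f ^~ x)) n.
  by rewrite telescopeK.
apply: le_trans (nneseries_lim_ge n (fun n _ _ => D0 n x)).
rewrite sumEFin lee_fin seriesEnat/=; exact: ler_norm_sum.
Qed.

Let f_cvg x : G x < +oo -> cvgn (f ^~ x).
Proof.
move=> Gx.
have : cvgn [normed series (telescope (f ^~ x))].
  apply: nondecreasing_is_cvgn.
    by apply: nondecreasing_series => i _ _; exact: normr_ge0.
  exists (fine (G x)) => _ [n _ <-].
  rewrite -lee_fin fineK ?ge0_fin_numE//.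
  apply: le_trans (nneseries_lim_ge n (fun n _ _ => D0 n x)).
  by rewrite sumEFin lee_fin.
move=> /normed_cvg; rewrite telescopeK => c.
rewrite (_ : f ^~ x = [sequence f n x - f 0%N x]_n \+ cst (f 0%N x))%R.
  by apply: is_cvgD => //; exact: is_cvg_cst.
by apply/funext => n /=; rewrite subrK.
Qed.

(** The upper limit is measurable everywhere and agrees with the limit wherever the sequence
    converges. *)
Let e x := limn_esup (fun n => (f n x)%:E).

(** The sum [G] of the absolute increments is integrable; the sequence converges where [G] is
    finite, and |f 0| + G dominates it. *)
Lemma L1_limit_real : exists2 l : T -> R, mu.-integrable setT (EFin \o l) &
  (fun n => \int[mu]_x `|(f n x - l x)%R|%:E) @ \oo --> 0.
Proof.
have me : measurable_fun setT e.
  by apply: measurable_fun_limn_esup => n; exact/measurable_EFinP.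
have aeG := ae_fin_integral mG G0 G_int.
have ec x : G x < +oo -> e x = (limn (f ^~ x))%:E /\ (f n x)%:E @[n --> \oo] --> e x.
  move=> /f_cvg c.
  have c' : (f n x)%:E @[n --> \oo] --> (limn (f ^~ x))%:E.
    by apply: cvg_EFin; [exact: nearW|exact: c].
  have E : e x = (limn (f ^~ x))%:E by rewrite /e (cvg_limn_einf_sup c').2.
  by rewrite E.
have Gi : mu.-integrable setT G.
  apply/integrableP; split => //; apply: le_lt_trans G_int.
  by under eq_integral do rewrite gee0_abs//.
have [] := @dominated_convergence _ _ _ mu setT measurableT
  (fun n x => (f n x)%:E) e (fun x => `|(f 0%N x)|%:E + G x) _ me.
- by move=> n; exact/measurable_EFinP.
- by apply: (ae_imply aeG) => x /ec[].
- by apply: integrableD => //; exact: (integrable_abse (fi 0%N)).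
- apply: nearW => x n _.
  have -> : (f n x)%:E = (f 0%N x)%:E + (f n x - f 0%N x)%R%:E by rewrite -EFinD addrC subrK.
  by rewrite (le_trans (lee_abs_add _ _))// leeD2l//; exact: f_bound.
move=> ei lim0 _.
have el : {ae mu, forall x, (fine (e x))%:E = e x}.
  by apply: (ae_imply aeG) => x /ec[-> _].
have mfe : measurable_fun setT (fun x => fine (e x)) by exact: measurableT_comp.
(* [fine] makes the limit real; almost everywhere it changes nothing, as [e] is finite where [G]
   is. *)
exists (fine \o e).
  apply/integrableP; split; first exact/measurable_EFinP.
  have /integrableP[_] := ei; apply: le_lt_trans; rewrite le_eqVlt; apply/orP; left.
  apply/eqP; apply: ae_eq_integral => //.
  - by apply: measurableT_comp => //; exact/measurable_EFinP.
  - exact: measurableT_comp.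
  - by apply: (ae_imply el) => x elx _; rewrite /= -[in RHS]elx.
apply: cvg_trans lim0; apply: near_eq_cvg; apply: nearW => n /=.
apply: ae_eq_integral => //.
- by apply: measurableT_comp => //; apply: emeasurable_funB => //; exact/measurable_EFinP.
- by apply/measurable_EFinP; apply: measurableT_comp => //; exact: measurable_funB.
- by apply: (ae_imply el) => x /= elx _; rewrite -{1}elx.
Qed.

End real_limit.

Section complex_limit.
Variable f : (T -> R[i])^nat.
Hypothesis fi : forall n, integrableC mu (f n).
Hypothesis f_sum :
  (\sum_(n <oo) \int[mu]_x (nrm (f n.+1 x - f n x))%:E < +oo)%E.

Let mdiff n : measurableC (fun x => f n.+1 x - f n x).
Proof.
have -> : (fun x => f n.+1 x - f n x) = (fun x => -1 * f n x + f n.+1 x).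
  by apply/funext => x; rewrite mulN1r addrC.
by apply: integrableC_measurable; exact: integrableC_lin.
Qed.

Lemma L1_limit : exists2 l : T -> R[i], integrableC mu l &
  ((fun n => \int[mu]_x (nrm (f n x - l x))%:E) @ \oo --> 0)%E.
Proof.
have sub_sum (g : (T -> R)^nat) :
    (forall n, mu.-integrable setT (EFin \o g n)) ->
    (forall n x, `|g n.+1 x - g n x| <= nrm (f n.+1 x - f n x)) ->
    (\sum_(n <oo) \int[mu]_x `|g n.+1 x - g n x|%:E < +oo)%E.
  move=> gi gf; apply: le_lt_trans f_sum; apply: lee_nneseries => n _.
    by move=> _; apply: integral_ge0 => x _; rewrite lee_fin.
  apply: ge0_le_integral => //.
  - apply/measurable_EFinP; apply: measurableT_comp => //.
    by apply: measurable_funB; apply/measurable_EFinP; exact: measurable_int (gi _).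
  - by apply: measurable_Enrm; exact: mdiff.
  - by move=> x _; rewrite lee_fin gf.
have ReB (z w : R[i]) : Re z - Re w = Re (z - w) by case: z; case: w.
have ImB (z w : R[i]) : Im z - Im w = Im (z - w) by case: z; case: w.
have dRe n x : `|Re (f n.+1 x) - Re (f n x)| <= nrm (f n.+1 x - f n x).
  by rewrite ReB normRe_le_nrm.
have dIm n x : `|Im (f n.+1 x) - Im (f n x)| <= nrm (f n.+1 x - f n x).
  by rewrite ImB normIm_le_nrm.
have [l1 l1i c1] := L1_limit_real (f := fun n x => Re (f n x)) (fun n => (fi n).1)
  (sub_sum (fun n x => Re (f n x)) (fun n => (fi n).1) dRe).
have [l2 l2i c2] := L1_limit_real (f := fun n x => Im (f n x)) (fun n => (fi n).2)
  (sub_sum (fun n x => Im (f n x)) (fun n => (fi n).2) dIm).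
have li : integrableC mu (fun x => (l1 x +i* l2 x)%C) by split.
exists (fun x => (l1 x +i* l2 x)%C) => //.
have mm1 n : measurable_fun setT (fun x => `|Re (f n x) - l1 x|).
  apply: measurableT_comp => //; apply: measurable_funB; apply/measurable_EFinP.
    exact: measurable_int (fi n).1.
  exact: measurable_int l1i.
have mm2 n : measurable_fun setT (fun x => `|Im (f n x) - l2 x|).
  apply: measurableT_comp => //; apply: measurable_funB; apply/measurable_EFinP.
    exact: measurable_int (fi n).2.
  exact: measurable_int l2i.
have c12 : ((fun n => \int[mu]_x `|Re (f n x) - l1 x|%:E +
    \int[mu]_x `|Im (f n x) - l2 x|%:E) @ \oo --> 0)%E.
  by rewrite -[0%E]adde0; apply: cvgeD c1 c2.
apply: (squeeze_cvge _ (cvg_cst 0%E) c12).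
apply: nearW => n; apply/andP; split.
  exact: integral_nrm_ge0.
rewrite -ge0_integralD//; last 2 first.
- exact/measurable_EFinP.
- exact/measurable_EFinP.
apply: ge0_le_integral => //.
- by move=> x _; rewrite lee_fin nrm_ge0.
- have := integrableC_measurable (integrableC_lin (-1) li (fi n)).
  move=> /measurable_Enrm; congr (measurable_fun _ _); apply/funext => x.
  by rewrite mulN1r addrC.
- by apply: emeasurable_funD; exact/measurable_EFinP.
- move=> x _; rewrite -EFinD lee_fin (le_trans (nrm_le _))//.
  by rewrite -ReB -ImB.
Qed.

End complex_limit.

Lemma L1norm_class (f : L1fun mu) :
  L1norm (L1class f) = (fine (\int[mu]_x (nrm (f x))%:E))%:C%C.
Proof.
congr (_%:C)%C; rewrite /Rintegral; congr fine.
have m (g : L1fun mu) : measurable_fun setT (fun x => (nrm (g x))%:E).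
  by apply: measurable_Enrm; exact: integrableC_measurable (L1funP g).
apply: ae_eq_integral => //; first exact: (m (repr (L1class f))).
by apply: (ae_imply (L1class_repr f)) => x ->.
Qed.

Lemma L1class_lin (a : R[i]) (f g : L1fun mu) :
  L1class (a *: f + g) = a *: L1class f + L1class g.
Proof.
apply/esym/L1classP.
have h : {ae mu, forall x, (a *: L1class f : L1 mu) x = a * f x}.
  apply: (ae_imply2 (L1class_repr (a *: (repr (L1class f) : L1fun mu)))
    (L1class_repr f)) => x E1 E2.
  exact: etrans E1 (congr1 ( *%R a) E2).
by apply: (ae_imply2 h (L1class_repr g)) => x fx gx; rewrite -[RHS]/(a * f x + g x) -fx -gx.
Qed.

Lemma L1class_reprK (F : L1 mu) : L1class (repr F : L1fun mu) = F.
Proof. exact: reprK. Qed.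

Lemma L1norm_sub (f g : L1fun mu) : `|L1class f - L1class g| =
  (fine (\int[mu]_x (nrm (f x - g x))%:E))%:C%C.
Proof.
rewrite -[X in `|X - _|]addr0 addrAC.
have -> : L1class f - L1class g = L1class (-1 *: g + f).
  by rewrite L1class_lin scaleN1r addrC.
rewrite addr0 [LHS]L1norm_class; congr (fine _)%:C%C.
by apply: eq_integral => x _; rewrite -[X in nrm X]/(-1 * g x + f x) mulN1r addrC.
Qed.

Lemma L1norm_sub_fin (f g : L1fun mu) :
  (\int[mu]_x (nrm (f x - g x))%:E)%E \is a fin_num.
Proof.
rewrite ge0_fin_numE; last exact: integral_nrm_ge0.
have /integrableCP[_] := integrableC_lin (-1) (L1funP g) (L1funP f).
by congr (_ < _)%E; apply: eq_integral => x _; rewrite mulN1r addrC.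
Qed.

Lemma L1_complete (F : set_system (L1 mu)) : ProperFilter F -> cauchy F -> cvg F.
Proof.
move=> FF /cauchyP Fc.
(* This is 2^-n, written as the terms of the geometric series of [cvg_geometric_eseries_half]. *)
pose e n : R := 2 / (2 ^ (n + 1))%:R.
have e_gt0 n : 0 < e n by rewrite divr_gt0// ltr0n expn_gt0.
have eS n : e n.+1 <= e n.
  rewrite /e ler_pM2l// lef_pV2 ?posrE ?ltr0n ?expn_gt0// ler_nat.
  by rewrite leq_exp2l// leq_add2r.
have e_cvg : e n @[n --> \oo] --> 0.
  have -> : e = geometric 1 2^-1.
    apply/funext => n; rewrite /e /= mul1r addn1 natrX exprS invfM mulrA divff//.
    by rewrite mul1r exprVn.
  by apply: cvg_geometric; rewrite ger0_norm ?invr_ge0// invf_lt1 ?ltr1n.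
have e_sum : (\sum_(n <oo) (e n)%:E < +oo)%E.
  by rewrite (cvg_lim _ (@cvg_geometric_eseries_half R 2 0))// ltry.
pose r n : R[i] := (e n / 2)%:C%C.
have r_gt0 n : 0 < r n by rewrite ltcR divr_gt0.
have [x Fx] := choice (fun n => Fc _ (r_gt0 n)).
pose f n : L1fun mu := repr (x n).
have xE n : x n = L1class (f n) by rewrite L1class_reprK.
(* The balls of radius e(n)/2 and e(n+1)/2 around consecutive centres belong to the proper filter F,
   so they meet. *)
have dist n : (\int[mu]_z (nrm (f n.+1 z - f n z))%:E <= (e n)%:E)%E.
  have [y [/= y1 y2]] := filter_ex (filterI (Fx n) (Fx n.+1)).
  move: y1 y2; rewrite -!ball_normE /ball_ /= => y1 y2.
  have : `|x n.+1 - x n| <= (e n)%:C%C.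
    rewrite -(subrKA y); apply: le_trans (ler_normD _ _) _.
    rewrite [X in _ + X]distrC.
    apply: le_trans (lerD (ltW y2) (ltW y1)) _.
    rewrite -rmorphD lecR -mulrDl ler_pdivrMr// mulr_natr mulr2n lerD2r.
    exact: eS.
  by rewrite !xE L1norm_sub lecR -lee_fin fineK ?L1norm_sub_fin.
have sum_fin : (\sum_(n <oo) \int[mu]_z (nrm (f n.+1 z - f n z))%:E < +oo)%E.
  apply: le_lt_trans e_sum; apply: lee_nneseries => n _; last exact: dist.
  by move=> _; apply: integral_ge0 => z _; rewrite lee_fin nrm_ge0.
have [l li lim0] := L1_limit (fun n => L1funP (f n)) sum_fin.
pose L : L1fun mu := MkL1fun (introT (L1predP mu l) li).
apply/cvg_ex; exists (L1class L); apply/fcvg_ballP => eps eps0.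
(* Radii are elements of R[i]; a positive one is real. *)
have -> : eps = (Re eps)%:C%C.
  by case: eps eps0 => a b; rewrite ltcE/= => /andP[/eqP-> _].
have re0 : 0 < Re eps by move: eps0; rewrite ltcE => /andP[].
have re2 : 0 < Re eps / 2 by rewrite divr_gt0.
have [n [e1 e2]] : exists n, e n < Re eps /\
    (\int[mu]_z (nrm (f n z - l z))%:E < (Re eps / 2)%:E)%E.
  have n1 : \forall n \near \oo, e n < Re eps by apply: cvgr_lt e_cvg _ re0.
  have n2 : \forall n \near \oo,
    (\int[mu]_z (nrm (f n z - l z))%:E < (Re eps / 2)%:E)%E.
    have : nbhs (0 : \bar R)%E [set y | (y < (Re eps / 2)%:E)%E].
      by apply: open_ereal_lt'; rewrite lte_fin.
    by move=> /lim0.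
  by have [n [? ?]] := filter_ex (filterI n1 n2); exists n.
apply: filterS (Fx n) => y; rewrite -!ball_normE /ball_ /= => xy.
rewrite -(subrKA (x n)); apply: le_lt_trans (ler_normD _ _) _.
have -> : (Re eps)%:C%C = (Re eps / 2)%:C%C + (Re eps / 2)%:C%C.
  by rewrite -rmorphD/= -splitr.
apply: ltrD.
  rewrite distrC xE L1norm_sub ltcR -lte_fin fineK//.
  exact: L1norm_sub_fin (f n) L.
by apply: lt_trans xy _; rewrite ltcR ltr_pM2r ?invr_gt0.
Qed.

End L1_complete.

(** * The Jordan algebra L1 *)

Section special_jordan.
Variables (F : fieldType) (V : lmodType F) (p : V -> V -> V).
Hypothesis pA : forall x y z, p (p x y) z = p x (p y z).
Hypothesis plin : forall a x y z, p (a *: x + y) z = a *: p x z + p y z.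
Hypothesis prlin : forall a x y z, p x (a *: y + z) = a *: p x y + p x z.

Definition jordan_mul (x y : V) : V := 2^-1 *: (p x y + p y x).

Let pD x y z : p (x + y) z = p x z + p y z.
Proof. by have := plin 1 x y z; rewrite !scale1r. Qed.
Let prD x y z : p x (y + z) = p x y + p x z.
Proof. by have := prlin 1 x y z; rewrite !scale1r. Qed.
Let p0 z : p 0 z = 0.
Proof. by apply: (addrI (p 0 z)); rewrite -pD !addr0. Qed.
Let pr0 z : p z 0 = 0.
Proof. by apply: (addrI (p z 0)); rewrite -prD !addr0. Qed.
Let pZ a x z : p (a *: x) z = a *: p x z.
Proof. by have := plin a x 0 z; rewrite p0 !addr0. Qed.
Let prZ a x z : p x (a *: z) = a *: p x z.
Proof. by have := prlin a x z 0; rewrite pr0 !addr0. Qed.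

Lemma jordan_mulC x y : jordan_mul x y = jordan_mul y x.
Proof. by rewrite /jordan_mul addrC. Qed.

Lemma jordan_mul_linr a x y z :
  jordan_mul x (a *: y + z) = a *: jordan_mul x y + jordan_mul x z.
Proof.
rewrite /jordan_mul plin prlin scalerA mulrC -scalerA -scalerDr; congr (_ *: _).
by rewrite scalerDr addrACA.
Qed.

Lemma jordan_mul_linl a x y z :
  jordan_mul (a *: x + y) z = a *: jordan_mul x z + jordan_mul y z.
Proof. by rewrite jordan_mulC jordan_mul_linr !(jordan_mulC z). Qed.

(** About the square q of x only x q = q x is used: both sides are then 1/4 of x y q + y x q + q x y
    + q y x. *)
Lemma jordan_identity x y :
  jordan_mul (jordan_mul x y) (jordan_mul x x) =
  jordan_mul x (jordan_mul y (jordan_mul x x)).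
Proof.
have : p x (jordan_mul x x) = p (jordan_mul x x) x.
  by rewrite /jordan_mul pZ prZ pD prD pA.
move: (jordan_mul x x) => q xq.
rewrite /jordan_mul !pZ !prZ !pD !prD -!scalerDr; do 2!congr (_ *: _).
rewrite !pA xq -(pA q x y) -xq (pA x q y) -!addrA; congr (_ + _).
exact: addrCA.
Qed.

End special_jordan.

(** * Passage to classes *)

Section L1_algebra.
Variables (R : realType) (H K : topGroupType) (tau : cont_hom_Aut H K).
Hypotheses (lcH : lc_group H) (lcK : lc_group K).
Hypothesis abK : forall x y : K, (x * y)%g = (y * x)%g.
Variable muH : {measure set (borel H) -> \bar R}.
Variable muK : {measure set (borel K) -> \bar R}.
Hypotheses (haarH : left_haar muH) (haarK : left_haar muK).
Variable delta : H -> R.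
Hypothesis delta_gt0 : forall h, 0 < delta h.
Hypothesis delta_continuous : continuous delta.
Variable m : {measure set (borel (semidirect tau)) -> \bar R}.
Hypotheses (haarm : left_haar m) (mE : weighted_product muH muK delta m).

Local Notation fc := (fconv muH muK delta).

Lemma admissible_common (s : seq (L1fun m)) : exists S T,
  [/\ exhausted_subgroup S, exhausted_subgroup T &
      forall f, f \in s -> admissible m S T f].
Proof.
(* The list is read as a sequence: beyond its end [nth 0] gives the zero function, whose support is
   empty. *)
have cs n : carried [set z : H * K | (nth 0 s n : L1fun m) z != 0].
  exact: (carried_integrable lcH lcK haarm (L1funP (nth 0 s n))).
have [S [T [eS eT ST]]] := carried_exhausted lcH lcK (carried_bigcup cs).
exists S, T; split => // f /(nthP 0)[n ns <-].
have /integrableCP[mf fi] := L1funP (nth 0 s n).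
have off z : ~ (S `*` T) z -> (nth 0 s n : L1fun m) z = 0.
  by move=> nST; apply/eqP/negPn/negP => nz; apply: nST; apply: ST; exists n.
split => // [h k nS|h k nT]; apply: off => -[/= ? ?]; [exact: nS|exact: nT].
Qed.

Lemma admissible3 (f g c : L1fun m) : exists S T,
  [/\ exhausted_subgroup S, exhausted_subgroup T &
      [/\ admissible m S T f, admissible m S T g & admissible m S T c]].
Proof.
have [S [T [eS eT A]]] := admissible_common [:: f; g; c].
by exists S, T; split => //; split; apply: A; rewrite !inE eqxx ?orbT.
Qed.

Lemma admissible_integrable S T (f : H * K -> R[i]) : admissible m S T f ->
  integrableC m f.
Proof. by move=> [mf _ _ fi]; apply/integrableCP; split. Qed.

Lemma integrable_fconv (f g : L1fun m) : fc f g \in L1pred m.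
Proof.
apply/L1predP; have [S [T [eS eT [af ag _]]]] := admissible3 f g g.
apply: (@admissible_integrable S T).
exact: (fconv_admissible lcH lcK haarH haarK delta_gt0 delta_continuous haarm mE eS eT af ag).
Qed.

(** The subgroups S and T occur only in the proof of integrability, so the value does not depend on
    their choice. *)
Definition L1conv (f g : L1fun m) : L1fun m := MkL1fun (integrable_fconv f g).

Lemma integrable_fstar (f : L1fun m) : fstar f \in L1pred m.
Proof.
apply/L1predP; have [S [T [eS eT [af _ _]]]] := admissible3 f f f.
apply: (@admissible_integrable S T).
exact: (fstar_admissible lcH lcK abK haarH haarK delta_gt0 delta_continuous haarm mE eS eT af).
Qed.

Definition L1star (f : L1fun m) : L1fun m := MkL1fun (integrable_fstar f).

Lemma L1conv_linl a (f f' g : L1fun m) : L1class (L1conv (a *: f + f') g) =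
  a *: L1class (L1conv f g) + L1class (L1conv f' g).
Proof.
rewrite -L1class_lin; apply/L1classP.
have [S [T [eS eT [af af' ag]]]] := admissible3 f f' g.
exact: (fconv_linl lcH lcK haarH haarK delta_gt0 delta_continuous haarm mE eS eT a af af' ag).
Qed.

Lemma L1conv_linr a (f g g' : L1fun m) : L1class (L1conv f (a *: g + g')) =
  a *: L1class (L1conv f g) + L1class (L1conv f g').
Proof.
rewrite -L1class_lin; apply/L1classP.
have [S [T [eS eT [af ag ag']]]] := admissible3 f g g'.
exact: (fconv_linr lcH lcK haarH haarK delta_gt0 delta_continuous haarm mE eS eT a af ag ag').
Qed.

Lemma L1conv_norm (f g : L1fun m) :
  `|L1class (L1conv f g)| <= `|L1class f| * `|L1class g|.
Proof.
have [S [T [eS eT [af ag _]]]] := admissible3 f g g.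
have N := fconv_norm lcH lcK haarH haarK delta_gt0 delta_continuous haarm mE eS eT af ag.
have fin (c : L1fun m) : (\int[m]_z (nrm (c z))%:E)%E \is a fin_num.
  rewrite ge0_fin_numE; last exact: integral_nrm_ge0.
  by have /integrableCP[] := L1funP c.
have normE (c : L1fun m) : `|L1class c| = (fine (\int[m]_z (nrm (c z))%:E))%:C%C.
  exact: L1norm_class.
rewrite !normE -rmorphM lecR -fineM; try exact: fin.
by apply: fine_le; [exact: (fin (L1conv f g))|rewrite fin_numM; [|exact: fin..]|exact: N].
Qed.

(** By linearity the difference of the two products is a product with a factor of norm 0, and the
    norm bound makes it vanish. *)
Lemma L1conv_congr (f f' g g' : L1fun m) : L1class f = L1class f' ->
  L1class g = L1class g' -> L1class (L1conv f g) = L1class (L1conv f' g').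
Proof.
move=> ff' gg'; transitivity (L1class (L1conv f' g)).
  apply/esym/eqP; rewrite -subr_eq0 addrC -scaleN1r -L1conv_linl -normr_le0.
  apply: le_trans (L1conv_norm _ _) _.
  by rewrite L1class_lin ff' scaleN1r addNr normr0 mul0r.
apply/esym/eqP; rewrite -subr_eq0 addrC -scaleN1r -L1conv_linr -normr_le0.
apply: le_trans (L1conv_norm _ _) _.
by rewrite L1class_lin gg' scaleN1r addNr normr0 mulr0.
Qed.

Lemma L1convA (f g c : L1fun m) :
  L1class (L1conv (L1conv f g) c) = L1class (L1conv f (L1conv g c)).
Proof.
apply/L1classP; have [S [T [eS eT [af ag ac]]]] := admissible3 f g c.
exact: (fconvA lcH lcK haarH haarK delta_gt0 delta_continuous haarm mE eS eT af ag ac).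
Qed.

Lemma L1star_norm (f : L1fun m) : `|L1class (L1star f)| = `|L1class f|.
Proof.
have [S [T [eS eT [af _ _]]]] := admissible3 f f f.
have normE (c : L1fun m) : `|L1class c| = (fine (\int[m]_z (nrm (c z))%:E))%:C%C.
  exact: L1norm_class.
rewrite !normE; congr (fine _)%:C%C.
exact: (fstar_integral lcH lcK abK haarH haarK delta_gt0 delta_continuous haarm mE eS eT af).
Qed.

Lemma L1star_semilinear a (f g : L1fun m) : L1class (L1star (a *: f + g)) =
  (a^*)%C *: L1class (L1star f) + L1class (L1star g).
Proof.
rewrite -L1class_lin; apply/L1classP; apply: nearW => z.
rewrite -[LHS]/((a * f (z.1, (z.2^-1)%g) + g (z.1, (z.2^-1)%g))^*)%C.
by rewrite rmorphD rmorphM.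
Qed.

Lemma L1star_congr (f f' : L1fun m) : L1class f = L1class f' ->
  L1class (L1star f) = L1class (L1star f').
Proof.
move=> ff'; apply/eqP; rewrite -subr_eq0 -normr_eq0 addrC -scaleN1r.
have -> : -1 = ((-1)^*)%C :> R[i] by rewrite rmorphN rmorph1.
by rewrite -L1star_semilinear L1star_norm L1class_lin ff' scaleN1r addNr normr0.
Qed.

Lemma L1starK (f : L1fun m) : L1class (L1star (L1star f)) = L1class f.
Proof.
apply/L1classP; apply: nearW => -[h k].
by rewrite /L1star /= /fstar /= invgK conjcK.
Qed.

Lemma L1conv_star (f g : L1fun m) :
  L1class (L1conv (L1star f) (L1star g)) = L1class (L1star (L1conv f g)).
Proof.
apply/L1classP; apply: nearW => z.
have [S [T [eS eT [af ag _]]]] := admissible3 f g g.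
exact: (fconv_fstar lcH lcK abK haarH haarK delta_continuous eS eT z af ag).
Qed.

Definition prodL1 (x y : L1 m) : L1 m :=
  L1class (L1conv (repr x : L1fun m) (repr y : L1fun m)).
Definition starL1 (x : L1 m) : L1 m := L1class (L1star (repr x : L1fun m)).

Lemma prodL1E (f g : L1fun m) : prodL1 (L1class f) (L1class g) = L1class (L1conv f g).
Proof. by apply: L1conv_congr; exact: L1class_reprK. Qed.

Lemma starL1E (f : L1fun m) : starL1 (L1class f) = L1class (L1star f).
Proof. by apply: L1star_congr; exact: L1class_reprK. Qed.

Lemma prodL1A x y z : prodL1 (prodL1 x y) z = prodL1 x (prodL1 y z).
Proof.
rewrite -(L1class_reprK x) -(L1class_reprK y) -(L1class_reprK z) !prodL1E.
exact: L1convA.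
Qed.

Lemma prodL1_linl a x y z : prodL1 (a *: x + y) z = a *: prodL1 x z + prodL1 y z.
Proof.
rewrite -(L1class_reprK x) -(L1class_reprK y) -(L1class_reprK z).
by rewrite -L1class_lin !prodL1E L1conv_linl.
Qed.

Lemma prodL1_linr a x y z : prodL1 x (a *: y + z) = a *: prodL1 x y + prodL1 x z.
Proof.
rewrite -(L1class_reprK x) -(L1class_reprK y) -(L1class_reprK z).
by rewrite -L1class_lin !prodL1E L1conv_linr.
Qed.

Lemma starL1_semilinear a x y : starL1 (a *: x + y) = (a^*)%C *: starL1 x + starL1 y.
Proof.
rewrite -(L1class_reprK x) -(L1class_reprK y).
by rewrite -L1class_lin !starL1E L1star_semilinear.
Qed.

Lemma prodL1_star x y : prodL1 (starL1 x) (starL1 y) = starL1 (prodL1 x y).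
Proof.
rewrite -(L1class_reprK x) -(L1class_reprK y) !(prodL1E, starL1E).
exact: L1conv_star.
Qed.

Lemma L1_jordan_banach_star_algebra :
  jordan_banach_star_algebra (jordan_mul prodL1) starL1.
Proof.
have star_jordan x y :
    starL1 (jordan_mul prodL1 x y) = jordan_mul prodL1 (starL1 x) (starL1 y).
  have star0 : starL1 0 = 0 by rewrite -[0]/(L1class 0) starL1E;
    apply/L1classP; apply: nearW => z; exact: conjc0.
  rewrite /jordan_mul -[X in starL1 X]addr0 starL1_semilinear star0 addr0.
  rewrite -[prodL1 x y in LHS]scale1r starL1_semilinear conjc1 scale1r !prodL1_star.
  by rewrite fmorphV rmorph_nat.
split; last 2 first.
- exact: jordan_mulC.
- by move=> x y; apply: jordan_identity; [exact: prodL1A|exact: prodL1_linl|exact: prodL1_linr].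
split.
- exact: L1_complete.
- by move=> a x y z; apply: jordan_mul_linl; [exact: prodL1_linl|exact: prodL1_linr].
- by move=> a x y z; apply: jordan_mul_linr; [exact: prodL1_linl|exact: prodL1_linr].
- move=> x y; rewrite /jordan_mul normrZ ger0_norm ?invr_ge0// mulrC ler_pdivrMr//.
  apply: le_trans (ler_normD _ _) _.
  rewrite mulr_natr mulr2n; apply: lerD.
    rewrite -(L1class_reprK x) -(L1class_reprK y) prodL1E; exact: L1conv_norm.
  rewrite mulrC -(L1class_reprK x) -(L1class_reprK y) prodL1E; exact: L1conv_norm.
- exact: starL1_semilinear.
- by move=> x; rewrite -(L1class_reprK x) starL1E L1star_norm.
- by move=> x; rewrite -(L1class_reprK x) !starL1E L1starK.
(* [starL1] keeps the order of the factors; commutativity of the Jordan product supplies the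
   reversal. *)
- by move=> x y; rewrite star_jordan jordan_mulC.
Qed.

Lemma L1_is_tau_convolution : is_tau_convolution muH muK delta (jordan_mul prodL1).
Proof.
move=> f g; have [S [T [eS eT [af ag _]]]] := admissible3 f g g.
have b1 := fbound_ae lcH lcK haarH haarK delta_gt0 delta_continuous haarm mE eS eT af ag.
have b2 := fbound_ae lcH lcK haarH haarK delta_gt0 delta_continuous haarm mE eS eT ag af.
have C z := @tau_conv_fconv _ _ _ _ lcH lcK abK _ _ haarH haarK _ delta_gt0
  delta_continuous m _ _ eS eT f g z af ag.
split; first by apply: (ae_imply2 b1 b2) => z z1 z2; have [] := C z z1 z2.
(* A representative of the Jordan product; the factor 1 and the summand 0 give it the shape
   [a *: f + g] of [L1class_lin]. *)
pose c : L1fun m := 2^-1 *: (1 *: L1conv f g + L1conv g f) + 0.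
have -> : jordan_mul prodL1 (L1class f) (L1class g) = L1class c.
  by rewrite /jordan_mul !prodL1E !L1class_lin scale1r; apply/esym; exact: addr0.
apply: (ae_imply2 (ae_imply2 b1 b2 C) (L1class_repr c)) => z [_ ->] ->.
rewrite -[LHS]/(2^-1 * (1 * fc f g z + fc g f z) + 0).
by rewrite mul1r addr0.
Qed.

Lemma L1_is_tau_involution (DeltaK : K -> R) : modular_function muK DeltaK ->
  is_tau_involution DeltaK starL1.
Proof.
move=> modK f; rewrite starL1E; apply: (ae_imply (L1class_repr (L1star f))) => z ->.
rewrite /tau_inv /involution (abelian_modular lcK abK haarK modK) mul1r.
by case: z.
Qed.

End L1_algebra.

Theorem corollary3p17 (R : realType) (H K : topGroupType)
  (lcH : lc_group H) (lcK : lc_group K)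
  (abK : forall x y : K, (x * y)%g = (y * x)%g)
  (tau : cont_hom_Aut H K)
  (muH : {measure set (borel H) -> \bar R})
  (muK : {measure set (borel K) -> \bar R})
  (haarH : left_haar muH) (haarK : left_haar muK)
  (DeltaK : K -> R) (modK : modular_function muK DeltaK)
  (delta : H -> R) (modtau : aut_modulus tau muK delta)
  (m : {measure set (borel (semidirect tau)) -> \bar R})
  (haarm : left_haar m) (mE : weighted_product muH muK delta m) :
  exists (mul : L1 m -> L1 m -> L1 m) (star : L1 m -> L1 m),
    [/\ is_tau_convolution muH muK delta mul,
        is_tau_involution DeltaK star &
        jordan_banach_star_algebra mul star].
Proof.
have d0 := modulus_gt0 modtau; have dc := modulus_continuous modtau.
exists (jordan_mul (prodL1 lcH lcK haarH haarK d0 dc haarm mE)).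
exists (starL1 lcH lcK abK haarH haarK d0 dc haarm mE); split.
- exact: L1_is_tau_convolution.
- exact: L1_is_tau_involution.
- exact: L1_jordan_banach_star_algebra.
Qed.
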